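(* Let $\mathcal X=C_0([0,T];\mathbb R^d)$, let $\mu$ be the Wiener measure on $\mathcal X$ and $X$ the canonical process. Assume $f\in\mathbb D^1_b$ and $f(X)\in\mathbf D^{1,2}$. Then $$(\mathbb D_tf)(X)=\mathbf D_tf(X)\qquad d\mu\otimes dt\text{-a.e.},$$ where $\mathbb D$ is the pathwise Malliavin derivative and $\mathbf D$ is the classical Malliavin derivative.
   Context: Classical Malliavin derivative: for $F=g(\int_0^T\langle k_t,dX_t\rangle)$ with $g\in C^1_b$ and $k\in L^2([0,T];\mathbb R^d)$, $\mathbf D_tF=g'(\int_0^T\langle k_s,dX_s\rangle)k_t$; $\mathbf D$ also denotes the closure of this operator on $L^2(\mu)$ (the usual Malliavin derivative) and $\mathbf D^{1,2}$ its domain. Pathwise Malliavin derivative: let $D([0,T];\mathbb R^d)$ be the space of càdlàg paths. A functional $\tilde f:D([0,T];\mathbb R^d)\to\mathbb R$ is pathwise Malliavin differentiable if there is $\mathbb D\tilde f:D([0,T];\mathbb R^d)\times[0,T]\to\mathbb R^d$ with $$\langle\mathbb D_t\tilde f(\omega),e\rangle=\lim_{\varepsilon\to0}\frac{\tilde f(\omega+\varepsilon e\mathbf 1_{[t,T]})-\tilde f(\omega)}{\varepsilon}\quad\text{for all }\omega\in D([0,T];\mathbb R^d),\ e\in\mathbb R^d.$$ A functional $F$ on $[0,T]\times D([0,T];\mathbb R^d)$ has a left limit at $t$ if for every $\omega^n\to\omega$ uniformly and $t^n$ increasing to $t$ the limit $\lim_nF(t^n,\omega^n)=:F(t-,\omega)$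 exists; $F$ is boundedness preserving if $\sup_{t\in[0,T]}\sup_{\|\omega\|_\infty<K}|F(t,\omega)|<\infty$ for every $K$. $\mathbb D^1_b$ is the set of functionals $f:C_0([0,T];\mathbb R^d)\to\mathbb R$ admitting an extension $\tilde f$ to $D([0,T];\mathbb R^d)$ which is pathwise Malliavin differentiable, such that $\tilde f$ and all $\mathbb D_t\tilde f$, $t\in[0,T]$, are continuous for the uniform topology, and $\mathbb D\tilde f$ has a left limit at every $t\in[0,T]$ and is boundedness preserving. For such $f$, $\mathbb D_tf(\omega):=\mathbb D_t\tilde f(\omega)$ for $\omega\in C_0([0,T];\mathbb R^d)$. *)

(* Defs.v *)
From HB Require Import structures.
From mathcomp Require Import all_boot all_order all_algebra.
From mathcomp Require Import all_classical all_reals all_analysis.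

Set Implicit Arguments.
Unset Strict Implicit.
Unset Printing Implicit Defensive.
Import Order.TTheory GRing.Theory Num.Theory.
Import numFieldNormedType.Exports.

Local Open Scope classical_set_scope.
Local Open Scope ring_scope.

(* The interval [0, T] as a type, with the library's subtype topology. *)
Definition time (R : realType) (T : R) : Type := set_type `[0, T]%classic.

HB.instance Definition _ (R : realType) (T : R) :=
  PseudoMetric.copy (time T) (set_type `[0, T]%classic).

Definition clock (R : realType) (T : R) (t : time T) : R := set_val t.

Section euclidean.
Context {R : realType} {d : nat}.

Definition inner (u v : 'rV[R]_d) : R := \sum_j u 0 j * v 0 j.

Definition enorm (u : 'rV[R]_d) : R := Num.sqrt (inner u u).

(* Borel measurability of a vector-valued map, stated on its coordinates. *)
Definition vmeasurable {dS} {S : measurableType dS} (A : set S)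
    (u : S -> 'rV[R]_d) : Prop :=
  forall j, measurable_fun A (fun x => u x 0 j).

(* Square of the norm of u in L^2(A, m; R^d). *)
Definition sqL2 {dS} {S : measurableType dS} (m : {measure set S -> \bar R}) (A : set S)
    (u : S -> 'rV[R]_d) : \bar R :=
  (\int[m]_(x in A) (enorm (u x) ^+ 2)%:E)%E.

End euclidean.

Section paths.
Context {R : realType}.
Variables (T : R) (d : nat).

(* At t = T, resp. t = 0, the filter is improper and the condition void. *)
Definition path_right_continuous (w : time T -> 'rV[R]_d) : Prop :=
  forall t : time T,
    w s @[s --> within [set s : time T | clock t < clock s] (nbhs t)] --> w t.

Definition path_left_limits (w : time T -> 'rV[R]_d) : Prop :=
  forall t : time T, exists l : 'rV[R]_d,
    w s @[s --> within [set s : time T | clock s < clock t] (nbhs t)] --> l.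

(* D([0,T]; R^d) *)
Record cadlag := Cadlag {
  cadlag_fun :> time T -> 'rV[R]_d ;
  cadlag_right : path_right_continuous cadlag_fun ;
  cadlag_left : path_left_limits cadlag_fun }.

(* C_0([0,T]; R^d): continuous paths started at the origin *)
Record C0 := MkC0 {
  C0_fun :> time T -> 'rV[R]_d ;
  C0_continuous : continuous C0_fun ;
  C0_start : forall t : time T, clock t = 0 -> C0_fun t = 0 }.

HB.instance Definition _ := gen_eqMixin cadlag.
HB.instance Definition _ := gen_choiceMixin cadlag.

(* D([0,T]; R^d) carries the topology of uniform convergence. *)
Definition cadlag_uniform (w : cadlag) : {uniform time T -> 'rV[R]_d} := w.

HB.instance Definition _ :=
  Uniform.copy cadlag (initial_topology cadlag_uniform).

Definition C0_zero : C0 :=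
  @MkC0 (cst 0) (@cst_continuous _ _ _) (fun _ _ => erefl).

HB.instance Definition _ := gen_eqMixin C0.
HB.instance Definition _ := gen_choiceMixin C0.
HB.instance Definition _ := isPointed.Build C0 C0_zero.

(* C_0 carries the sigma-algebra generated by the canonical process
   X_t(w) = w t, i.e. the Borel sigma-algebra of the uniform topology. *)
Definition cylinders : set (set C0) :=
  [set B | exists (t : time T) (j : 'I_d) (A : set R),
    measurable A /\ B = [set w : C0 | A (w t 0 j)]].

HB.instance Definition _ := Measurable.copy C0 (g_sigma_algebraType cylinders).

Lemma C0_right (w : C0) : path_right_continuous w.
Proof. by move=> t; apply: cvg_within_filter; exact: C0_continuous. Qed.

Lemma C0_left (w : C0) : path_left_limits w.
Proof.
by move=> t; exists (w t); apply: cvg_within_filter; exact: C0_continuous.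
Qed.

Definition C0_cadlag (w : C0) : cadlag :=
  Cadlag (@C0_right w) (@C0_left w).

Definition jump_at_fun (w : cadlag) (t : time T) (v : 'rV[R]_d) (s : time T) :
    'rV[R]_d :=
  w s + (if clock t <= clock s then v else 0).

Lemma near_val_lt (t : time T) (a : R) :
  clock t < a -> \forall s \near t, clock s < a.
Proof.
move=> ta.
exact: (@initial_continuous (set_type `[0, T]%classic) R set_val t _
  (lt_nbhsl ta)).
Qed.

Lemma near_val_gt (t : time T) (a : R) :
  a < clock t -> \forall s \near t, a < clock s.
Proof.
move=> ta.
exact: (@initial_continuous (set_type `[0, T]%classic) R set_val t _
  (lt_nbhsr ta)).
Qed.

Lemma jump_at_right (w : cadlag) t v : path_right_continuous (jump_at_fun w t v).
Proof.
move=> t0; apply: cvgD; first exact: cadlag_right.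
apply: cvg_near_cst; rewrite near_withinE.
have [tt0|t0t] := leP (clock t) (clock t0).
  by apply: nearW => s /= /ltW /(le_trans tt0) ->.
by near=> s => _; rewrite leNgt (near (near_val_lt t0t) s).
Unshelve. all: by end_near. Qed.

Lemma jump_at_left (w : cadlag) t v : path_left_limits (jump_at_fun w t v).
Proof.
move=> t0; have [l wl] := cadlag_left w t0.
have [t0t|tt0] := leP (clock t0) (clock t).
  exists (l + 0); apply: cvgD => //; apply: cvg_near_cst.
  rewrite near_withinE; apply: nearW => s /= st0.
  by rewrite leNgt (lt_le_trans st0 t0t).
exists (l + v); apply: cvgD => //; apply: cvg_near_cst; rewrite near_withinE.
by near=> s => _; rewrite ltW// (near (near_val_gt tt0) s).
Unshelve. all: by end_near. Qed.

(* w + v 1_[t,T] *)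
Definition jump_at (w : cadlag) (t : time T) (v : 'rV[R]_d) : cadlag :=
  Cadlag (@jump_at_right w t v) (@jump_at_left w t v).

Section pathwise.
Implicit Types (f : C0 -> R) (ft : cadlag -> R)
  (Dft : time T -> cadlag -> 'rV[R]_d).

Definition pathwise_derivative ft Dft : Prop :=
  forall (t : time T) (w : cadlag) (e : 'rV[R]_d),
    (ft (jump_at w t (eps *: e)) - ft w) / eps @[eps --> 0^'] --> inner (Dft t w) e.

(* l is the functional F(t-, .). *)
Definition has_left_limit (F : time T -> cadlag -> 'rV[R]_d) (t : time T) :
    Prop :=
  exists l : cadlag -> 'rV[R]_d,
    forall (w : cadlag) (w_ : nat -> cadlag) (t_ : nat -> time T),
      w_ n @[n --> \oo] --> w ->
      (forall n, clock (t_ n) <= clock (t_ n.+1)) ->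
      (forall n, clock (t_ n) < clock t) ->
      t_ n @[n --> \oo] --> t ->
      F (t_ n) (w_ n) @[n --> \oo] --> l w.

Definition sup_norm (w : cadlag) : \bar R :=
  ereal_sup [set (enorm (w t))%:E | t in [set: time T]].

Definition boundedness_preserving (F : time T -> cadlag -> 'rV[R]_d) : Prop :=
  forall K : R, exists M : R, forall (t : time T) (w : cadlag),
    (sup_norm w < K%:E)%E -> enorm (F t w) <= M.

Definition D1b_extension f ft Dft : Prop :=
  [/\ forall w : C0, ft (C0_cadlag w) = f w,
      pathwise_derivative ft Dft,
      continuous ft /\ (forall t, continuous (Dft t)),
      forall t, has_left_limit Dft t &
      boundedness_preserving Dft].

Definition D1b f : Prop := exists ft Dft, D1b_extension f ft Dft.

(* Df is a pathwise Malliavin derivative of f; it is defined through an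
   extension of f to cadlag paths, which need not be unique. *)
Definition D1b_derivative f (Df : time T -> C0 -> 'rV[R]_d) : Prop :=
  exists ft Dft, D1b_extension f ft Dft /\
    forall t (w : C0), Df t w = Dft t (C0_cadlag w).

End pathwise.

(* The increments of the canonical process over consecutive intervals, and
   the coordinates of each of them, are independent centered Gaussians of
   variance the length of the interval (normal_prob takes the standard
   deviation). The paths start at 0, so this determines mu. *)
Definition wiener_measure (mu : probability C0 R) : Prop :=
  forall (n : nat) (t : nat -> time T) (A : 'I_n -> 'I_d -> set R),
    (forall i : 'I_n, clock (t i) < clock (t i.+1)) ->
    (forall i j, measurable (A i j)) ->
    mu [set w : C0 | forall i j, A i j (w (t i.+1) 0 j - w (t i) 0 j)] =
    (\prod_(i < n) \prod_(j < d)
      normal_prob 0 (Num.sqrt (clock (t i.+1) - clock (t i))) (A i j))%E.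

Section malliavin.
Variable mu : probability C0 R.
Local Notation itvT := `[0%R, T]%classic.

(* The list of the (c, a, b) stands for the integrand \sum c 1_]a,b]. *)
Definition simple_integrand := seq ('rV[R]_d * time T * time T).

Definition simple_wf (s : simple_integrand) : bool :=
  all (fun p => clock p.1.2 <= clock p.2) s.

Definition simple_fun (s : simple_integrand) (u : R) : 'rV[R]_d :=
  \sum_(p <- s) (clock p.1.2 < u <= clock p.2)%R%:R *: p.1.1.

Definition simple_integral (s : simple_integrand) (w : C0) : R :=
  \sum_(p <- s) inner p.1.1 (w p.2 - w p.1.2).

(* k \in L^2([0,T]; R^d); the values of k outside [0,T] are irrelevant. *)
Definition L2_integrand (k : R -> 'rV[R]_d) : Prop :=
  vmeasurable itvT k /\ (sqL2 (@lebesgue_measure R) itvT k < +oo)%E.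

(* W is a version of \int_0^T <k_t, dX_t>. *)
Definition wiener_integral (k : R -> 'rV[R]_d) (W : C0 -> R) : Prop :=
  measurable_fun [set: C0] W /\
  exists s_ : nat -> simple_integrand,
    [/\ forall n, simple_wf (s_ n),
        sqL2 (@lebesgue_measure R) itvT (fun u => simple_fun (s_ n) u - k u)
          @[n --> \oo] --> 0%E &
        'N[mu]_2%:E[EFin \o (simple_integral (s_ n) \- W)%R]%E
          @[n --> \oo] --> 0%E].

Definition C1b (g : R -> R) : Prop :=
  [/\ forall x, derivable g x 1,
      continuous g^`()%classic &
      exists M, forall x, `|g x| <= M /\ `|g^`()%classic x| <= M].

Definition elementary (F : C0 -> R) (Y : C0 * R -> 'rV[R]_d) : Prop :=
  exists (g : R -> R) (k : R -> 'rV[R]_d) (W : C0 -> R),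
    [/\ C1b g, L2_integrand k, wiener_integral k W,
        F = (fun w => g (W w)) &
        Y = (fun p => g^`()%classic (W p.1) *: k p.2)].

(* The linear extension of the operator; scalar multiples of elementary pairs
   are elementary. *)
Definition elementary_span (F : C0 -> R) (Y : C0 * R -> 'rV[R]_d) : Prop :=
  exists (m : nat) (F_ : 'I_m -> C0 -> R) (Y_ : 'I_m -> C0 * R -> 'rV[R]_d),
    [/\ forall i, elementary (F_ i) (Y_ i),
        F = (fun w => \sum_i F_ i w) &
        Y = (fun p => \sum_i Y_ i p)].

(* (F, Y) belongs to the closure of the graph in
   L^2(mu) x L^2(mu \otimes dt; R^d): F is in D^{1,2} and Y is a version of its
   Malliavin derivative, Y (w, t) being D_t F (w) for t in [0, T]. *)
Definition malliavin_derivative (F : C0 -> R) (Y : C0 * R -> 'rV[R]_d) : Prop :=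
  [/\ measurable_fun [set: C0] F,
      vmeasurable ([set: C0] `*` itvT) Y &
      exists (F_ : nat -> C0 -> R) (Y_ : nat -> C0 * R -> 'rV[R]_d),
        [/\ forall n, elementary_span (F_ n) (Y_ n),
            'N[mu]_2%:E[EFin \o (F_ n \- F)%R]%E @[n --> \oo] --> 0%E &
            sqL2 (mu \x lebesgue_measure)%E ([set: C0] `*` itvT)
              (fun p => Y_ n p - Y p) @[n --> \oo] --> 0%E]].

Definition D12 (F : C0 -> R) : Prop := exists Y, malliavin_derivative F Y.

End malliavin.

End paths.

(* Main.v *)
(* Fix a coordinate [j], a time [b], and the Cameron-Martin shifts
   [tau_x w = w + x e_j min(., b)]. The difference quotient
   [m (f (tau_{1/m} w) - f w)] has two limits as [m] tends to infinity.
   Pathwise, a staircase of [n] small jumps replaces the shift; telescoping and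
   the mean value theorem along each jump turn the quotient into a Riemann sum,
   so for every [w] it converges to the integral over [0, b] of the [j]-th
   coordinate of the left limit of the pathwise derivative. On the other hand, if
   [f] is an elementary functional with derivative [Y], the quotient converges in
   [L^1] to the integral of [Y_j] over [0, b]; the Cameron-Martin density controls
   shifted errors in [L^1] by unshifted errors in [L^2], uniformly in [m], so this
   passes to the closure of the operator. By Fatou's lemma the two integrals agree
   almost surely, for all rational [b] at once, and Lebesgue differentiation
   identifies [Y_j] with the left limit almost everywhere. Finally, the left limit
   equals the derivative itself outside a countable set of times, which does not
   depend on [w] because it can be read off a countable uniformly dense family of
   step paths. *)

Require Import Defs.
From HB Require Import structures.
From mathcomp Require Import all_boot all_order all_algebra.
From mathcomp Require Import all_classical all_reals all_analysis.
From mathcomp Require Import measurable_realfun lebesgue_integral_fubini ring lra.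

Set Implicit Arguments.
Unset Strict Implicit.
Unset Printing Implicit Defensive.
Import Order.TTheory GRing.Theory Num.Theory.
Import numFieldNormedType.Exports.

Local Open Scope classical_set_scope.
Local Open Scope ring_scope.

(** * Change of density and independent products *)

(** [wiener_measure] only gives the joint laws of increments along grids, and [pathwise_derivative]
    only sees jumps; a Cameron-Martin shift is neither. Adding [b] to a grid makes the shift
    translate each increment by a constant, so the density formula reduces to a one-dimensional
    Gaussian translation. On the pathwise side the number of jumps is chosen after [m], large enough
    that replacing the shift by a staircase costs at most [1 / (m + 1)] even after multiplication by
    [m + 1]. The detour through the left limit has two causes. In the Riemann sums the jump times
    approach [t] strictly from below. Moreover, joint measurability of the derivative in path and
    time is not given, whereas the left limit is a pointwise limit of staircases and can enter
    Tonelli's theorem. Cadlag paths are not separable for the uniform topology: step paths with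
    rational data come close to every continuous path but not to every cadlag one. Both
    measurability and the choice of the countable set of times are therefore settled on continuous
    paths only. *)

Section density_transfer.
Local Open Scope ereal_scope.
Context d1 d2 (X : measurableType d1) (Y : measurableType d2) (R : realType).
Variables (U : X -> Y) (mU : measurable_fun [set: X] U).
Variables (m1 : {measure set X -> \bar R}) (m2 : {measure set Y -> \bar R}).
Variables (psi : X -> R).
Hypothesis mpsi : measurable_fun [set: X] psi.
Hypothesis psi0 : forall x, (0 <= psi x)%R.
Hypothesis psiE : forall A, measurable A -> \int[m1]_(x in U @^-1` A) (psi x)%:E = m2 A.

Import HBNNSimple.

(** Simple functions reduce the identity to [psiE], and monotone convergence does the rest. Treating
    the map [U] and the density [psi] together lets one statement serve independence, translation of
    Lebesgue measure, the Gaussian density and the Cameron-Martin density. *)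
Lemma ge0_integral_density_comp (phi : Y -> \bar R) :
  measurable_fun [set: Y] phi -> (forall y, 0 <= phi y) ->
  \int[m1]_x (phi (U x) * (psi x)%:E) = \int[m2]_y phi y.
Proof.
move=> mphi phi0.
pose f_ := nnsfun_approx measurableT mphi.
have mfU n : measurable_fun [set: X] (fun x => (f_ n (U x))%:E).
  by apply/measurable_EFinP; apply: measurableT_comp => //; exact: measurable_funP.
transitivity (limn (fun n => \int[m1]_x ((f_ n (U x))%:E * (psi x)%:E))).
  rewrite -monotone_convergence//.
  - apply: eq_integral => x _; apply/esym/cvg_lim => //.
    apply: cvgeZr => //.
    by apply: (@cvg_nnsfun_approx _ _ _ setT measurableT phi mphi) => // *; exact: phi0.
  - by move=> n; apply: emeasurable_funM => //; exact/measurable_EFinP.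
  - by move=> n x _; rewrite mule_ge0// lee_fin.
  - move=> x _ m n mn; rewrite lee_wpmul2r ?lee_fin//.
    exact/lefP/nd_nnsfun_approx.
transitivity (limn (fun n => \int[m2]_y (f_ n y)%:E)); last first.
  rewrite -monotone_convergence//.
  - apply: eq_integral => y _; apply/cvg_lim => //.
    by apply: (@cvg_nnsfun_approx _ _ _ setT measurableT phi mphi) => // *; exact: phi0.
  - by move=> n; exact/measurable_EFinP/measurable_funP.
  - by move=> n y _; rewrite lee_fin.
  - by move=> y _ m n mn; rewrite lee_fin; exact/lefP/nd_nnsfun_approx.
congr (limn _); apply/funext => n.
have mfn r : measurable (U @^-1` (f_ n @^-1` [set r])).
  by rewrite -[X in measurable X]setTI; exact: mU.
transitivity (\sum_(k \in range (f_ n)) k%:E * m2 (f_ n @^-1` [set k])); last first.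
  by rewrite integralT_nnsfun sintegralE.
transitivity (\sum_(k \in range (f_ n)) \int[m1]_x (k%:E * ((\1_(U @^-1` (f_ n @^-1` [set k])) x)%:E * (psi x)%:E))).
  rewrite -ge0_integral_fsum//.
  - apply: eq_integral => x _; rewrite fimfunE -fsumEFin// ge0_mule_fsuml.
      by apply: eq_fsbigr => r _; rewrite EFinM muleA.
    by move=> r; exact: (@nnfun_muleindic_ge0 _ _ _ (f_ n)).
  - move=> r; do 2 apply: emeasurable_funM => //; apply/measurable_EFinP => //.
  - by move=> r x _; rewrite muleA; apply: mule_ge0; rewrite ?lee_fin//; exact: (@nnfun_muleindic_ge0 _ _ _ (f_ n) r (U x)).
apply: eq_fsbigr => r /set_mem [y _ <-].
rewrite ge0_integralZl//; last 3 first.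
  - by apply: emeasurable_funM; exact/measurable_EFinP.
  - by move=> x _; rewrite mule_ge0// lee_fin.
  - by rewrite lee_fin.
congr (_ * _); rewrite -psiE//.
rewrite [RHS]integral_mkcond; apply: eq_integral => x _.
rewrite /patch indicE; case: ifPn => _; by rewrite ?mul1e ?mul0e.
Qed.

End density_transfer.

Section independence.
Local Open Scope ereal_scope.
Context d (X : measurableType d) (R : realType) (m : {measure set X -> \bar R}).
Variables (Q : finType) (U : Q -> X -> R) (P : Q -> probability (measurableTypeR R) R).
Hypothesis mU : forall q, measurable_fun [set: X] (U q).
Hypothesis indep : forall A : Q -> set R, (forall q, measurable (A q)) ->
  m [set w | forall q, A q (U q w)] = \prod_q P q (A q).

Lemma prode_fin_num (I : Type) (r : seq I) (p : pred I) (F : I -> \bar R) :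
  (forall i, F i \is a fin_num) -> \prod_(i <- r | p i) F i \is a fin_num.
Proof. by move=> h; elim/big_ind : _ => // x y hx hy; rewrite fin_numM. Qed.

Lemma ge0_integral_prod_indep (psi : Q -> R -> R) :
  (forall q, measurable_fun [set: R] (psi q)) -> (forall q x, (0 <= psi q x)%R) ->
  (forall q, \int[P q]_x (psi q x)%:E \is a fin_num) ->
  \int[m]_w (\prod_q psi q (U q w))%:E = \prod_q \int[P q]_x (psi q x)%:E.
Proof.
(* The induction is on a list containing every index whose factor is not yet an indicator; for the
   empty list the claim is [indep]. *)
suff main (r : seq Q) : uniq r -> forall psi : Q -> R -> R,
    (forall q, measurable_fun [set: R] (psi q)) -> (forall q x, (0 <= psi q x)%R) ->
    (forall q, \int[P q]_x (psi q x)%:E \is a fin_num) ->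
    (forall q, q \notin r -> exists2 A, measurable A & psi q = \1_A) ->
    \int[m]_w (\prod_q psi q (U q w))%:E = \prod_q \int[P q]_x (psi q x)%:E.
  by move=> ? ? ?; apply: (main (enum Q)); rewrite ?enum_uniq// => q; rewrite mem_enum.
elim: r => [_|q0 r IH /= /andP[q0r ur]] {}psi mpsi psi0 fpsi indic.
  have {}indic q : exists A : set R, measurable A /\ psi q = \1_A.
    by have [//|A mA ->] := indic q; exists A.
  have [A /all_and2[mA psiA]] := choice indic.
  rewrite [RHS](eq_bigr (fun q => P q (A q))); last first.
    by move=> q _; rewrite psiA integral_indic ?setIT//; exact: mA.
  rewrite -indep//.
  have mAU : measurable [set w | forall q, A q (U q w)].
    rewrite [X in measurable X](_ : _ = \big[setI/setT]_q (U q @^-1` A q)).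
      apply: big_ind => //; first exact: measurableI.
      by move=> q _; rewrite -[X in measurable X]setTI; exact: mU.
    rewrite -bigcap_seq.
    apply/seteqP; split=> w /= h q; first by move=> _; exact: h.
    by apply: (h q) => /=; rewrite mem_index_enum.
  rewrite -[X in m X]setIT -[RHS]integral_indic//.
  apply: eq_integral => w _; congr _%:E; rewrite indicE.
  case: (pselect (forall q, A q (U q w))) => h.
    by rewrite mem_set// big1// => q _; rewrite psiA indicE mem_set.
  rewrite memNset//; move/existsNP : h => [q h].
  by rewrite (bigD1 q)//= psiA indicE memNset// mul0r.
(* Putting an arbitrary indicator at [q0] shows that, weighted by the other factors, the law of
   [U q0] is [K] times [P q0]; the density lemma then restores [psi q0]. Finiteness of [K] is what
   allows it to be a factor of [mscale]. *)
pose psi' B q := if q == q0 then \1_B else psi q.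
have mpsi' B : measurable B -> forall q, measurable_fun [set: R] (psi' B q).
  by move=> mB q; rewrite /psi'; case: ifP => // _; exact: measurable_indic.
pose K := \prod_(q | q != q0) \int[P q]_x (psi q x)%:E.
have K0 : 0 <= K by apply: prode_ge0 => q _; apply: integral_ge0 => x _; rewrite lee_fin.
have Kfin : K \is a fin_num by exact: prode_fin_num.
have step B : measurable B ->
    \int[m]_(w in U q0 @^-1` B) (\prod_(q | q != q0) psi q (U q w))%:E = K * P q0 B.
  move=> mB; transitivity (\int[m]_w (\prod_q psi' B q (U q w))%:E).
    rewrite [LHS]integral_mkcond; apply: eq_integral => w _.
    rewrite /patch [in RHS](bigD1 q0)//= {1}/psi' eqxx indicE.
    have -> : (w \in U q0 @^-1` B) = (U q0 w \in B) by [].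
    case: ifPn => _; last by rewrite mul0r.
    by rewrite mul1r; congr _%:E; apply: eq_bigr => q qq0; rewrite /psi' (negbTE qq0).
  rewrite IH//; last 4 first.
  - exact: mpsi'.
  - by move=> q x; rewrite /psi'; case: ifP => // _; rewrite indicE.
  - move=> q; rewrite /psi'; case: ifP => // _.
    by rewrite integral_indic ?setIT//; exact: fin_num_measure.
  - move=> q qr; rewrite /psi'; case: ifPn => [_|qq0]; first by exists B.
    by apply: indic; rewrite inE negb_or qq0.
  rewrite (bigD1 q0)//= {1}/psi' eqxx integral_indic ?setIT// muleC; congr (_ * _).
  by apply: eq_bigr => q qq0; rewrite /psi' (negbTE qq0).
have K0' : (0 <= fine K)%R by exact: fine_ge0.
have := @ge0_integral_density_comp _ _ X (measurableTypeR R) R (U q0) (mU q0) m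
  (mscale (NngNum K0') (P q0)) (fun w => \prod_(q | q != q0) psi q (U q w))%R.
move=> /(_ _ _ _ (EFin \o psi q0)) h.
transitivity (\int[m]_w ((psi q0 (U q0 w))%:E * (\prod_(q | q != q0) psi q (U q w))%:E)).
  by apply: eq_integral => w _; rewrite (bigD1 q0)//= EFinM.
have mE : measurable_fun [set: R] (EFin \o psi q0) by exact/measurable_EFinP.
rewrite h//.
- rewrite ge0_integral_mscale//=; last by move=> x _; rewrite lee_fin.
  by rewrite fineK// [RHS](bigD1 q0)//= muleC.
- under [X in measurable_fun _ X]eq_fun do rewrite -big_filter.
  by apply: measurable_prod => q _; apply: measurableT_comp.
- by move=> w; apply: prodr_ge0.
- by move=> A mA; rewrite step//= /mscale/= fineK.
- by move=> y; rewrite lee_fin.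
Qed.

End independence.

(** * Translation of the one-dimensional Gaussian *)

Section gaussian_shift.
Context {R : realType}.
Local Notation mu := (@lebesgue_measure R).

Lemma lebesgue_measure_addr (s : R) (A : set R) : measurable A ->
  mu [set x | A (x + s)] = mu A.
Proof.
move=> mA; apply/esym.
have mS : measurable_fun [set: R] (fun x : R => x + s : measurableTypeR R).
  exact: measurable_funD.
apply: (@lebesgue_measure_unique _ (pushforward mu (fun x : R => x + s : measurableTypeR R))) => //.
move=> _ [[a b]] _ <-; rewrite /pushforward/=.
rewrite [X in _ = mu X](_ : _ = `]a - s, b - s]%classic); last first.
  by apply/seteqP; split=> x /=; rewrite !in_itv/= => ?; lra.
rewrite !lebesgue_measure_itv/= !lte_fin ltrD2r.
case: ifP => // _; by rewrite -!EFinD; congr _%:E; lra.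
Qed.

Lemma ge0_integral_addr (s : R) (f : R -> \bar R) :
  measurable_fun [set: R] f -> (forall x, 0 <= f x)%E ->
  (\int[mu]_x f (x + s)%R = \int[mu]_x f x)%E.
Proof.
move=> mf f0.
have mS : measurable_fun [set: R] (fun x : R => x + s : measurableTypeR R).
  exact: measurable_funD.
have := @ge0_integral_density_comp _ _ (measurableTypeR R) (measurableTypeR R) R
  (fun x => x + s) mS mu mu (cst 1).
move=> /(_ _ _ _ f) <-//.
- by apply: eq_integral => x _; rewrite mule1.
- move=> A mA; transitivity (\int[mu]_(x in +%R^~ s @^-1` A) cst 1%E x)%E => //.
  rewrite (@integral_cst _ _ _ mu); last first.
    by rewrite -[X in measurable X]setTI; exact: mS.
  by rewrite mul1e; exact: lebesgue_measure_addr.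
Qed.

Lemma ge0_integral_normal_prob (s : R) (f : R -> R) :
  measurable_fun [set: R] f -> (forall x, 0 <= f x) ->
  (\int[normal_prob 0 s]_x (f x)%:E = \int[mu]_x (f x * normal_pdf 0 s x)%:E)%E.
Proof.
move=> mf f0; have := @ge0_integral_density_comp _ _ (measurableTypeR R) (measurableTypeR R) R
  id _ mu (normal_prob 0 s) (normal_pdf 0 s).
move=> /(_ _ _ _ _ (EFin \o f)) <-//=.
- exact: measurable_normal_pdf.
- by move=> x; exact: normal_pdf_ge0.
- exact/measurable_EFinP.
Qed.

(** One-dimensional Cameron-Martin formula: after the translation by [c * v], completing the square
    absorbs the exponential factor into the Gaussian density. *)
Lemma normal_prob_shift (v c : R) (A : set R) : 0 < v -> measurable A ->
  (\int[normal_prob 0 (Num.sqrt v)]_x (\1_A x * expR (c * x - c ^+ 2 * v / 2))%:E =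
   normal_prob 0 (Num.sqrt v) [set x | A (x + c * v)%R])%E.
Proof.
move=> v0 mA; have s0 : Num.sqrt v != 0 by rewrite gt_eqF// sqrtr_gt0.
have me : measurable_fun [set: R] (fun x => expR (c * x - c ^+ 2 * v / 2)).
  apply: (measurableT_comp (f := @expR R)); first exact: measurable_expR.
  apply: measurable_funB; last exact: measurable_cst.
  by apply: measurable_funM; [exact: measurable_cst|exact: measurable_id].
rewrite ge0_integral_normal_prob; last 2 first.
- by apply: measurable_funM.
- by move=> x; rewrite mulr_ge0 ?expR_ge0.
rewrite /normal_prob [RHS]integral_mkcond.
rewrite -[LHS](@ge0_integral_addr (c * v)); last 2 first.
- apply/measurable_EFinP; apply: measurable_funM => //; last exact: measurable_normal_pdf.
  exact: measurable_funM.
- by move=> x; rewrite lee_fin !mulr_ge0 ?expR_ge0// normal_pdf_ge0.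
apply: eq_integral => x _; rewrite /patch indicE.
have -> : (x \in [set x | A (x + c * v)]) = (x + c * v \in A) by [].
case: ifPn => _; last by rewrite !mul0r.
rewrite mul1r normal_pdfE//; congr _%:E.
rewrite mulrCA /normal_fun -expRD; congr (_ * expR _).
rewrite !subr0 sqr_sqrtr ?ltW//.
by field; rewrite gt_eqF.
Qed.

End gaussian_shift.

(** * Paths, increments and Cameron-Martin shifts *)

Section time_basics.
Context {R : realType} {T : R}.
Implicit Types t s : time T.

Lemma clock_itv t : clock t \in `[0, T].
Proof. by case: t => x px; exact: (set_mem px). Qed.

Lemma clock_ge0 t : 0 <= clock t.
Proof. by have := clock_itv t; rewrite in_itv/= => /andP[]. Qed.

Lemma clock_le t : clock t <= T.
Proof. by have := clock_itv t; rewrite in_itv/= => /andP[]. Qed.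

Lemma clock_inj : injective (@clock R T).
Proof. exact: val_inj. Qed.

Lemma continuous_clock : continuous (@clock R T).
Proof. exact: initial_continuous. Qed.

Lemma ex_time (x : R) : 0 <= x <= T -> exists t : time T, clock t = x.
Proof.
move=> xT; have h : x \in `[0, T]%classic by rewrite inE/= in_itv.
by exists (SigSub h).
Qed.

End time_basics.

Lemma telescope_sum_ord (V : zmodType) (F : nat -> V) n k : (k <= n)%N ->
  \sum_(i < n | (i < k)%N) (F i.+1 - F i) = F k - F 0%N.
Proof.
move=> kn; rewrite -telescope_sumr// big_mkord.
by rewrite (big_ord_widen_cond n xpredT (fun i => F i.+1 - F i) kn).
Qed.

Section path_space.
Context {R : realType} {T : R} {d : nat}.
Implicit Types (w : C0 T d) (t s b : time T).

Lemma measurable_eval t j : measurable_fun [set: C0 T d] (fun w : C0 T d => w t 0 j).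
Proof.
by move=> _ A mA; rewrite setTI; apply: sub_sigma_algebra; exists t, j, A.
Qed.

Lemma measurable_fun_C0 d' (S : measurableType d') (g : S -> C0 T d) :
  (forall t j, measurable_fun [set: S] (fun x => g x t 0 j)) -> measurable_fun [set: S] g.
Proof.
move=> mg; apply: (@measurability _ _ _ _ _ _ (@cylinders R T d)) => //.
by move=> _ [_ [t [j [A [mA ->]]]] <-]; exact: mg.
Qed.

Lemma C0_eq w w' : (forall t, w t = w' t) -> w = w'.
Proof.
move=> /funext ww'; case: w w' ww' => [w cw sw] [w' cw' sw'] /= ww'.
by rewrite ww' in cw sw *; congr MkC0; exact: Prop_irrelevance.
Qed.

Definition ramp_fun (j : 'I_d) b (x : R) (t : time T) : 'rV[R]_d :=
  (x * Num.min (clock t) (clock b)) *: delta_mx 0 j.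

Lemma continuous_scale_delta (j : 'I_d) (f : time T -> R) :
  continuous f -> continuous (fun t => f t *: delta_mx 0 j : 'rV[R]_d).
Proof. by move=> cf t; apply: (@cvgZr_tmp R 'rV[R]_d _ (nbhs t) _ f (f t)); exact: cf. Qed.

Lemma ramp_continuous j b x w : continuous (fun t => w t + ramp_fun j b x t).
Proof.
have cr : continuous (fun t => x * Num.min (clock t) (clock b)).
  have cm : continuous ((@clock R T : time T -> R^o) \min cst (clock b)).
    move=> t; apply: continuous_min; last exact: cst_continuous.
    exact: continuous_clock.
  move=> t; apply: (@cvgM R _ (nbhs t) _ (cst x) _ x); first exact: cvg_cst.
  exact: cm.
move=> t; apply: (@cvgD R 'rV[R]_d _ (nbhs t) _ w (ramp_fun j b x) (w t) (ramp_fun j b x t)).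
  exact: (@C0_continuous _ _ _ w t).
exact: (continuous_scale_delta cr).
Qed.

Lemma ramp_start j b x w t : clock t = 0 -> w t + ramp_fun j b x t = 0.
Proof.
move=> t0; rewrite C0_start// /ramp_fun t0 add0r.
by rewrite (min_idPl (clock_ge0 _)) mulr0 scale0r.
Qed.

(* [w + x h] with [h = e_j min(., b)], that is [h' = e_j 1_[0,b]]. *)
Definition tilt j b x w : C0 T d := MkC0 (@ramp_continuous j b x w) (@ramp_start j b x w).

Lemma tiltE j b x w t l :
  tilt j b x w t 0 l = w t 0 l + x * Num.min (clock t) (clock b) * (l == j)%:R.
Proof. by rewrite !mxE eqxx. Qed.

Lemma measurable_tilt j b x : measurable_fun [set: C0 T d] (tilt j b x).
Proof.
apply: measurable_fun_C0 => t l; under eq_fun do rewrite tiltE.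
by apply: measurable_funD => //; exact: measurable_eval.
Qed.

(** The Cameron-Martin density [exp (x int <h', dX> - x^2 / 2 int |h'|^2)] for [h' = e_j
    1_[0,b]]. *)
Definition tilt_density j b x w : R :=
  expR (x * w b 0 j - x ^+ 2 * clock b / 2).

Lemma measurable_tilt_density j b x :
  measurable_fun [set: C0 T d] (tilt_density j b x).
Proof.
apply: (measurableT_comp (f := @expR R)); first exact: measurable_expR.
apply: measurable_funB; last exact: measurable_cst.
by apply: measurable_funM; [exact: measurable_cst|exact: measurable_eval].
Qed.

Section grid.
Variables (n : nat) (t : nat -> time T).

Definition increment (i : 'I_n) (j : 'I_d) w : R := w (t i.+1) 0 j - w (t i) 0 j.

Definition increment_rectangles : set_system (C0 T d) :=
  [set B | exists A : 'I_n -> 'I_d -> set R, (forall i j, measurable (A i j)) /\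
    B = [set w | forall i j, A i j (increment i j w)]].

Lemma measurable_increment i j : measurable_fun [set: C0 T d] (increment i j).
Proof. by apply: measurable_funB; exact: measurable_eval. Qed.

Lemma increment_rectanglesI : setI_closed increment_rectangles.
Proof.
move=> _ _ [A [mA ->]] [B [mB ->]]; exists (fun i j => A i j `&` B i j); split.
  by move=> i j; exact: measurableI.
by apply/seteqP; split => w /= => [[hA hB] i j|h]; [split|split=> i j; have [] := h i j].
Qed.

Lemma increment_rectanglesT : increment_rectangles [set: C0 T d].
Proof.
by exists (fun _ _ => setT); split => //; apply/seteqP; split.
Qed.

Lemma measurable_increment_rectangles : increment_rectangles `<=` measurable.
Proof.
move=> _ [A [mA ->]].
rewrite [X in measurable X](_ : _ = \big[setI/setT]_i \big[setI/setT]_j (increment i j @^-1` A i j)).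
  apply: big_ind => //; first exact: measurableI.
  move=> i _; apply: big_ind => //; first exact: measurableI.
  by move=> j _; rewrite -[X in measurable X]setTI; exact: measurable_increment.
rewrite -bigcap_seq; apply/seteqP; split=> w /=.
  by move=> h i _ /=; rewrite -bigcap_seq => j _; exact: h.
move=> h i j; have := h i; rewrite /= mem_index_enum -bigcap_seq => /(_ isT) /(_ j).
by rewrite /= mem_index_enum; exact.
Qed.

Hypothesis t0 : clock (t 0%N) = 0.

(** Since paths start at the origin and the grid starts at time 0, a value of the path is a
    telescoping sum of increments; this links the increments of [wiener_measure] to the cylinders
    that generate the sigma-algebra. *)
Lemma eval_increment_rectangles k j (A : set R) : (k <= n)%N -> measurable A ->
  <<s increment_rectangles >> [set w : C0 T d | A (w (t k) 0 j)].
Proof.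
move=> kn mA.
have mi (i : 'I_n) : measurable_fun [set: g_sigma_algebraType increment_rectangles] (increment i j : g_sigma_algebraType increment_rectangles -> R).
  move=> _ B mB; rewrite setTI; apply: sub_sigma_algebra.
  exists (fun i' j' => if (i' == i) && (j' == j) then B else setT); split.
    by move=> i' j'; case: ifP.
  apply/seteqP; split => w /= => [h i' j'|/(_ i j)]; last by rewrite !eqxx.
  by case: ifP => // /andP[/eqP -> /eqP ->].
have ms : measurable_fun [set: g_sigma_algebraType increment_rectangles]
    (fun w : g_sigma_algebraType increment_rectangles => \sum_(i <- [seq i : 'I_n <- index_enum 'I_n | (i < k)%N]) increment i j w).
  exact: measurable_sum.
have := ms measurableT _ mA; rewrite setTI; congr (<<s _ >> _).
apply/seteqP; split => w /=; rewrite big_filter.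
all: rewrite (_ : \sum_(i < n | (i < k)%N) increment i j w = w (t k) 0 j)//.
all: rewrite (telescope_sum_ord (fun i => w (t i) 0 j) kn).
all: by rewrite (C0_start _ t0) mxE subr0.
Qed.

End grid.

(** [wiener_measure] speaks of strictly increasing times only, so finitely many times are completed
    by 0, freed of repetitions and sorted. *)
Lemma ex_grid (L : seq (time T)) : 0 <= T -> exists (n : nat) (t : nat -> time T),
  [/\ clock (t 0%N) = 0, forall i : 'I_n, clock (t i) < clock (t i.+1) &
    forall s, s \in L -> exists2 k, (k <= n)%N & s = t k].
Proof.
move=> T0; have /ex_time [z z0] : (0 : R) <= 0 <= T by rewrite lexx.
pose r := fun s u : time T => clock s <= clock u.
have rtot : total r by move=> s u; exact: le_total.
have rtr : transitive r by move=> s u v; exact: le_trans.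
pose S := sort r (undup (z :: L)).
have oS : z \in S by rewrite mem_sort mem_undup mem_head.
have uS : uniq S by rewrite sort_uniq undup_uniq.
have sS : sorted r S by exact: sort_sorted.
exists (size S).-1, (nth z S).
have S0 : (0 < size S)%N by case: (S) oS.
split.
- have : (index z S < size S)%N by rewrite index_mem.
  move=> iS; apply/eqP; rewrite eq_le clock_ge0 andbT -[leRHS]z0 -(nth_index z oS).
  have := @sorted_leq_nth _ r rtr (fun x => lexx _) z S sS 0%N (index z S).
  by rewrite !inE => /(_ S0 iS (leq0n _)); rewrite nth_index.
- move=> i; have iS : (i.+1 < size S)%N by rewrite -[X in (_ < X)%N](prednK S0) ltnS.
  rewrite lt_neqAle; apply/andP; split.
    apply/eqP => /clock_inj /eqP; rewrite nth_uniq//; last exact: ltnW.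
    by rewrite ltn_eqF.
  have := @sorted_leq_nth _ r rtr (fun x => lexx _) z S sS i i.+1.
  by rewrite !inE => /(_ (ltnW iS) iS (leqnSn _)).
- move=> s sL; have sS' : s \in S by rewrite mem_sort mem_undup inE sL orbT.
  exists (index s S); last by rewrite nth_index.
  by rewrite -ltnS prednK// index_mem.
Qed.

(** Increment rectangles of different grids are not closed under intersection, because an increment
    of a coarse grid is a sum of finer ones. Uniqueness of measures is therefore applied twice:
    inside the sigma-algebra of one grid, and then to [G], the union of the sigma-algebras generated
    by finitely many times. The grids are made to contain [b] because the Cameron-Martin density
    depends on the value at [b]. *)
Lemma eq_measure_increments (m1 m2 : {measure set (C0 T d) -> \bar R}) b :
  0 <= T -> (m1 setT < +oo)%E ->
  (forall n (t : nat -> time T), clock (t 0%N) = 0 ->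
    (forall i : 'I_n, clock (t i) < clock (t i.+1)) ->
    (exists2 k, (k <= n)%N & b = t k) ->
    forall B, @increment_rectangles n t B -> m1 B = m2 B) ->
  forall B, measurable B -> m1 B = m2 B.
Proof.
move=> T0 m1oo m12.
pose evs (L : seq (time T)) : set_system (C0 T d) :=
  [set B | exists t j (A : set R), [/\ t \in L, measurable A & B = [set w : C0 T d | A (w t 0 j)]]].
pose G : set_system (C0 T d) := [set B | exists L, <<s evs L >> B].
have evs_mono L L' : {subset L <= L'} -> <<s evs L >> `<=` <<s evs L' >>.
  move=> LL'; apply: sub_sigma_algebra2.
  by move=> _ [t [j [A [tL mA ->]]]]; exists t, j, A; split => //; exact: LL'.
have evs_measurable L : <<s evs L >> `<=` @measurable _ (C0 T d).
  apply: smallest_sub; first exact: sigma_algebra_measurable.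
  by move=> _ [t [j [A [_ mA ->]]]]; apply: sub_sigma_algebra; exists t, j, A.
have G12 B : G B -> m1 B = m2 B.
  move=> [L LB].
  have [n [t [t0 tmono Lt]]] := ex_grid (b :: L) T0.
  have bt : exists2 k, (k <= n)%N & b = t k by apply: Lt; exact: mem_head.
  apply: (@g_sigma_algebra_measure_unique _ _ _ (@increment_rectangles n t) _ (fun _ => setT)) => //.
  - exact: measurable_increment_rectangles.
  - by move=> _; exact: increment_rectanglesT.
  - by apply/seteqP; split => // w _; exists 0%N.
  - exact: increment_rectanglesI.
  - exact: m12.
  - move: B LB; apply: smallest_sub; first exact: smallest_sigma_algebra.
    move=> _ [s [j [A [sL mA ->]]]].
    have [k kn ->] : exists2 k, (k <= n)%N & s = t k by apply: Lt; rewrite inE sL orbT.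
    exact: eval_increment_rectangles.
have GT : G setT by exists [::]; exact: (@measurableT _ (g_sigma_algebraType (evs [::]))).
move=> B mB.
apply: (@g_sigma_algebra_measure_unique _ _ _ G _ (fun _ => setT)) => //.
- by move=> X [L] /evs_measurable.
- by apply/seteqP; split => // w _; exists 0%N.
- move=> X Y [L LX] [L' LY]; exists (L ++ L').
  apply: (@measurableI _ (g_sigma_algebraType (evs (L ++ L')))).
    by apply: evs_mono LX => x xL; rewrite mem_cat xL.
  by apply: evs_mono LY => x xL; rewrite mem_cat xL orbT.
- move: B mB; apply: smallest_sub; first exact: smallest_sigma_algebra.
  move=> _ [s [j [A [mA ->]]]]; apply: sub_sigma_algebra; exists [:: s].
  by apply: sub_sigma_algebra; exists s, j, A; split => //; exact: mem_head.
Qed.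

End path_space.

Section density_measure.
Local Open Scope ereal_scope.
Context d (X : measurableType d) (R : realType) (m : {measure set X -> \bar R}).
Variable f : X -> R.
Hypothesis mf : measurable_fun [set: X] f.
Hypothesis f0 : forall x, (0 <= f x)%R.

Definition density_measure (A : set X) : \bar R := \int[m]_(x in A) (f x)%:E.

Let density_measure0 : density_measure set0 = 0.
Proof. exact: integral_set0. Qed.

Let density_measure_ge0 A : 0 <= density_measure A.
Proof. by apply: integral_ge0 => x _; rewrite lee_fin. Qed.

Let density_measure_sigma_additive : semi_sigma_additive density_measure.
Proof.
move=> /= A mA tA mUA; rewrite /density_measure ge0_integral_bigcup//.
- by apply: is_cvg_ereal_nneg_natsum_cond => n _ _; exact: density_measure_ge0.
- by apply/measurable_EFinP; exact: measurable_funTS.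
- by move=> x _; rewrite lee_fin.
Qed.

HB.instance Definition _ := isMeasure.Build _ _ _ density_measure
  density_measure0 density_measure_ge0 density_measure_sigma_additive.

Definition density_measure_m : {measure set X -> \bar R} := density_measure.

End density_measure.

(** * The Cameron-Martin formula in the direction [e_j min(., b)] *)

Section cameron_martin.
Context {R : realType} {T : R} {d : nat}.
Variable mu : probability (C0 T d) R.
Hypothesis hmu : wiener_measure mu.
Hypothesis T0 : 0 < T.
Variables (j : 'I_d) (b : time T) (x : R).

Lemma clock_grid_mono n (t : nat -> time T) i k :
  (forall i : 'I_n, clock (t i) < clock (t i.+1)) ->
  (i <= k <= n)%N -> clock (t i) <= clock (t k).
Proof.
move=> tmono /andP[]; elim: k => [|k IH]; first by rewrite leqn0 => /eqP ->.
rewrite leq_eqVlt => /predU1P[-> //|ik kn].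
by apply: (le_trans (IH ik (ltnW kn))); apply/ltW/(tmono (Ordinal kn)).
Qed.

Section rectangle.
Variables (n k : nat) (t : nat -> time T).
Hypothesis t0 : clock (t 0%N) = 0.
Hypothesis tmono : forall i : 'I_n, clock (t i) < clock (t i.+1).
Hypothesis kn : (k <= n)%N.
Hypothesis bt : b = t k.

Let delta (i : 'I_n) := clock (t i.+1) - clock (t i).
Let c (i : 'I_n) (l : 'I_d) : R := if (i < k)%N && (l == j) then x else 0.

Let delta_gt0 i : 0 < delta i. Proof. by rewrite subr_gt0. Qed.

(** As [b] is the grid point [t k], every grid interval lies wholly before or wholly after [b], so
    the drift has a constant slope [c i l] on it. *)
Lemma increment_tilt i l w :
  increment t i l (tilt j b x w) = increment t i l w + c i l * delta i.
Proof.
rewrite /increment !tiltE /c /delta; have [-> /=|lj] := eqVneq l j; last first.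
  by rewrite andbF !mulr0 !addr0 mul0r addr0.
rewrite andbT !mulr1 bt; case: ltnP => ik.
  have h1 : clock (t i.+1) <= clock (t k) by apply: (clock_grid_mono tmono); rewrite ik.
  have h2 : clock (t i) <= clock (t k) by apply: le_trans h1; exact/ltW.
  by rewrite (min_idPl h1) (min_idPl h2); ring.
have h1 : clock (t k) <= clock (t i).
  by apply: (clock_grid_mono tmono); rewrite ik ltnW.
have h2 : clock (t k) <= clock (t i.+1) by apply: le_trans h1 _; exact/ltW.
by rewrite (min_idPr h1) (min_idPr h2); ring.
Qed.

Lemma tilt_density_prod w : tilt_density j b x w =
  \prod_(q : 'I_n * 'I_d) expR (c q.1 q.2 * increment t q.1 q.2 w - c q.1 q.2 ^+ 2 * delta q.1 / 2).
Proof.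
rewrite -expR_sum; congr expR.
rewrite -(pair_bigA _ (fun i l => c i l * increment t i l w - c i l ^+ 2 * delta i / 2))/=.
transitivity (\sum_(i < n | (i < k)%N) (x * increment t i j w - x ^+ 2 * delta i / 2)).
  under eq_bigr => i _ do rewrite -mulrA.
  rewrite sumrB -!mulr_sumr -mulr_suml.
  rewrite (telescope_sum_ord (fun i => w (t i) 0 j) kn) (telescope_sum_ord (fun i => clock (t i)) kn).
  by rewrite (C0_start _ t0) mxE !subr0 t0 subr0 -bt mulrA.
rewrite big_mkcond; apply: eq_bigr => i _.
rewrite (bigD1 j)//= big1 ?addr0; last first.
  by move=> l lj; rewrite /c (negbTE lj) andbF expr0n/= !mul0r subrr.
by rewrite /c eqxx andbT; case: ifP => // _; rewrite expr0n/= !mul0r subrr.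
Qed.

(** The density and the indicator of [B] both factor over pairs of an increment and a coordinate;
    independence then leaves one use of [normal_prob_shift] for each pair. *)
Lemma cameron_martin_rectangle B : @increment_rectangles R T d n t B ->
  (\int[mu]_(w in B) (tilt_density j b x w)%:E = mu (tilt j b x @^-1` B))%E.
Proof.
move=> [A [mA BE]].
pose P (q : 'I_n * 'I_d) : probability (measurableTypeR R) R := normal_prob 0 (Num.sqrt (delta q.1)).
pose U (q : 'I_n * 'I_d) (w : C0 T d) := increment t q.1 q.2 w.
have indep (A' : 'I_n * 'I_d -> set R) : (forall q, measurable (A' q)) ->
    (mu [set w | forall q, A' q (U q w)] = \prod_q P q (A' q))%E.
  move=> mA'; have := hmu tmono (fun i j => mA' (i, j)).
  rewrite pair_bigA/=; set X := [set w | _]; set Y := [set w | _].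
  have -> : X = Y.
    by apply/seteqP; split => w h; [move=> [i l]; exact: h|move=> i l; exact: (h (i, l))].
  by move=> ->; apply: eq_bigr => -[i l] _.
pose psi q y : R := \1_(A q.1 q.2) y * expR (c q.1 q.2 * y - c q.1 q.2 ^+ 2 * delta q.1 / 2).
have intpsi q : (\int[P q]_y (psi q y)%:E = P q [set y | A q.1 q.2 (y + c q.1 q.2 * delta q.1)%R])%E.
  exact: (normal_prob_shift (c q.1 q.2) (delta_gt0 q.1) (mA q.1 q.2)).
have mU q : measurable_fun [set: C0 T d] (U q) by exact: measurable_increment.
have mpsi q : measurable_fun [set: R] (psi q).
  apply: measurable_funM; first exact: measurable_indic.
  apply: (measurableT_comp (f := @expR R)); first exact: measurable_expR.
  apply: measurable_funB; last exact: measurable_cst.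
  by apply: measurable_funM; [exact: measurable_cst|exact: measurable_id].
have mshift q : measurable [set y | A q.1 q.2 (y + c q.1 q.2 * delta q.1)].
  have mS : measurable_fun [set: R] (fun y : R => y + c q.1 q.2 * delta q.1 : measurableTypeR R).
    exact: measurable_funD.
  by have := mS measurableT _ (mA q.1 q.2); rewrite setTI.
transitivity (\int[mu]_w (\prod_q psi q (U q w))%:E)%E.
  rewrite BE integral_mkcond; apply: eq_integral => w _; rewrite /patch.
  under eq_bigr do rewrite /psi.
  rewrite big_split/= tilt_density_prod.
  case: (pselect (forall i l, A i l (increment t i l w))) => h.
    rewrite mem_set// [X in (X * _)%:E]big1 ?mul1r// => -[i l] _.
    by rewrite /= indicE mem_set//; exact: h.
  rewrite memNset//; move/existsNP : h => [i /existsNP[l h]].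
  by rewrite (bigD1 (i, l))//= indicE memNset// !mul0r.
rewrite (ge0_integral_prod_indep mU indep)//; last 2 first.
- by move=> q y; rewrite /psi mulr_ge0// ?expR_ge0.
- by move=> q; rewrite intpsi; apply: fin_num_measure; exact: mshift.
under eq_bigr do rewrite intpsi.
rewrite -(indep (fun q => [set y | A q.1 q.2 (y + c q.1 q.2 * delta q.1)]))//.
congr (mu _); rewrite BE; apply/seteqP; split => w /= h.
  by move=> i l; rewrite increment_tilt; exact: (h (i, l)).
by move=> [i l] /=; rewrite -increment_tilt; exact: h.
Qed.

End rectangle.

Lemma tilt_density_ge0 w : 0 <= tilt_density j b x w.
Proof. exact: expR_ge0. Qed.

(** The Cameron-Martin theorem: the image of [mu] under the shift and the measure of density
    [tilt_density] agree on increment rectangles, hence everywhere. *)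
Lemma ge0_integral_tilt (phi : C0 T d -> \bar R) :
  measurable_fun [set: C0 T d] phi -> (forall w, 0 <= phi w)%E ->
  (\int[mu]_w phi (tilt j b x w) = \int[mu]_w (phi w * (tilt_density j b x w)%:E))%E.
Proof.
move=> mphi phi0.
have mt := @measurable_tilt R T d j b x.
have md := @measurable_tilt_density R T d j b x.
pose m1 := pushforward mu (tilt j b x).
have E B : measurable B -> m1 B = density_measure_m mu md tilt_density_ge0 B.
  apply: (@eq_measure_increments _ _ _ _ _ b (ltW T0)).
    by rewrite /m1/= /pushforward preimage_setT; exact: (le_lt_trans (probability_le1 _ _) (ltry 1)).
  move=> n t t0 tmono [k kn bt] B' B'E.
  by rewrite /= /density_measure (cameron_martin_rectangle t0 tmono kn bt B'E).
rewrite (@ge0_integral_density_comp _ _ _ _ _ id _ mu m1)//; last 2 first.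
- exact: tilt_density_ge0.
- by move=> A mA; exact/esym/E.
by rewrite ge0_integral_pushforward.
Qed.

Lemma integral_tilt_density : (\int[mu]_w (tilt_density j b x w)%:E = 1)%E.
Proof.
transitivity (\int[mu]_w (cst 1 w * (tilt_density j b x w)%:E))%E.
  by apply: eq_integral => w _; rewrite mul1e.
rewrite -ge0_integral_tilt//.
transitivity (\int[mu]_w cst 1 w)%E => //.
by rewrite (@integral_cst _ _ _ mu)// mul1e; exact: probability_setT.
Qed.

End cameron_martin.

Section tilt_square.
Context {R : realType} {T : R} {d : nat}.
Variable mu : probability (C0 T d) R.
Hypothesis hmu : wiener_measure mu.
Hypothesis T0 : 0 < T.

(** Up to a constant, squaring the density doubles the shift. Since the density of the doubled shift
    has integral 1, the second moment is explicit. *)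
Lemma tilt_density_sqr j b x (w : C0 T d) :
  tilt_density j b x w ^+ 2 = expR (x ^+ 2 * clock b) * tilt_density j b (x *+ 2) w.
Proof.
by rewrite /tilt_density -expRM_natl -expRD; congr expR; rewrite !mulr2n; field.
Qed.

Lemma integral_tilt_density_sqr j b x :
  (\int[mu]_w ((tilt_density j b x w) ^+ 2)%:E = (expR (x ^+ 2 * clock b))%:E)%E.
Proof.
under eq_integral do rewrite tilt_density_sqr EFinM.
rewrite ge0_integralZl//=.
- by rewrite integral_tilt_density// mule1.
- by apply/measurable_EFinP; exact: measurable_tilt_density.
- by move=> w _; rewrite lee_fin expR_ge0.
Qed.

End tilt_square.

(** * Uniform topology on cadlag paths *)

Section time_clamp.
Context {R : realType} {T : R}.
Hypothesis T0 : 0 <= T.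

Lemma clamp_itv (r : R) : 0 <= Num.max 0 (Num.min r T) <= T.
Proof. by rewrite le_max lexx/= ge_max T0 ge_min lexx orbT. Qed.

(** Clamping makes functionals of [time T] total functions of a real variable, ready for Lebesgue
    integration, without side conditions on [r]. *)
Definition tclamp (r : R) : time T := projT1 (cid (ex_time (clamp_itv r))).

Lemma clock_tclamp r : clock (tclamp r) = Num.max 0 (Num.min r T).
Proof. exact: projT2 (cid (ex_time (clamp_itv r))). Qed.

Lemma clock_tclamp_id r : 0 <= r <= T -> clock (tclamp r) = r.
Proof. by move=> /andP[r0 rT]; rewrite clock_tclamp (min_idPl rT) (max_idPr r0). Qed.

Lemma tclamp_clock (t : time T) : tclamp (clock t) = t.
Proof. by apply: clock_inj; rewrite clock_tclamp_id// clock_ge0 clock_le. Qed.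

Lemma cvg_time (u : nat -> time T) (t : time T) :
  clock (u n) @[n --> \oo] --> clock t -> u n @[n --> \oo] --> t.
Proof.
move=> /cvgrPdist_lt ut A /nbhs_ballP[e /= e0 eA].
have := ut e e0; apply: filterS => n /= un; exact: eA.
Qed.

End time_clamp.

Section cadlag_topology.
Context {R : realType} {T : R} {d : nat}.
Implicit Types (w : cadlag T d).

(** The balls are described by non-strict bounds, since a strict bound at each time does not survive
    the supremum over times. *)
Lemma nbhs_cadlagP w (A : set (cadlag T d)) : nbhs w A <->
  exists2 e : R, 0 < e & forall w', (forall t, `|w t - w' t| <= e) -> A w'.
Proof.
split.
  rewrite nbhsE => -[B [[C oC <-] Cw] BA].
  have : nbhs (cadlag_uniform w) C by apply: open_nbhs_nbhs.
  move=> /uniform_nbhs[E [entE EC]].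
  move: entE; rewrite -entourage_ballE => -[e /= e0 eE].
  exists (e / 2); first by rewrite divr_gt0.
  move=> w' ww'; apply: BA; apply: EC => t _; apply: eE => /=.
  rewrite -ball_normE/=; apply: le_lt_trans (ww' t) _.
  by rewrite gtr_pMr// invf_lt1 ?ltr1n.
move=> [e e0 eA].
have : nbhs (cadlag_uniform w) [set h | forall t, `|w t - h t| < e].
  apply/uniform_nbhs; exists [set xy | `|xy.1 - xy.2| < e]; split; last by move=> h hh t; exact: hh.
  rewrite -entourage_ballE; exists e => // xy /=; by rewrite -ball_normE.
set X := [set h | _] => nX.
have : nbhs w (@cadlag_uniform R T d @^-1` X).
  exact: (@initial_continuous _ _ (@cadlag_uniform R T d) w).
apply: filterS => w' h.
by apply: eA => t; apply/ltW/h.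
Qed.

Lemma cvg_cadlag (w_ : nat -> cadlag T d) w (e_ : nat -> R) :
  e_ n @[n --> \oo] --> 0 -> (forall n t, `|w t - w_ n t| <= e_ n) ->
  w_ n @[n --> \oo] --> w.
Proof.
move=> e0 we A /nbhs_cadlagP[e egt0 eA].
have /cvgrPdist_lt /(_ e egt0) := e0; apply: filterS => n /= ne.
apply: eA => t; apply: le_trans (we n t) _; apply: le_trans (ltW ne).
by rewrite sub0r normrN ler_norm.
Qed.

Lemma continuous_cadlagP (V : normedModType R) (psi : cadlag T d -> V) w :
  {for w, continuous psi} -> forall eta : R, 0 < eta -> exists2 e : R, 0 < e &
  forall w', (forall t, `|w t - w' t| <= e) -> `|psi w - psi w'| < eta.
Proof. by move=> /cvgrPdist_lt h eta eta0; apply/nbhs_cadlagP; exact: h. Qed.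

Lemma cadlag_eq w w' : (forall t, w t = w' t) -> w = w'.
Proof.
move=> /funext ww'; case: w w' ww' => [w cw sw] [w' cw' sw'] /= ww'.
by rewrite ww' in cw sw *; congr Cadlag; exact: Prop_irrelevance.
Qed.

Lemma jump_at_add w t v v' : jump_at (jump_at w t v) t v' = jump_at w t (v + v').
Proof.
apply: cadlag_eq => s /=; rewrite /jump_at_fun/= /jump_at_fun.
by case: ifP => _; rewrite ?addr0 ?addrA.
Qed.

Lemma jump_at0 w t : jump_at w t 0 = w.
Proof. by apply: cadlag_eq => s /=; rewrite /jump_at_fun if_same addr0. Qed.

Lemma row_norm_le (v : 'rV[R]_d) (x : R) : 0 <= x -> (forall j, `|v 0 j| <= x) -> `|v| <= x.
Proof.
move=> x0 vx; rewrite -[leLHS]/(mx_norm v) mx_normrE; apply/bigmax_leP; split => // -[i j] _ /=.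
by rewrite (ord1 i).
Qed.

Lemma row_coord_le (v : 'rV[R]_d) j : `|v 0 j| <= `|v|.
Proof.
rewrite -[leRHS]/(mx_norm v) mx_normrE.
by apply: (@le_bigmax _ _ _ _ (fun ij => `|v ij.1 ij.2|) (0, j)).
Qed.

Lemma sqr_coord_le_inner (v : 'rV[R]_d) j : v 0 j ^+ 2 <= inner v v.
Proof.
rewrite /inner (bigD1 j)//= -expr2 lerDl; apply: sumr_ge0 => i _.
by rewrite -expr2 sqr_ge0.
Qed.

Lemma inner_ge0 (v : 'rV[R]_d) : 0 <= inner v v.
Proof. by apply: sumr_ge0 => i _; rewrite -expr2 sqr_ge0. Qed.

Lemma coord_le_enorm (v : 'rV[R]_d) j : `|v 0 j| <= enorm v.
Proof.
by rewrite /enorm -sqrtr_sqr ler_wsqrtr// sqr_coord_le_inner.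
Qed.

Lemma sqr_enorm (v : 'rV[R]_d) : enorm v ^+ 2 = inner v v.
Proof. by rewrite sqr_sqrtr// inner_ge0. Qed.

(** The topology uses the maximum norm of row vectors, [boundedness_preserving] the Euclidean one;
    the crude factor [d.+1] is enough to pass between them. *)
Lemma enorm_le (v : 'rV[R]_d) : enorm v <= d.+1%:R * `|v|.
Proof.
have h : 0 <= d.+1%:R * `|v| by rewrite mulr_ge0.
rewrite /enorm -[leRHS](ger0_norm h) -sqrtr_sqr ler_wsqrtr// /inner.
apply: (@le_trans _ _ (\sum_(j < d) `|v| ^+ 2)).
  apply: ler_sum => j _; rewrite -expr2 -[leLHS]real_normK ?num_real//.
  by rewrite lerXn2r ?nnegrE ?row_coord_le.
rewrite sumr_const card_ord exprMn -[leLHS]mulr_natl ler_wpM2r ?sqr_ge0//.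
rewrite -natrX ler_nat; apply: (@leq_trans (d.+1 ^ 1)%N).
  by rewrite expn1.
by rewrite leq_pexp2l.
Qed.

Lemma inner_delta (v : 'rV[R]_d) j : inner v (delta_mx 0 j) = v 0 j.
Proof.
rewrite /inner (bigD1 j)//= big1 ?addr0 ?mxE ?eqxx ?mulr1// => i ij.
by rewrite mxE (negbTE ij) andbF mulr0.
Qed.

End cadlag_topology.

Section left_limit.
Context {R : realType} {T : R} {d : nat}.
Variables (F : time T -> cadlag T d -> 'rV[R]_d) (t : time T).
Hypothesis Ft : has_left_limit F t.

Definition left_limit : cadlag T d -> 'rV[R]_d := projT1 (cid Ft).

(** [has_left_limit] is sequential and asks for nondecreasing times. If no [delta] worked, bad times
    and paths could be picked one after the other so as to form such a sequence, and the convergence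
    along it would fail. *)
Lemma left_limitP (w : cadlag T d) (eta : R) : 0 < eta -> exists2 delta : R, 0 < delta &
  forall (s : time T) (w' : cadlag T d), clock t - delta < clock s -> clock s < clock t ->
    (forall u, `|w u - w' u| <= delta) -> `|left_limit w - F s w'| < eta.
Proof.
move=> eta0; apply: contrapT => /forall2NP nodelta.
have bad (e : R) : exists sw : time T * cadlag T d, 0 < e ->
    [/\ clock t - e < clock sw.1, clock sw.1 < clock t,
      forall u, `|w u - sw.2 u| <= e & eta <= `|left_limit w - F sw.1 sw.2|].
  case: (ltP 0 e) => e0; last by exists (t, w).
  case: (nodelta e) => [/(_ e0) //|].
  move=> /existsNP[s] /existsNP[w'] /not_implyP[h1] /not_implyP[h2] /not_implyP[h3] h4.
  by exists (s, w') => _; split => //; rewrite leNgt; apply/negP.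
have {bad}[g gP] := choice bad.
(* The first term of the minimum forces convergence; the second places the next bad time after the
   previous one, which gives monotonicity. *)
pose sw := fix sw n := if n is m.+1 then
  g (Num.min (m.+2%:R^-1) (clock t - clock (sw m).1)) else g 1.
have swP n : [/\ clock t - n.+1%:R^-1 < clock (sw n).1, clock (sw n).1 < clock t,
      forall u, `|w u - (sw n).2 u| <= n.+1%:R^-1,
      eta <= `|left_limit w - F (sw n).1 (sw n).2| &
      forall m, n = m.+1 -> clock (sw m).1 <= clock (sw n).1].
  elim: n => [|n [h1 h2 h3 h4 _]] /=.
    by have [a b c e] := gP 1 ltr01; rewrite invr1; split.
  set e := Num.min _ _.
  have e0 : 0 < e by rewrite lt_min invr_gt0 ltr0n/= subr_gt0.
  have [a b c f] := gP e e0.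
  have e1 : e <= n.+2%:R^-1 by rewrite ge_min lexx.
  have e2 : e <= clock t - clock (sw n).1 by rewrite ge_min lexx orbT.
  split => //.
  - by apply: le_lt_trans a; rewrite lerB.
  - by move=> u; apply: le_trans (c u) e1.
  - by move=> m [<-]; apply/ltW; apply: le_lt_trans a; lra.
have inv0 : (fun n : nat => n.+1%:R^-1 : R) @ \oo --> 0 by exact: cvg_harmonic.
have : F (sw n).1 (sw n).2 @[n --> \oo] --> left_limit w.
  apply: (projT2 (cid Ft) w (fun n => (sw n).2) (fun n => (sw n).1)).
  - by apply: (cvg_cadlag inv0) => n u; have [_ _ + _ _] := swP n; apply.
  - by move=> n; have [_ _ _ _] := swP n.+1; apply.
  - by move=> n; have [] := swP n.
  - apply: cvg_time; apply/cvgrPdist_lt => e e0.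
    have /cvgrPdist_lt /(_ e e0) := inv0; apply: filterS => n /=.
    rewrite sub0r normrN; have [a b _ _ _] := swP n => /(le_lt_trans (ler_norm _)) ne.
    rewrite ger0_norm ?subr_ge0 ?ltW// ltrBlDr -ltrBlDl; apply: lt_trans a.
    by rewrite ltrD2l ltrN2.
move=> /cvgrPdist_lt /(_ eta eta0)[N _ /(_ N (leqnn N))] /=.
by have [_ _ _ h _] := swP N; move=> /(le_lt_trans h); rewrite ltxx.
Qed.

End left_limit.

(** * Rational step paths and measurability on Wiener space *)

Section step_paths.
Context {R : realType} {T : R} {d : nat}.
Hypothesis T0 : 0 <= T.

Definition step_path (l : seq (rat * 'rV[rat]_d)) : cadlag T d :=
  foldr (fun p w => jump_at w (tclamp T0 (ratr p.1)) (map_mx ratr p.2))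
    (C0_cadlag (C0_zero T d)) l.

Lemma row_rat_approx (v : 'rV[R]_d) (e : R) : 0 < e ->
  exists q : 'rV[rat]_d, `|v - map_mx ratr q| <= e.
Proof.
move=> e0.
have h j : exists q : rat, `|v 0 j - ratr q| <= e.
  have [|q] := @rat_in_itvoo R (v 0 j - e) (v 0 j + e); first lra.
  rewrite in_itv/= => /andP[q1 q2]; exists q; rewrite ler_norml; apply/andP; split; lra.
have [q qP] := choice h; exists (\row_j q j).
by apply: row_norm_le; [exact: ltW|move=> j; rewrite !mxE].
Qed.

Lemma C0_nbhs (w : C0 T d) (t : time T) (e : R) : 0 < e -> exists2 rho : R, 0 < rho &
  forall u, `|clock t - clock u| < rho -> `|w t - w u| < e.
Proof.
move=> e0; have /cvgrPdist_lt /(_ e e0) := @C0_continuous _ _ _ w t.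
move=> /nbhs_ballP[rho /= rho0 h]; exists rho => // u tu; exact: (h u tu).
Qed.

Lemma step_path_dense (w : C0 T d) (e : R) : 0 < e ->
  exists l, forall u, `|w u - step_path l u| <= e.
Proof.
move=> e0.
(* Real induction on the time up to which [w] is approximated. Requiring the step path to be
   constant from [r] on lets a single further jump correct it beyond [r]. *)
pose good r l v := (forall u, clock u < r -> `|w u - step_path l u| <= e) /\
  (forall u, r <= clock u -> step_path l u = map_mx ratr v).
pose G := [set r : R | exists q : rat, r = clock (tclamp T0 (ratr q)) /\ exists l v, good r l v].
have G0 : G 0.
  exists 0; rewrite rmorph0 clock_tclamp_id ?lexx//; split => //.
  exists [::], 0; split => u; first by rewrite ltNge clock_ge0.
  by move=> _ /=; apply/rowP => i; rewrite !mxE rmorph0.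
have GT : ubound G T by move=> r [q [-> _]]; exact: clock_le.
have supG : has_sup G by split; [exists 0|exists T].
set s := sup G.
have s0 : 0 <= s by apply: ub_le_sup => //; exists T.
have sT : s <= T by apply: ge_sup => //; exists 0.
have [t ts] : exists t : time T, clock t = s by apply: ex_time; rewrite s0.
have [rho rho0 hrho] := C0_nbhs w t (divr_gt0 e0 (ltr0Sn R 1)).
have [r [q [rq [l [v [lapp lcst]]]]]] := sup_adherent rho0 supG; rewrite -/s => sr.
have rs : r <= s by apply: ub_le_sup; [exists T|exists q; split => //; exists l, v].
have [v' vv'] := row_rat_approx (w t) (divr_gt0 e0 (ltr0Sn R 1)).
(* The new jump replaces the final value [v] by [v'], a rational approximation of [w] at the
   supremum [s]. As [r] is within [rho] of [s], the path [l'] is good from [r] up to [s + rho]. *)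
pose l' := (q, v' - v) :: l.
have l'E u : step_path l' u = if r <= clock u then map_mx ratr v' else step_path l u.
  rewrite /= /jump_at_fun -rq; case: ifPn => ru; last by rewrite addr0.
  rewrite lcst//; apply/rowP => i; rewrite !mxE rmorphB/=; lra.
have l'app u : `|s - clock u| < rho \/ clock u < r -> `|w u - step_path l' u| <= e.
  rewrite l'E; case: (leP r (clock u)) => ru; last by move=> _; exact: lapp.
  move=> [|//]; rewrite -ts => /hrho tu.
  rewrite -(subrKA (w t)) [leRHS]splitr; apply: le_trans (ler_normD _ _) _.
  by rewrite lerD// distrC ltW.
have [sltT|Ts] := ltP s T; last first.
  exists l' => u; apply: l'app; have [ru|] := leP r (clock u); last by right.
  left; have us : clock u <= s by apply: le_trans Ts; exact: clock_le.
  by rewrite ger0_norm ?subr_ge0//; lra.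
(* If [s < T], a rational time just after [s] would belong to [G], against the choice of [s]. *)
have [|q'] := @rat_in_itvoo R s (Num.min (s + rho) T); first by rewrite lt_min sltT andbT; lra.
rewrite in_itv/= lt_min => /and3P[sq' q'rho q'T].
have q'E : clock (tclamp T0 (ratr q')) = ratr q' by rewrite clock_tclamp_id// !ltW//; lra.
suff /(ub_le_sup (ex_intro _ T GT)) : G (ratr q') by rewrite leNgt sq'.
exists q'; split => //; exists l', v'; split => u uq'.
  apply: l'app; have [ru|] := leP r (clock u); last by right.
  by left; rewrite ltr_norml; apply/andP; split; lra.
by rewrite l'E ifT//; lra.
Qed.

Lemma step_path_bounded l : exists B : R, forall u, `|step_path l u| <= B.
Proof.
elim: l => [|[q v] l [B IH]] /=; first by exists 0 => u; rewrite normr0.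
exists (B + `|map_mx ratr v : 'rV[R]_d|) => u; rewrite /jump_at_fun; case: ifP => _.
  by apply: le_trans (ler_normD _ _) _; rewrite lerD.
by rewrite addr0; apply: le_trans (IH u) _; rewrite lerDl.
Qed.

Lemma C0_bounded (w : C0 T d) : exists2 B : R, 0 <= B & forall u, `|w u| <= B.
Proof.
have [l wl] := step_path_dense w ltr01; have [B lB] := step_path_bounded l.
have wB u : `|w u| <= 1 + B.
  by rewrite -[w u](subrK (step_path l u)); apply: le_trans (ler_normD _ _) _; rewrite lerD.
exists (1 + B) => //; have [t _] : exists t : time T, clock t = 0 by apply: ex_time; rewrite lexx.
exact: le_trans (wB t).
Qed.

(* Right-continuity lets rational times, together with T, decide the
   uniform distance to a cadlag path. *)
Lemma rat_times_dist (w : C0 T d) (v : cadlag T d) (e : R) :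
  (forall q : rat, `|w (tclamp T0 (ratr q)) - v (tclamp T0 (ratr q))| <= e) ->
  forall u, `|w u - v u| <= e.
Proof.
move=> h u; have [uT|Tu] := ltP (clock u) T; last first.
  (* A rational above [T] is clamped to [T], so [T] is among the countably many times even when it
     is irrational. *)
  have [|q] := @rat_in_itvoo R T (T + 1); first lra.
  rewrite in_itv/= => /andP[Tq _]; suff -> : u = tclamp T0 (ratr q) by [].
  apply: clock_inj; rewrite clock_tclamp (min_idPr (ltW Tq)) (max_idPr T0).
  by apply/eqP; rewrite eq_le clock_le.
rewrite leNgt; apply/negP => eu.
pose F := within [set s : time T | clock u < clock s] (nbhs u).
have : (fun s => `|w s - v s|) @ F --> `|w u - v u|.
  by apply: cvg_norm; apply: cvgB; [exact: C0_right|exact: cadlag_right].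
move=> /cvgrPdist_lt /(_ (`|w u - v u| - e)); rewrite subr_gt0 => /(_ eu).
rewrite near_withinE => /nbhs_ballP[rho /= rho0 hrho].
have [|q] := @rat_in_itvoo R (clock u) (Num.min (clock u + rho) T).
  by rewrite lt_min uT andbT; lra.
rewrite in_itv/= lt_min => /and3P[uq qrho qT].
have qE : clock (tclamp T0 (ratr q)) = ratr q.
  by rewrite clock_tclamp_id// (ltW qT) andbT (le_trans (clock_ge0 u))// ltW.
have hb : `|clock u - clock (tclamp T0 (ratr q))| < rho.
  by rewrite qE ltr_norml; apply/andP; split; lra.
have := hrho (tclamp T0 (ratr q)) hb; rewrite qE => /(_ uq); have := h q.
by rewrite ltr_norml => ? /andP[? ?]; lra.
Qed.

Lemma measurable_dist_ball (v : cadlag T d) (e : R) :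
  measurable [set w : C0 T d | forall u, `|w u - v u| <= e].
Proof.
(* A negative radius is treated apart: for [d = 0] the coordinate conditions below would be void
   although the ball is empty. *)
have [e0|e0] := ltP e 0.
  rewrite [X in measurable X](_ : _ = set0)//; apply/seteqP; split => // w /= h.
  have [t _] : exists t : time T, clock t = 0 by apply: ex_time; rewrite lexx.
  by have := le_lt_trans (h t) e0; rewrite ltNge normr_ge0.
pose B (q : rat) (j : 'I_d) := [set w : C0 T d | `|w (tclamp T0 (ratr q)) 0 j - v (tclamp T0 (ratr q)) 0 j| <= e].
have mB q j : measurable (B q j).
  have mf : measurable_fun [set: C0 T d] (fun w : C0 T d => `|w (tclamp T0 (ratr q)) 0 j - v (tclamp T0 (ratr q)) 0 j|).
    apply: measurableT_comp => //; apply: measurable_funB; last exact: measurable_cst.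
    exact: measurable_eval.
  have := mf measurableT `]-oo, e]%classic (measurable_itv _); rewrite setTI.
  by congr measurable; apply/seteqP; split => w /=; rewrite in_itv.
rewrite [X in measurable X](_ : _ = \bigcap_n (if unpickle n is Some q then \big[setI/setT]_j B q j else setT)).
  apply: bigcapT_measurable => n; case: unpickle => // q.
  by apply: big_ind => //; first exact: measurableI.
apply/seteqP; split => w /=.
  move=> h n _; case: unpickle => // q; rewrite -bigcap_seq => j _ /=.
  by apply: le_trans (h (tclamp T0 (ratr q))); have := row_coord_le (w (tclamp T0 (ratr q)) - v (tclamp T0 (ratr q))) j; rewrite !mxE.
move=> h; apply: rat_times_dist => q; apply: row_norm_le => // j.
have := h (pickle q) I; rewrite pickleK -bigcap_seq => /(_ j); rewrite !mxE; apply.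
exact: mem_index_enum.
Qed.

(** Continuity is uniform while the sigma-algebra is generated by evaluations. Since step paths come
    close to every continuous path, a superlevel set is the countable union of those balls around
    step paths on which [psi] exceeds [a], and balls are measurable. The condition on [psi] ranges
    over all cadlag paths near the step path, because the step path itself is not continuous. *)
Lemma measurable_continuous_cadlag (psi : cadlag T d -> R) :
  continuous psi -> measurable_fun [set: C0 T d] (fun w : C0 T d => psi (C0_cadlag w)).
Proof.
move=> cpsi.
apply: (measurability _ (RGenOInfty.measurableE R)).
move=> _ [_ [a ->] <-]; rewrite setTI.
pose U (l : seq (rat * 'rV[rat]_d)) (n : nat) : set (C0 T d) :=
  [set w | (forall w' : cadlag T d, (forall u, `|step_path l u - w' u| <= n.+1%:R^-1) -> a < psi w') /\
    forall u, `|w u - step_path l u| <= n.+1%:R^-1].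
have mU l n : measurable (U l n).
  have [h|h] := pselect (forall w' : cadlag T d, (forall u, `|step_path l u - w' u| <= n.+1%:R^-1) -> a < psi w').
    have := measurable_dist_ball (step_path l) n.+1%:R^-1.
    by congr measurable; apply/seteqP; split => [w|w []].
  by rewrite (_ : U l n = set0)//; apply/seteqP; split => // w [].
rewrite [X in measurable X](_ : _ = \bigcup_k (if unpickle k is Some ln then U ln.1 ln.2 else set0)).
  by apply: bigcupT_measurable => k; case: unpickle.
apply/seteqP; split => w /=.
  rewrite in_itv/= andbT => aw.
  have pw : 0 < psi (C0_cadlag w) - a by rewrite subr_gt0.
  have [e e0 he] := continuous_cadlagP (@cpsi (C0_cadlag w)) pw.
  have [n _ /(_ n (leqnn n)) /= ne] := near_infty_natSinv_lt (PosNum (divr_gt0 e0 (ltr0Sn R 1))).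
  have n0 : 0 < (n.+1%:R^-1 : R) by rewrite invr_gt0.
  have [l wl] := step_path_dense w n0.
  exists (pickle (l, n)) => //; rewrite pickleK/=; split => // w' lw'.
  suff : `|psi (C0_cadlag w) - psi w'| < psi (C0_cadlag w) - a by rewrite ltr_norml; lra.
  apply: he => u; rewrite -(subrKA (step_path l u)) [leRHS]splitr.
  apply: le_trans (ler_normD _ _) _.
  by apply: lerD; apply: le_trans (ltW ne); [exact: wl|exact: lw'].
move=> [k _]; case: unpickle => // -[l n] /= [h wl].
by rewrite in_itv/= andbT; apply: h => u; rewrite distrC; exact: wl.
Qed.

End step_paths.

(** * Difference quotients and the pathwise derivative *)

Section staircase.
Context {R : realType}.
Implicit Types (b h t u : R) (c : nat -> R).

(** Open on the left, so that the node [i h] of the cell containing [t] lies strictly before [t]: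
    evaluation at the nodes tends to a left limit. *)
Definition cell h i : set R := `]i%:R * h, i.+1%:R * h]%classic.

Definition staircase h n c t : R := \sum_(i < n) c i * \1_(cell h i) t.

Lemma mem_cell h i t : (t \in cell h i) = (i%:R * h < t <= i.+1%:R * h).
Proof. by rewrite /cell mem_setE in_itv. Qed.

Lemma staircase_in h n c t : 0 < h -> 0 < t <= n%:R * h ->
  exists i : 'I_n, i%:R * h < t <= i.+1%:R * h /\ staircase h n c t = c i.
Proof.
move=> h0 /andP[t0 tn].
have [i it] : exists i : 'I_n, i%:R * h < t <= i.+1%:R * h.
  elim: n tn => [|n IH tn]; first by rewrite mul0r leNgt t0.
  have [/IH[i it]|nt] := leP t (n%:R * h); first by exists (widen_ord (leqnSn n) i).
  by exists ord_max; rewrite /= nt.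
exists i; split => //; rewrite /staircase (bigD1 i)//= big1 ?addr0.
  by rewrite indicE mem_cell it mulr1.
move=> k ki; rewrite indicE mem_cell; case: (boolP (_ && _)) => [/andP[k1 k2]|_]; last by rewrite mulr0.
move: it => /andP[i1 i2]; case/eqP : ki; apply/val_inj/eqP; rewrite eqn_leq.
by apply/andP; split; rewrite -ltnS -(ltr_nat R) -(ltr_pM2r h0); [exact: lt_le_trans i2|exact: lt_le_trans k2].
Qed.

Lemma staircase_out h n c t : 0 < h -> ~~ (0 < t <= n%:R * h) -> staircase h n c t = 0.
Proof.
move=> h0 tn; rewrite /staircase big1// => i _; rewrite indicE mem_cell.
case: (boolP (_ && _)) => [/andP[i1 i2]|_]; last by rewrite mulr0.
case/negP : tn; apply/andP; split.
  by apply: le_lt_trans i1; rewrite mulr_ge0// ltW.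
by apply: le_trans i2 _; rewrite ler_pM2r// ler_nat.
Qed.

Lemma measurable_staircase h n c : measurable_fun [set: R] (staircase h n c).
Proof.
apply: measurable_sum => i; apply: measurable_funM; first exact: measurable_cst.
by apply: measurable_indic; exact: measurable_itv.
Qed.

Lemma integral_staircase b n c : 0 < b -> (0 < n)%N ->
  (\int[lebesgue_measure]_(t in `]0%R, b]) (staircase (b / n%:R) n c t)%:E =
   (\sum_(i < n) b / n%:R * c i)%:E)%E.
Proof.
move=> b0 n0; set h := b / n%:R.
have h0 : 0 < h by rewrite divr_gt0// ltr0n.
have nh : n%:R * h = b by rewrite /h mulrC divfK// pnatr_eq0 -lt0n.
under eq_integral do rewrite /staircase -sumEFin.
have mc i : measurable (cell h i) by exact: measurable_itv.
have mI : measurable (`]0%R, b]%classic : set R) by exact: measurable_itv.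
have i1 (i : 'I_n) : (@lebesgue_measure R).-integrable `]0, b] (fun x => (\1_(cell h i) x)%:E).
  apply: (@integrableS _ _ _ _ setT) => //; apply: integrable_indic_itv.
rewrite integral_sum//; last first.
  by move=> i; apply: (integrableZl _ (c i) (i1 i)); exact: mI.
rewrite -sumEFin; apply: eq_bigr => i _.
transitivity (\int[lebesgue_measure]_(x in `]0%R, b]) ((c i)%:E * (\1_(cell h i) x)%:E))%E.
  by apply: eq_integral => x _; rewrite EFinM.
rewrite integralZl// integral_indic//; last exact: mc.
have -> : cell h i `&` `]0, b] = cell h i.
  apply/setIidl => x; rewrite /cell/= !in_itv/= => /andP[x1 x2]; apply/andP; split.
    by apply: le_lt_trans x1; rewrite mulr_ge0// ltW.
  by apply: le_trans x2 _; rewrite -nh ler_pM2r// ler_nat.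
transitivity ((c i)%:E * (@lebesgue_measure R) (cell h i))%E => //.
rewrite /cell lebesgue_measure_itv/= lte_fin ltr_pM2r// ltr_nat ltnSn -EFinD -EFinM.
by congr _%:E; rewrite -mulrBl -natrB// subSnn mul1r mulrC.
Qed.

(* The staircase with [k] jumps of size [h] at [0, h, 2h, ...] stays within [h]
   of the ramp [min(., k h)]. *)
Lemma jump_count h u k : 0 < h -> 0 <= u ->
  let N := h * \sum_(i < k) (i%:R * h <= u)%R%:R in
  [/\ Num.min u (k%:R * h) <= N, N <= Num.min u (k%:R * h) + h & k%:R * h <= u -> N = k%:R * h].
Proof.
move=> h0 u0 /=; elim: k => [|k [IH1 IH2 IH3]].
  by rewrite big_ord0 mulr0 mul0r (min_idPr u0) add0r; split => //; exact: ltW.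
rewrite big_ord_recr/= mulrDr -natr1 mulrDl mul1r.
case: (leP (k%:R * h) u) => ku.
  rewrite IH3// mulr1; split.
  - by rewrite ge_min lexx orbT.
  - by rewrite -lerBlDr addrK le_min ku lerDl ltW.
  - by [].
move: IH1 IH2; rewrite (min_idPl (ltW ku)) mulr0 addr0 => IH1 IH2.
have ku' : u <= k%:R * h + h by apply: le_trans (ltW ku) _; rewrite lerDl ltW.
rewrite (min_idPl ku'); split => // kku.
by have := lt_le_trans ku (le_trans _ kku); rewrite lerDl (ltW h0) => /(_ isT); rewrite ltxx.
Qed.

End staircase.

Section pathwise.
Context {R : realType} {T : R} {d : nat}.
Hypothesis T0 : 0 <= T.
Variables (ft : cadlag T d -> R) (Dft : time T -> cadlag T d -> 'rV[R]_d).
Hypothesis dft : pathwise_derivative ft Dft.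
Hypothesis cft : continuous ft.
Hypothesis lDft : forall t, has_left_limit Dft t.
Hypothesis bDft : boundedness_preserving Dft.
Variable j : 'I_d.

Lemma jump_at_mvt (w : cadlag T d) t (y : R) : 0 < y -> exists2 z : R, 0 < z < y &
  ft (jump_at w t (y *: delta_mx 0 j)) - ft w =
  y * Dft t (jump_at w t (z *: delta_mx 0 j)) 0 j.
Proof.
move=> y0; pose phi (z : R) : R := ft (jump_at w t (z *: delta_mx 0 j)).
have dphi z : is_derive (z : R^o) 1 (phi : R^o -> R^o) (Dft t (jump_at w t (z *: delta_mx 0 j)) 0 j).
  have h : (fun h : R^o => h^-1 *: ((phi \o shift z) (h *: 1) - phi z)) @ 0^' -->
      Dft t (jump_at w t (z *: delta_mx 0 j)) 0 j.
    rewrite -[X in _ --> X]inner_delta.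
    have -> : (fun h : R^o => h^-1 *: ((phi \o shift z) (h *: 1) - phi z)) =
        (fun e => (ft (jump_at (jump_at w t (z *: delta_mx 0 j)) t (e *: delta_mx 0 j)) -
          ft (jump_at w t (z *: delta_mx 0 j))) / e).
      apply/funext => e; rewrite jump_at_add -scalerDl /phi /=.
      by rewrite [e%:A]mulr1 [e + z]addrC; exact: mulrC.
    exact: dft.
  apply: DeriveDef; last by apply: cvg_lim h; exact: Rhausdorff.
  by apply/cvg_ex; exists (Dft t (jump_at w t (z *: delta_mx 0 j)) 0 j); exact: h.
have [|z] := @MVT R phi _ 0 y y0 (fun z _ => dphi z).
  by apply: derivable_within_continuous => z _; have [] := dphi z.
rewrite in_itv/= subr0 => zy; rewrite /phi scale0r jump_at0 => ->.
by exists z => //; rewrite mulrC.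
Qed.

Fixpoint jumps (w : cadlag T d) (tau : nat -> time T) (y : R) (n : nat) : cadlag T d :=
  if n is m.+1 then jump_at (jumps w tau y m) (tau m) (y *: delta_mx 0 j) else w.

Lemma jumpsE (w : cadlag T d) tau (y : R) n u : jumps w tau y n u =
  w u + (y * \sum_(i < n) (clock (tau i) <= clock u)%R%:R) *: delta_mx 0 j.
Proof.
elim: n => [|n IH]; first by rewrite big_ord0 mulr0 scale0r addr0.
rewrite big_ord_recr/= mulrDr scalerDl addrA -IH /jump_at_fun.
by case: ifP => _; rewrite ?mulr1// mulr0 scale0r.
Qed.

Lemma norm_scale_delta (x : R) : `|x *: delta_mx 0 j : 'rV[R]_d| <= `|x|.
Proof.
apply: row_norm_le => // l; rewrite !mxE eqxx/=.
by case: eqP => _; rewrite ?mulr1 ?mulr0 ?normr0.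
Qed.

(** [xi i] is the path after [i] full jumps and the fraction of the next one supplied by the mean
    value theorem; at most [i + 1] jumps of size [y] separate it from [w]. *)
Lemma jumps_telescope (w : cadlag T d) tau (y : R) : 0 < y -> exists xi : nat -> cadlag T d,
  (forall i u, `|w u - xi i u| <= y * i.+1%:R) /\
  forall n, ft (jumps w tau y n) - ft w = \sum_(i < n) y * Dft (tau i) (xi i) 0 j.
Proof.
move=> y0; have h i := jump_at_mvt (jumps w tau y i) (tau i) y0.
have {h}[z zP] := choice (fun i => let: ex_intro2 z a b := h i in ex_intro _ z (conj a b)).
exists (fun i => jump_at (jumps w tau y i) (tau i) (z i *: delta_mx 0 j)); split.
  move=> i u; have [/andP[z0 zy] _] := zP i.
  rewrite /= /jump_at_fun jumpsE.
  set N := \sum_(_ < _) _.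
  have N0 : 0 <= N by apply: sumr_ge0.
  have Ni : N <= i%:R.
    rewrite -[i in leRHS]card_ord -sum1_card natr_sum; apply: ler_sum => k _.
    by rewrite ler_nat; case: (clock _ <= _).
  have zle : z i * (clock (tau i) <= clock u)%R%:R <= y.
    by case: (clock _ <= _); rewrite ?mulr1 ?mulr0; exact: ltW.
  have zge : 0 <= z i * (clock (tau i) <= clock u)%R%:R.
    by case: (clock _ <= _); rewrite ?mulr1 ?mulr0//; exact: ltW.
  rewrite [X in w u - X](_ : _ = w u + (y * N + z i * (clock (tau i) <= clock u)%R%:R) *: delta_mx 0 j).
    rewrite opprD addrA subrr sub0r normrN; apply: le_trans (norm_scale_delta _) _.
    rewrite ger0_norm; last by rewrite addr_ge0// mulr_ge0// ltW.
    by rewrite -natr1 mulrDr mulr1 lerD// ler_wpM2l// ltW.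
  rewrite scalerDl addrA; congr (_ + _).
  by case: ifP => _; rewrite ?mulr1 ?mulr0 ?scale0r.
elim=> [|n IH]; first by rewrite big_ord0 subrr.
rewrite big_ord_recr/= -IH; have [_ <-] := zP n.
by rewrite [RHS]addrC addrA subrK.
Qed.

Variables (b : time T) (w : C0 T d).
Hypothesis b0 : 0 < clock b.

Let mesh n : R := clock b / n%:R.
Let tau n i : time T := tclamp T0 (i%:R * mesh n).

Let mesh_gt0 n : (0 < n)%N -> 0 < mesh n.
Proof. by move=> n0; rewrite divr_gt0// ltr0n. Qed.

Let mesh_n n : (0 < n)%N -> n%:R * mesh n = clock b.
Proof. by move=> n0; rewrite /mesh mulrC divfK// pnatr_eq0 -lt0n. Qed.

Let clock_tau n i : (0 < n)%N -> (i <= n)%N -> clock (tau n i) = i%:R * mesh n.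
Proof.
move=> n0 ni; rewrite clock_tclamp_id//; apply/andP; split.
  by rewrite mulr_ge0// ltW// mesh_gt0.
apply: (@le_trans _ _ (n%:R * mesh n)); last by rewrite mesh_n// clock_le.
by rewrite ler_pM2r ?mesh_gt0// ler_nat.
Qed.

Lemma jumps_tilt (e : R) n u : 0 < e -> (0 < n)%N ->
  `|tilt j b e w u - jumps (C0_cadlag w) (tau n) (e * mesh n) n u| <= e * mesh n.
Proof.
move=> e0 n0; rewrite jumpsE /= /ramp_fun.
have [] := jump_count n (mesh_gt0 n0) (clock_ge0 u).
rewrite mesh_n//.
have -> : \sum_(i < n) (i%:R * mesh n <= clock u)%R%:R =
    \sum_(i < n) (clock (tau n i) <= clock u)%R%:R :> R.
  by apply: eq_bigr => i _; rewrite clock_tau// ltnW.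
set N := \sum_(_ < _) _ => N1 N2 _.
rewrite opprD addrACA subrr add0r -scalerBl; apply: le_trans (norm_scale_delta _) _.
rewrite -mulrA -mulrBr normrM (gtr0_norm e0) ler_pM2l//.
by rewrite ler_norml; apply/andP; split; lra.
Qed.

Let quotient m : R := m.+1%:R * (ft (C0_cadlag (tilt j b (m.+1%:R^-1) w)) - ft (C0_cadlag w)).

Lemma riemann_sum m : exists (n : nat) (xi : nat -> cadlag T d),
  [/\ (m < n)%N, forall i u, (i < n)%N -> `|w u - xi i u| <= m.+1%:R^-1 * clock b &
    `|quotient m - \sum_(i < n) mesh n * Dft (tau n i) (xi i) 0 j| <= m.+1%:R^-1].
Proof.
set e := m.+1%:R^-1; have e0 : 0 < e by rewrite invr_gt0.
(* The tolerance is [e * e] because the quotient divides by [e], leaving an error [e]. Below, [n]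
   exceeds [k] so that the staircase is within [r] of the shifted path, and exceeds [m] so that the
   mesh tends to 0. *)
have [r r0 hr] := continuous_cadlagP (@cft (C0_cadlag (tilt j b e w))) (mulr_gt0 e0 e0).
have [k kr] : exists k : nat, e * clock b / r < k%:R.
  by exists (Num.truncn (e * clock b / r)).+1; exact: truncnS_gt.
pose n := maxn m.+1 k; have n0 : (0 < n)%N by rewrite leq_max.
have enr : e * mesh n <= r.
  rewrite /mesh mulrA ler_pdivrMr ?ltr0n// [leRHS]mulrC -ler_pdivrMr//.
  by apply: le_trans (ltW kr) _; rewrite ler_nat leq_maxr.
have emesh0 : 0 < e * mesh n by rewrite mulr_gt0// mesh_gt0.
have [xi [xiw xisum]] := jumps_telescope (C0_cadlag w) (tau n) emesh0.
exists n, xi; split.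
- by rewrite leq_max leqnn.
- move=> i u ni; apply: le_trans (xiw i u) _.
  by rewrite -mulrA ler_pM2l// -(mesh_n n0) mulrC ler_pM2r ?mesh_gt0// ler_nat.
have := hr (jumps (C0_cadlag w) (tau n) (e * mesh n) n).
move=> /(_ (fun u => le_trans (jumps_tilt u e0 n0) enr)).
have := xisum n; under eq_bigr do rewrite -mulrA; rewrite -mulr_sumr.
set S := \sum_(_ < _) _; set J := ft (jumps _ _ _ _) => JS tJ.
have -> : quotient m - S = m.+1%:R * (ft (C0_cadlag (tilt j b e w)) - J).
  have -> : S = m.+1%:R * (J - ft (C0_cadlag w)) by rewrite JS mulrA divff// mul1r.
  by rewrite /quotient -/e -mulrBr; congr (_ * _); lra.
rewrite normrM normr_nat -ler_pdivlMl// -/e.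
exact: ltW.
Qed.

Definition left_gradient (t : R) (v : cadlag T d) : R :=
  left_limit (lDft (tclamp T0 t)) v 0 j.

Lemma Dft_bounded (B : R) : exists M : R, forall t (v : cadlag T d),
  (forall u, `|v u| <= B) -> `|Dft t v 0 j| <= M.
Proof.
(* The factor [d.+1] converts the maximum norm to the Euclidean one; the summand 1 provides the
   strict inequality of [boundedness_preserving]. *)
have [M hM] := bDft (d.+1%:R * B + 1).
exists M => t v vB; apply: le_trans (coord_le_enorm _ _) _; apply: hM.
apply: (@le_lt_trans _ _ (d.+1%:R * B)%:E); last by rewrite lte_fin ltrDl.
apply: ge_ereal_sup => _ [u _ <-]; rewrite lee_fin.
by apply: le_trans (enorm_le _) _; rewrite ler_wpM2l.
Qed.

(** The Riemann sum of [riemann_sum] is the integral of a staircase in [t]. The staircases are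
    uniformly bounded, as all paths [xi] stay in one ball, and converge pointwise to the left limit,
    so dominated convergence applies. *)
Theorem pathwise_quotient :
  (quotient m)%:E @[m --> \oo] -->
  (\int[lebesgue_measure]_(t in `]0%R, clock b]) (left_gradient t (C0_cadlag w))%:E)%E.
Proof.
have {}/choice[n_ /choice[xi_ H]] := riemann_sum.
pose c m i := Dft (tau (n_ m) i) (xi_ m i) 0 j.
pose S m := staircase (mesh (n_ m)) (n_ m) (c m).
have n0 m : (0 < n_ m)%N by have [/(leq_ltn_trans (leq0n m))] := H m.
have inv0 : (fun m : nat => m.+1%:R^-1 : R) @ \oo --> 0 by exact: cvg_harmonic.
have [B B0 wB] := C0_bounded T0 w.
have [M hM] := Dft_bounded (B + clock b).
have cM m i : (i < n_ m)%N -> `|c m i| <= M.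
  move=> im; apply: hM => u; rewrite -[xi_ m i u](subKr (w u)).
  apply: le_trans (ler_normB _ _) _; rewrite lerD//.
  have [_ + _] := H m; move=> /(_ i u im) h; apply: le_trans h _.
  by apply: ler_piMl; [exact: ltW|rewrite invf_le1// ler1n].
have M0 : 0 <= M by apply: le_trans (cM 0%N 0%N (n0 0%N)).
(* The value of the staircase at [t] is [Dft] at a node strictly before [t], less than one mesh or
   so away, and at a path close to [w]: exactly the situation of [left_limitP], which allows time
   and path to vary together. *)
have cvgS t : `]0%R, clock b]%classic t -> S m t @[m --> \oo] --> left_gradient t (C0_cadlag w).
  rewrite /= in_itv/= => tb; apply/cvgrPdist_lt => eta eta0.
  have [delta delta0 hdelta] := left_limitP (lDft (tclamp T0 t)) (C0_cadlag w) eta0.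
  have tE : clock (tclamp T0 t) = t.
    by rewrite clock_tclamp_id//; have := clock_le b; lra.
  have /cvgrPdist_lt /(_ (delta / (clock b))) := inv0.
  move=> /(_ (divr_gt0 delta0 b0)); apply: filterS => m.
  rewrite sub0r normrN gtr0_norm ?invr_gt0// ltr_pdivlMr// => mdelta.
  have tb' : 0 < t <= (n_ m)%:R * mesh (n_ m) by rewrite mesh_n.
  have [i [/andP[it ti]]] := staircase_in (c m) (mesh_gt0 (n0 m)) tb'.
  rewrite -/(S m t) => ->.
  have ci : clock (tau (n_ m) i) = i%:R * mesh (n_ m) by rewrite clock_tau// ltnW.
  have mesh_delta : mesh (n_ m) < delta.
    apply: le_lt_trans mdelta; rewrite /mesh mulrC ler_pM2r//.
    by rewrite lef_pV2 ?posrE ?ltr0n// ler_nat; have [] := H m.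
  have := hdelta (tau (n_ m) i) (xi_ m i); rewrite tE ci => /(_ _ _ _) h.
  apply: le_lt_trans (h _ _ _) => //.
  - rewrite /left_gradient /c; have := row_coord_le (left_limit (lDft (tclamp T0 t)) (C0_cadlag w) - Dft (tau (n_ m) i) (xi_ m i)) j.
    by rewrite !mxE.
  - by move: ti; rewrite -natr1 mulrDl mul1r; lra.
  - by move=> u; have [_ + _] := H m => /(_ i u (ltn_ord i)) /le_trans; apply; exact: ltW.
have mI : measurable (`]0%R, clock b]%classic : set R) by exact: measurable_itv.
have lI : ((@lebesgue_measure R) `]0%R, clock b]%classic < +oo)%E.
  by rewrite lebesgue_measure_itv/= lte_fin b0 -EFinD ltry.
have intS : (\int[lebesgue_measure]_(t in `]0%R, clock b]) (S m t)%:E)%E @[m --> \oo] -->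
    (\int[lebesgue_measure]_(t in `]0%R, clock b]) (left_gradient t (C0_cadlag w))%:E)%E.
  apply: (@dominated_cvg _ _ _ (@lebesgue_measure R) _ _ _ _ (cst M%:E)) => //.
  - by move=> m; apply/measurable_EFinP; apply: measurable_funTS; exact: measurable_staircase.
  - by move=> t tb; apply: cvg_EFin; [exact: nearW|exact: cvgS].
  - apply: (@measurable_bounded_integrable _ _ _ _ (cst M)) => //.
    by exists `|M|; split => // x /ltW Mx y _; exact: le_trans Mx.
  - move=> m t; rewrite /= in_itv/= lee_fin -{1}(mesh_n (n0 m)) => tb.
    have [i [_]] := staircase_in (c m) (mesh_gt0 (n0 m)) tb.
    rewrite -/(S m t) => ->.
    exact: cM.
have -> : (fun m => (quotient m)%:E) = (fun m => (\int[lebesgue_measure]_(t in `]0%R, clock b]) (S m t)%:E)%E +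
    (quotient m - \sum_(i < n_ m) mesh (n_ m) * c m i)%:E)%E.
  apply/funext => m; rewrite integral_staircase// -EFinD; congr _%:E; rewrite -/(mesh _); lra.
rewrite -[X in _ --> X]adde0; apply: cvgeD => //.
- by rewrite fin_num_adde_defl.
- apply: cvg_EFin; first exact: nearW.
  apply/cvgrPdist_lt => eta eta0; have /cvgrPdist_lt /(_ eta eta0) := inv0; apply: filterS => m.
  rewrite !sub0r !normrN; apply: le_lt_trans; have [_ _ h] := H m.
  by rewrite [leRHS]gtr0_norm ?invr_gt0.
Qed.

End pathwise.

(** * Left limits of the pathwise derivative *)

(* Only left limits are assumed: a point where [phi] jumps by [3 e] is isolated
   on its left among such points, hence the endpoint of a rational interval. *)
Lemma countable_jumps {R : realType} (D : set R) (phi l : R -> R) :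
  (forall t (eta : R), D t -> 0 < eta -> exists2 delta : R, 0 < delta &
    forall s : R, t - delta < s < t -> `|l t - phi s| < eta) ->
  countable [set t | D t /\ phi t <> l t].
Proof.
move=> philim.
pose E (e : R) := [set t | D t /\ 3 * e <= `|l t - phi t|].
have -> : [set t | D t /\ phi t <> l t] = \bigcup_n E n.+1%:R^-1.
  apply/seteqP; split => t.
    move=> [Dt /eqP lt]; have e0 : 0 < `|l t - phi t| / 3.
      by rewrite divr_gt0// normr_gt0 subr_eq0 eq_sym.
    have [n _ /(_ n (leqnn n)) /= ne] := near_infty_natSinv_lt (PosNum e0).
    by exists n => //; split => //; rewrite mulrC -ler_pdivlMr// ltW.
  move=> [n _ [Dt h]]; split => // lt; move: h; rewrite lt subrr normr0 leNgt.
  by rewrite mulr_gt0// invr_gt0.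
apply: bigcup_countable => // n _.
have n0 : 0 < (n.+1%:R^-1 : R) by rewrite invr_gt0.
move: (n.+1%:R^-1) n0 => e n0.
have gap t : exists delta : R, E e t -> 0 < delta /\ forall s, t - delta < s < t -> ~ E e s.
  have [[Dt Et]|nE] := pselect (E e t); last by exists 1 => /nE.
  have [delta delta0 h] := philim t _ Dt n0.
  exists delta => _; split => // s st [Ds]; apply/negP; rewrite -ltNge.
  have [delta' delta'0 h'] := philim s _ Ds n0.
  (* The time [s'] is close enough to both [s] and [t] from the left. In the chain [l s], [phi s'],
     [l t], [phi s] each of the three gaps is below [e]; hence the factor 3 in [E]. *)
  pose s' := Num.max (s - delta' / 2) ((t - delta + s) / 2).
  have /andP[s1 s2] := st.
  have s's : s' < s by rewrite gt_max; apply/andP; split; lra.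
  have s'1 : s - delta' < s' by rewrite lt_max; apply/orP; left; lra.
  have s'2 : t - delta < s' by rewrite lt_max; apply/orP; right; lra.
  have := h s st; have := h' s'; rewrite s'1 s's => /(_ isT).
  have := h s'; rewrite s'2 (lt_trans s's s2) => /(_ isT).
  rewrite !ltr_norml => /andP[? ?] /andP[? ?] /andP[? ?].
  by apply/andP; split; lra.
have {gap}[delta deltaP] := choice gap.
have ex_q t : exists q : rat, E e t -> t - delta t < ratr q < t.
  have [Et|nE] := pselect (E e t); last by exists 0 => /nE.
  have [|q] := @rat_in_itvoo R (t - delta t) t; first by have [] := deltaP t Et; lra.
  by rewrite in_itv/= => tq; exists q.
have [q qP] := choice ex_q.
apply/countable_injP; exists (pickle \o q) => t t' /set_mem Et /set_mem Et' /=.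
move=> /(pcan_inj pickleK) qq; apply/eqP; rewrite eq_le !leNgt.
have /andP[a1 a2] := qP t Et; have /andP[b1 b2] := qP t' Et'; rewrite qq in a1 a2.
apply/andP; split; apply/negP => tt.
- by have [_ /(_ t')] := deltaP t Et; apply => //; apply/andP; split => //; lra.
- by have [_ /(_ t)] := deltaP t' Et'; apply => //; apply/andP; split => //; lra.
Qed.

Section gradient_versions.
Context {R : realType} {T : R} {d : nat}.
Hypothesis T0 : 0 < T.
Variables (Dft : time T -> cadlag T d -> 'rV[R]_d).
Hypothesis cDft : forall t, continuous (Dft t).
Hypothesis lDft : forall t, has_left_limit Dft t.
Variable j : 'I_d.
Local Notation clamp := (tclamp (ltW T0)).
Local Notation grad := (left_gradient (ltW T0) lDft j).

Lemma left_gradientP (v : cadlag T d) (t eta : R) : 0 < t <= T -> 0 < eta ->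
  exists2 delta : R, 0 < delta & forall s (v' : cadlag T d), t - delta < s < t ->
    (forall u, `|v u - v' u| <= delta) -> `|grad t v - Dft (clamp s) v' 0 j| < eta.
Proof.
move=> /andP[t0 tT] eta0.
have [delta delta0 h] := left_limitP (lDft (clamp t)) v eta0.
exists delta => // s v' /andP[s1 s2] vv'.
have tE : clock (clamp t) = t by rewrite clock_tclamp_id// tT ltW.
have sE : clock (clamp s) = Num.max 0 s.
  by rewrite clock_tclamp (min_idPl _)//; apply: le_trans tT; exact: ltW.
apply: le_lt_trans (h (clamp s) v' _ _ vv').
- have := row_coord_le (left_limit (lDft (clamp t)) v - Dft (clamp s) v') j.
  by rewrite !mxE.
- by rewrite tE sE lt_max s1 orbT.
- by rewrite tE sE gt_max t0.
Qed.

(** At fixed time the derivative is measurable in the path by continuity; a staircase in time with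
    such coefficients is jointly measurable, and the left limit is the pointwise limit of these
    staircases. Outside []0, T]] the default value is 0. *)
Lemma measurable_left_gradient : measurable_fun [set: C0 T d * R]
  (fun p : C0 T d * R => if 0 < p.2 <= T then grad p.2 (C0_cadlag p.1) else 0).
Proof.
pose h n : R := T / n.+1%:R.
have h0 n : 0 < h n by rewrite divr_gt0.
have hT n : n.+1%:R * h n = T by rewrite /h mulrC divfK.
pose F n (p : C0 T d * R) : R :=
  staircase (h n) n.+1 (fun i => Dft (clamp (i%:R * h n)) (C0_cadlag p.1) 0 j) p.2.
apply: (@measurable_fun_cvg _ _ _ _ F).
  move=> n; apply: measurable_sum => i; apply: measurable_funM.
    apply: (measurableT_comp (f := fun w : C0 T d => Dft (clamp (i%:R * h n)) (C0_cadlag w) 0 j)).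
      apply: (measurable_continuous_cadlag (ltW T0) (psi := fun v => Dft (clamp (i%:R * h n)) v 0 j)).
      move=> v; apply: (cvg_comp (Dft (clamp (i%:R * h n))) (fun x : 'rV[R]_d => x 0 j)).
        exact: cDft.
      exact: coord_continuous.
    exact: measurable_fst.
  apply: (measurableT_comp (f := \1_(cell (h n) i) : R -> R)); last exact: measurable_snd.
  by apply: measurable_indic; exact: measurable_itv.
move=> [w t] _ /=; case: ifPn => tT; last first.
  have -> : F^~ (w, t) = cst 0 by apply/funext => n; rewrite /F staircase_out// hT.
  exact: cvg_cst.
apply/cvgrPdist_lt => eta eta0.
have [delta delta0 hd] := left_gradientP (C0_cadlag w) tT eta0.
have inv0 : (fun m : nat => m.+1%:R^-1 : R) @ \oo --> 0 by exact: cvg_harmonic.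
have /cvgrPdist_lt /(_ (delta / T)) := inv0.
move=> /(_ (divr_gt0 delta0 T0)); apply: filterS => n.
rewrite sub0r normrN gtr0_norm ?invr_gt0// ltr_pdivlMr// mulrC -/(h n) => ndelta.
have [|i [/andP[it ti] Fi]] := @staircase_in R (h n) n.+1
    (fun i => Dft (clamp (i%:R * h n)) (C0_cadlag w) 0 j) t (h0 n).
  by rewrite hT.
rewrite /F /= Fi; apply: hd.
  by rewrite it andbT; move: ti; rewrite -natr1 mulrDl mul1r; lra.
by move=> u; rewrite subrr normr0 ltW.
Qed.

(** For each step path the exceptional times are countable by [countable_jumps]. At any other time
    the derivative at [w] is within [e / 3], and the left limit within [2 e / 3], of their common
    value at a nearby step path. *)
Lemma left_gradient_ae : exists2 N : set R, countable N &
  forall t (w : C0 T d), 0 < t <= T -> ~ N t ->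
    Dft (clamp t) (C0_cadlag w) 0 j = grad t (C0_cadlag w).
Proof.
pose N l := [set t | 0 < t <= T /\ Dft (clamp t) (step_path (ltW T0) l) 0 j <> grad t (step_path (ltW T0) l)].
exists (\bigcup_(l in [set: seq (rat * 'rV[rat]_d)]) N l).
  apply: bigcup_countable => // l _.
  apply: (@countable_jumps R [set t | 0 < t <= T] (fun t => Dft (clamp t) (step_path (ltW T0) l) 0 j)
    (fun t => grad t (step_path (ltW T0) l))) => t eta /= tT eta0.
  have [delta delta0 h] := left_gradientP (step_path (ltW T0) l) tT eta0.
  by exists delta => // s st; apply: h => // u; rewrite subrr normr0 ltW.
move=> t w tT Nt; apply/eqP; rewrite -subr_eq0 -normr_le0; apply/ler_addgt0Pl => e e0.
rewrite addr0; have e3 : 0 < e / 3 by rewrite divr_gt0.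
have [delta delta0 hd] := left_gradientP (C0_cadlag w) tT e3.
have [r r0 hr] := continuous_cadlagP (@cDft (clamp t) (C0_cadlag w)) e3.
have rd0 : 0 < Num.min r delta by rewrite lt_min r0.
have [l wl] := step_path_dense (ltW T0) w rd0.
have lE : Dft (clamp t) (step_path (ltW T0) l) 0 j = grad t (step_path (ltW T0) l).
  by apply: contrapT => h; apply: Nt; exists l.
have [delta' delta'0 hd'] := left_gradientP (step_path (ltW T0) l) tT e3.
have m0 : 0 < Num.min delta delta' by rewrite lt_min delta0.
(* At the time [s] the derivative along the step path is close to both left limits, the one at [w]
   and the one at the step path, and so compares them. *)
pose s := t - Num.min delta delta' / 2.
have s1 : t - delta < s < t.
  have : Num.min delta delta' <= delta by rewrite ge_min lexx.
  by rewrite /s => ?; apply/andP; split; lra.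
have s2 : t - delta' < s < t.
  have : Num.min delta delta' <= delta' by rewrite ge_min lexx orbT.
  by rewrite /s => ?; apply/andP; split; lra.
have wr u : `|C0_cadlag w u - step_path (ltW T0) l u| <= r.
  by apply: le_trans (wl u) _; rewrite ge_min lexx.
have wd u : `|C0_cadlag w u - step_path (ltW T0) l u| <= delta.
  by apply: le_trans (wl u) _; rewrite ge_min lexx orbT.
have h1 := hd _ _ s1 wd.
have h2 : `|grad t (step_path (ltW T0) l) - Dft (clamp s) (step_path (ltW T0) l) 0 j| < e / 3.
  by apply: hd' => // u; rewrite subrr normr0 ltW.
have := row_coord_le (Dft (clamp t) (C0_cadlag w) - Dft (clamp t) (step_path (ltW T0) l)) j.
move=> /le_lt_trans /(_ (hr _ wr)); rewrite !mxE lE.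
move: h1 h2; rewrite !ltr_norml => /andP[? ?] /andP[? ?] /andP[? ?].
by rewrite ler_norml; apply/andP; split; lra.
Qed.

End gradient_versions.

(** * Wiener integrals under shifts *)

Section square_integral.
Local Open Scope ereal_scope.
Context d (X : measurableType d) (R : realType) (m : {measure set X -> \bar R}).

Lemma cvge0_near (u : nat -> \bar R) (eta : R) : u n @[n --> \oo] --> 0 ->
  (0 < eta)%R -> \forall n \near \oo, u n <= eta%:E.
Proof.
move=> /fine_cvgP[ufin /cvgrPdist_lt /(_ eta)] h eta0.
near=> n; have un : u n \is a fin_num by near: n.
rewrite -(fineK un) lee_fin; apply: le_trans (ler_norm _) _; apply: ltW.
rewrite -normrN -[X in `|X|%R]add0r; near: n; exact: h.
Unshelve. all: by end_near. Qed.

Lemma integral_sqr_le_Lnorm (f : X -> R) (eta : R) :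
  'N[m]_2%:E[EFin \o f] <= eta%:E -> \int[m]_x (f x ^+ 2)%:E <= (eta ^+ 2)%:E.
Proof.
move=> fe; have N0 := @Lnorm_ge0 _ _ _ m 2%:E (EFin \o f).
have Nfin : 'N[m]_2%:E[EFin \o f] \is a fin_num.
  by rewrite ge0_fin_numE//; apply: le_lt_trans fe _; rewrite ltry.
have <- : 'N[m]_2%:E[EFin \o f] `^ 2 = \int[m]_x (f x ^+ 2)%:E.
  rewrite powR_Lnorm//; apply: eq_integral => x _ /=.
  by rewrite powR_mulrn// real_normK ?num_real.
rewrite -(fineK Nfin) poweR_EFin powR_mulrn ?fine_ge0// lee_fin.
rewrite lerXn2r ?nnegrE ?fine_ge0//.
  by rewrite -lee_fin; apply: le_trans fe.
by rewrite -lee_fin fineK.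
Qed.

(** A substitute for Cauchy-Schwarz, linear in [eta] and free of square roots. The constants of the
    form [(1 + A) / 2] in the later estimates come from here. *)
Lemma ge0_integral_mul_le (D : set X) (f g : X -> R) (eta A : R) :
  measurable D -> measurable_fun D f -> measurable_fun D g -> (0 < eta)%R ->
  \int[m]_(x in D) (f x ^+ 2)%:E <= (eta ^+ 2)%:E ->
  \int[m]_(x in D) (g x ^+ 2)%:E <= A%:E ->
  \int[m]_(x in D) `|f x * g x|%:E <= (eta * ((1 + A) / 2))%:E.
Proof.
move=> mD mf mg eta0 fe gA.
(* AM-GM: [|f g| <= f^2 / (2 eta) + (eta / 2) g^2] *)
have a0 : (0 <= (2 * eta)^-1)%R by rewrite invr_ge0 mulr_ge0// ltW.
have b0 : (0 <= eta / 2)%R by rewrite divr_ge0// ltW.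
have mf2 : measurable_fun D (fun x => (f x ^+ 2)%:E).
  by apply/measurable_EFinP; exact: measurable_funX.
have mg2 : measurable_fun D (fun x => (g x ^+ 2)%:E).
  by apply/measurable_EFinP; exact: measurable_funX.
apply: (@le_trans _ _ (\int[m]_(x in D) (((2 * eta)^-1)%:E * (f x ^+ 2)%:E + (eta / 2)%:E * (g x ^+ 2)%:E))).
  apply: ge0_le_integral => //.
  - by apply/measurable_EFinP; apply: measurableT_comp => //; exact: measurable_funM.
  - by apply: emeasurable_funD; exact: measurable_funeM.
  - move=> x _; rewrite -!EFinM -EFinD lee_fin.
    have e0 : (eta != 0)%R by rewrite gt_eqF.
    rewrite normrM -[(f x ^+ 2)%R]real_normK ?num_real// -[(g x ^+ 2)%R]real_normK ?num_real//.
    rewrite -subr_ge0 [X in (0 <= X)%R](_ : _ = (2 * eta)^-1 * (`|f x| - eta * `|g x|) ^+ 2)%R.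
      by rewrite mulr_ge0// sqr_ge0.
    by field.
rewrite ge0_integralD//; last 4 first.
- by move=> x _; rewrite mule_ge0// lee_fin// sqr_ge0.
- exact: measurable_funeM.
- by move=> x _; rewrite mule_ge0// lee_fin// sqr_ge0.
- exact: measurable_funeM.
rewrite !ge0_integralZl//; last 2 first.
- by move=> x _; rewrite lee_fin sqr_ge0.
- by move=> x _; rewrite lee_fin sqr_ge0.
apply: (@le_trans _ _ (((2 * eta)^-1)%:E * (eta ^+ 2)%:E + (eta / 2)%:E * A%:E)).
  by apply: leeD; rewrite lee_wpmul2l// lee_fin.
rewrite -!EFinM -EFinD lee_fin le_eqVlt; apply/orP; left; apply/eqP.
by field; rewrite gt_eqF.
Qed.

End square_integral.

Section tilt_estimates.
Context {R : realType} {T : R} {d : nat}.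
Variable mu : probability (C0 T d) R.
Hypothesis hmu : wiener_measure mu.
Hypothesis T0 : 0 < T.
Variables (j : 'I_d) (b : time T).

(** The constant of [ge0_integral_mul_le] when [A] is the second moment of [tilt_density]. *)
Definition tilt_cst (x : R) : R := (1 + expR (x ^+ 2 * clock b)) / 2.

Lemma tilt_cst_ge0 (x : R) : 0 <= tilt_cst x.
Proof. by rewrite divr_ge0// addr_ge0// expR_ge0. Qed.

Lemma tilt_cst_mono (x : R) : 0 <= x <= 1 -> tilt_cst x <= tilt_cst 1.
Proof.
move=> /andP[x0 x1]; rewrite /tilt_cst ler_pM2r// lerD2l ler_expR.
by rewrite ler_wpM2r ?clock_ge0// lerXn2r ?nnegrE.
Qed.

Lemma integral_tilt_le (phi : C0 T d -> R) (x eta : R) :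
  measurable_fun [set: C0 T d] phi -> 0 < eta ->
  (\int[mu]_w (phi w ^+ 2)%:E <= (eta ^+ 2)%:E)%E ->
  (\int[mu]_w `|phi (tilt j b x w)|%:E <= (eta * tilt_cst x)%:E)%E.
Proof.
move=> mphi eta0 phie.
rewrite (ge0_integral_tilt hmu T0 j b x (phi := fun w => `|phi w|%:E)); last 2 first.
- by apply/measurable_EFinP; exact: measurableT_comp.
- by move=> w; rewrite lee_fin.
have md := @measurable_tilt_density R T d j b x.
under eq_integral => w _ do rewrite -EFinM -[tilt_density _ _ _ _]ger0_norm ?tilt_density_ge0// -normrM.
apply: ge0_integral_mul_le => //.
by rewrite integral_tilt_density_sqr.
Qed.

Lemma tilt0 w : tilt j b 0 w = w.
Proof. by apply: C0_eq => t /=; rewrite /ramp_fun mul0r scale0r addr0. Qed.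

Lemma integral_abs_le (phi : C0 T d -> R) (eta : R) :
  measurable_fun [set: C0 T d] phi -> 0 < eta ->
  (\int[mu]_w (phi w ^+ 2)%:E <= (eta ^+ 2)%:E)%E ->
  (\int[mu]_w `|phi w|%:E <= (eta * tilt_cst 0)%:E)%E.
Proof.
move=> mphi eta0 phie; rewrite -(eq_integral _ _ (fun w _ => congr1 (fun v => `|phi v|%:E) (tilt0 w))).
exact: integral_tilt_le.
Qed.

End tilt_estimates.

Section wiener_integral_tilt.
Context {R : realType} {T : R} {d : nat}.
Variable mu : probability (C0 T d) R.
Hypothesis hmu : wiener_measure mu.
Hypothesis T0 : 0 < T.
Variables (j : 'I_d) (b : time T).
Hypothesis b0 : 0 < clock b.
Local Notation I := (`]0%R, clock b]%classic).
Local Notation leb := (@lebesgue_measure R).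

(** The inner product in [L^2] of [k] with [h' = e_j 1_[0,b]]: the rate at which the Wiener integral
    of [k] grows along the shift. *)
Definition drift (k : R -> 'rV[R]_d) : R := (\int[leb]_(t in I) k t 0 j)%R.

Lemma leb_I : leb I = (clock b)%:E.
Proof. by rewrite lebesgue_measure_itv/= lte_fin b0 sube0. Qed.

Lemma simple_funE (s : simple_integrand T d) u :
  simple_fun s u 0 j = \sum_(p <- s) p.1.1 0 j * \1_(`]clock p.1.2, clock p.2]) u.
Proof.
rewrite /simple_fun summxE; apply: eq_bigr => p _.
by rewrite !mxE mulrC indicE mem_setE in_itv.
Qed.

Lemma integral_cellI (s t : time T) : clock s <= clock t ->
  (\int[leb]_(u in I) (\1_(`]clock s, clock t]) u)%:E =
   (Num.min (clock t) (clock b) - Num.min (clock s) (clock b))%:E)%E.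
Proof.
move=> st; rewrite integral_indic//.
have -> : `]clock s, clock t]%classic `&` I = `]clock s, Num.min (clock t) (clock b)]%classic.
  apply/seteqP; split => x /=; rewrite !in_itv/= le_min.
    by move=> [/andP[-> ->] /andP[_ ->]].
  by move=> /and3P[sx -> ->]; rewrite sx (le_lt_trans (clock_ge0 s)).
transitivity (leb `]clock s, Num.min (clock t) (clock b)]%classic) => //.
rewrite lebesgue_measure_itv/= lte_fin lt_min -EFinD.
have [bs|sb] := leP (clock b) (clock s).
  by rewrite (min_idPr (le_trans bs st)) andbF subrr.
rewrite andbT; have [st'|ts] := ltP (clock s) (clock t); first by [].
have <- : clock s = clock t by apply/eqP; rewrite eq_le st.
by rewrite (min_idPl (ltW sb)) subrr.
Qed.

Lemma integrable_cellI (s t : R) : leb.-integrable I (fun u => (\1_(`]s, t]) u : R)%:E).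
Proof.
apply: (@integrableS _ _ _ leb setT) => //; exact: integrable_indic_itv.
Qed.

Lemma integrable_simple_fun (s : simple_integrand T d) :
  leb.-integrable I (fun u => (simple_fun s u 0 j)%:E).
Proof.
rewrite (_ : (fun u => _) = fun u => (\sum_(p <- s) (p.1.1 0 j)%:E * (\1_(`]clock p.1.2, clock p.2]) u)%:E)%E).
  apply: integrable_sum => // p _.
  by apply: integrableZl => //; exact: integrable_cellI.
by apply/funext => u; rewrite simple_funE -sumEFin; apply: eq_bigr => p _; rewrite EFinM.
Qed.

Lemma integral_simple_fun (s : simple_integrand T d) : simple_wf s ->
  (\int[leb]_(u in I) (simple_fun s u 0 j)%:E =
  (\sum_(p <- s) p.1.1 0 j * (Num.min (clock p.2) (clock b) - Num.min (clock p.1.2) (clock b)))%:E)%E.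
Proof.
elim: s => [_|p s IH /= /andP[ps wfs]].
  under eq_integral do rewrite simple_funE big_nil; by rewrite integral0 big_nil.
under eq_integral do rewrite simple_funE big_cons -simple_funE EFinD EFinM.
rewrite integralD//; last 2 first.
- by apply: integrableZl => //; exact: integrable_cellI.
- exact: integrable_simple_fun.
rewrite IH// integralZl//; last exact: integrable_cellI.
by rewrite integral_cellI// big_cons -EFinM -EFinD.
Qed.

Lemma simple_integral_tilt (s : simple_integrand T d) x w : simple_wf s ->
  simple_integral s (tilt j b x w) = simple_integral s w + x * drift (simple_fun s).
Proof.
move=> wfs; rewrite /drift /Rintegral integral_simple_fun//= mulr_sumr -big_split/=.
apply: eq_bigr => p _.
rewrite /inner (bigD1 j)//= [in RHS](bigD1 j)//= addrAC; congr (_ + _); last first.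
  apply: eq_bigr => l lj; rewrite !mxE (negbTE lj) andbF !mulr0 !addr0//.
by rewrite !mxE !eqxx/= mulr1; ring.
Qed.

Lemma measurable_simple_integral (s : simple_integrand T d) :
  measurable_fun [set: C0 T d] (simple_integral s).
Proof.
apply: measurable_sum => p; apply: measurable_sum => l.
apply: measurable_funM; first exact: measurable_cst.
under eq_fun do rewrite !mxE.
by apply: measurable_funB; exact: measurable_eval.
Qed.

End wiener_integral_tilt.

Section square_integrable.
Context dX (X : measurableType dX) {R : realType} (m : {measure set X -> \bar R}).

Lemma integrable_sqr (D : set X) (f : X -> R) : measurable D -> (m D < +oo)%E ->
  measurable_fun D f -> (\int[m]_(x in D) (f x ^+ 2)%:E < +oo)%E ->
  m.-integrable D (EFin \o f).
Proof.
move=> mD mDoo mf f2.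
have mf2 : measurable_fun D (fun x => (f x ^+ 2)%:E).
  by apply/measurable_EFinP; exact: measurable_funX.
apply: (@le_integrable _ _ _ _ _ mD _ (EFin \o (fun x => 1 + f x ^+ 2))).
- exact/measurable_EFinP.
- move=> x _ /=; rewrite lee_fin [leRHS]ger0_norm; last by rewrite addr_ge0// sqr_ge0.
  rewrite -real_normK ?num_real//; have : 0 <= `|f x| by []; move: (`|f x|) => y y0.
  have : 0 <= (y - 1/2) ^+ 2 by exact: sqr_ge0.
  by rewrite sqrrB; nra.
- have h1 : m.-integrable D (EFin \o cst (1 : R)).
    apply: (@measurable_bounded_integrable _ _ _ _ (cst 1)) => //.
    by exists 1; split => // y /ltW y1 x _; rewrite /= normr1.
  have h2 : m.-integrable D (EFin \o (fun x => f x ^+ 2)).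
    apply/integrableP; split => //; under eq_integral do rewrite /= ger0_norm ?sqr_ge0//.
    exact: f2.
  by apply: eq_integrable (integrableD mD h1 h2).
Qed.

Context {d : nat}.

Lemma vmeasurableB (A : set X) (u v : X -> 'rV[R]_d) :
  vmeasurable A u -> vmeasurable A v -> vmeasurable A (fun x => u x - v x).
Proof.
move=> hu hv l; rewrite (_ : (fun x => _) = (fun x => u x 0 l - v x 0 l)).
  exact: measurable_funB.
by apply/funext => x; rewrite !mxE.
Qed.

Lemma coord_sqL2_le (A B : set X) (u : X -> 'rV[R]_d) j :
  measurable A -> measurable B -> B `<=` A -> vmeasurable A u ->
  (\int[m]_(x in B) (u x 0 j ^+ 2)%:E <= sqL2 m A u)%E.
Proof.
move=> mA mB BA mu; rewrite /sqL2.
have me : measurable_fun A (fun x => (enorm (u x) ^+ 2)%:E).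
  apply/measurable_EFinP; under eq_fun do rewrite sqr_enorm.
  by apply: measurable_sum => i; exact: measurable_funM.
apply: (@le_trans _ _ (\int[m]_(x in B) (enorm (u x) ^+ 2)%:E)%E).
  apply: ge0_le_integral => //.
  - by move=> x _; rewrite lee_fin sqr_ge0.
  - by apply/measurable_EFinP/measurable_funX; exact: measurable_funS (mu j).
  - exact: measurable_funS me.
  - by move=> x _; rewrite lee_fin sqr_enorm sqr_coord_le_inner.
apply: ge0_subset_integral => //.
by move=> x _; rewrite lee_fin sqr_ge0.
Qed.

End square_integrable.

Section wiener_shift.
Context {R : realType} {T : R} {d : nat}.
Variable mu : probability (C0 T d) R.
Hypothesis hmu : wiener_measure mu.
Hypothesis T0 : 0 < T.
Variables (j : 'I_d) (b : time T).
Hypothesis b0 : 0 < clock b.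
Local Notation I := (`]0%R, clock b]%classic).
Local Notation leb := (@lebesgue_measure R).

Lemma I_subset : I `<=` `[0, T]%classic.
Proof.
move=> x /=; rewrite !in_itv/= => /andP[x0 xb]; rewrite ltW//=.
exact: le_trans xb (clock_le b).
Qed.

Lemma vmeasurable_simple_fun (s : simple_integrand T d) (A : set R) : vmeasurable A (simple_fun s).
Proof.
move=> l; under eq_fun do rewrite simple_funE.
apply: measurable_sum => p; apply: measurable_funM; first exact: measurable_cst.
by apply: measurable_indic; exact: measurable_itv.
Qed.

Lemma integrable_L2_coord (k : R -> 'rV[R]_d) : L2_integrand T k ->
  leb.-integrable I (fun t => (k t 0 j)%:E).
Proof.
move=> [mk k2].
have lI : (leb I < +oo)%E by rewrite (leb_I b0) ltry.
apply: (@integrable_sqr _ _ _ leb I (fun t => k t 0 j)) => //.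
- by apply: measurable_funS (mk j) => //; exact: I_subset.
- apply: le_lt_trans k2; apply: coord_sqL2_le => //; exact: I_subset.
Qed.

Lemma drift_dist (k : R -> 'rV[R]_d) (s : simple_integrand T d) (eta : R) :
  L2_integrand T k -> 0 < eta ->
  (sqL2 leb `[0%R, T]%classic (fun u => simple_fun s u - k u)%R <= (eta ^+ 2)%:E)%E ->
  `|drift j b (simple_fun s) - drift j b k| <= eta * ((1 + clock b) / 2).
Proof.
move=> kL2 eta0 sk; have [mk _] := kL2.
have is_ : leb.-integrable I (fun u => (simple_fun s u 0 j)%:E) by exact: integrable_simple_fun.
have ik := integrable_L2_coord kL2.
have isk : leb.-integrable I (EFin \o (fun t => simple_fun s t 0 j - k t 0 j)).
  by apply: eq_integrable (integrableB _ is_ ik).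
rewrite /drift -RintegralB// -lee_fin EFin_normr_Rintegral//.
have mI : measurable_fun I (fun t => simple_fun s t 0 j - k t 0 j).
  apply: measurable_funB; first exact: vmeasurable_simple_fun.
  by apply: measurable_funS (mk j) => //; exact: I_subset.
apply: (@le_trans _ _ (\int[leb]_(t in I) `|(simple_fun s t 0 j - k t 0 j)%R%:E|)%E).
  by apply: le_abse_integral => //; exact/measurable_EFinP.
apply: (@le_trans _ _ (\int[leb]_(t in I) `|(simple_fun s t 0 j - k t 0 j)%R * cst 1%R t|%R%:E)%E).
  rewrite le_eqVlt; apply/orP; left; apply/eqP; apply: eq_integral => t _.
  by rewrite mulr1.
apply: (@ge0_integral_mul_le _ _ _ leb I (fun t => simple_fun s t 0 j - k t 0 j) (cst 1)) => //.
  apply: le_trans sk.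
  apply: (@le_trans _ _ (\int[leb]_(t in I) (((simple_fun s t - k t)%R 0 j ^+ 2)%R)%:E)%E).
    rewrite le_eqVlt; apply/orP; left; apply/eqP; apply: eq_integral => t _.
    by rewrite !mxE.
  apply: coord_sqL2_le => //; first exact: I_subset.
  by apply: vmeasurableB => //; exact: vmeasurable_simple_fun.
apply: (@le_trans _ _ (\int[leb]_(t in I) cst 1%E t)%E).
  rewrite le_eqVlt; apply/orP; left; apply/eqP; apply: eq_integral => t _.
  by rewrite /= expr1n.
rewrite (@integral_cst _ _ _ leb)// mul1e.
have lI : (leb I <= (clock b)%:E)%E by rewrite (leb_I b0).
exact: lI.
Qed.

(** The identity is exact for simple integrands. It passes to the limit because the Cameron-Martin
    density controls [W] after the shift as well as before, so the [L^1] norm of the defect [D] is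
    below every [e]. *)
Lemma wiener_integral_shift (k : R -> 'rV[R]_d) W x :
  L2_integrand T k -> wiener_integral mu k W ->
  {ae mu, forall w, W (tilt j b x w) = W w + x * drift j b k}.
Proof.
move=> kL2 [mW [s_ [wfs sk sW]]].
have mt := @measurable_tilt R T d j b x.
pose D w := W (tilt j b x w) - (W w + x * drift j b k).
have mWt : measurable_fun [set: C0 T d] (W \o tilt j b x) by exact: measurableT_comp.
have mD : measurable_fun [set: C0 T d] D.
  by apply: measurable_funB => //; exact: measurable_funD.
suff : (\int[mu]_w `|(D w)%:E| = 0)%E.
  have mDe : measurable_fun [set: C0 T d] (EFin \o D) by exact/measurable_EFinP.
  move=> /(ae_eq_integral_abs mu measurableT mDe).1; apply: filterS => w /(_ Logic.I) [] /eqP.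
  by rewrite subr_eq0 => /eqP.
apply/eqP; rewrite eq_le; apply/andP; split; last by apply: integral_ge0.
apply/lee_addgt0Pr => e e0; rewrite add0e.
(* The first three terms are the constants of the three errors: of [W] after the shift, of [W]
   before it, and of the drift. The last keeps [C] positive. *)
pose C := tilt_cst b x + tilt_cst b 0 + `|x| * ((1 + clock b) / 2) + 1.
have c1 := tilt_cst_ge0 b x; have c2 := tilt_cst_ge0 b 0.
have c3 : 0 <= `|x| * ((1 + clock b) / 2).
  by rewrite mulr_ge0// divr_ge0// addr_ge0// ltW.
have C_gt0 : 0 < C by rewrite /C; lra.
pose eta := e / C; have eta0 : 0 < eta by rewrite divr_gt0.
have [n [nk nW]] : exists n,
    (sqL2 leb `[0%R, T]%classic (fun u => simple_fun (s_ n) u - k u)%R <= (eta ^+ 2)%:E)%E /\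
    ('N[mu]_2%:E[EFin \o (simple_integral (s_ n) \- W)%R] <= eta%:E)%E.
  have := cvge0_near sk (exprn_gt0 2 eta0); have := cvge0_near sW eta0.
  move=> [n1 _ h1] [n2 _ h2]; exists (maxn n1 n2); split.
    by apply: h2; rewrite /= leq_maxr.
  by apply: h1; rewrite /= leq_maxl.
set S := simple_integral (s_ n); pose phi w := S w - W w.
have mphi : measurable_fun [set: C0 T d] phi.
  by apply: measurable_funB => //; exact: measurable_simple_integral.
have phi2 := integral_sqr_le_Lnorm nW.
have i1 := integral_tilt_le hmu T0 j b x mphi eta0 phi2.
have i2 := integral_abs_le hmu T0 j b mphi eta0 phi2.
have dk := drift_dist kL2 eta0 nk.
have mphit : measurable_fun [set: C0 T d] (fun w => `|phi (tilt j b x w)|%:E).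
  by apply/measurable_EFinP; apply: measurableT_comp => //; exact: (measurableT_comp mphi mt).
have mphia : measurable_fun [set: C0 T d] (fun w => `|phi w|%:E).
  by apply/measurable_EFinP; exact: measurableT_comp.
pose c := `|x| * `|drift j b (simple_fun (s_ n)) - drift j b k|.
have c0 : 0 <= c by rewrite mulr_ge0.
apply: (@le_trans _ _ (\int[mu]_w (`|phi (tilt j b x w)|%:E + (`|phi w|%:E + cst c%:E w)))%E).
  apply: ge0_le_integral => //.
  - by apply/measurable_EFinP; exact: measurableT_comp.
  - by apply: emeasurable_funD => //; exact: emeasurable_funD.
  - move=> w _; rewrite lee_fin /D /phi /S simple_integral_tilt// /c -normrM.
    set s1 := simple_integral _ _; set d1 := drift _ _ _; set d2 := drift _ _ _.
    (* As the defect of the simple integral vanishes, only the three approximation errors remain. *)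
    rewrite (_ : W _ - _ = - (s1 + x * d2 - W (tilt j b x w)) + ((s1 - W w) + x * (d2 - d1))); last by ring.
    apply: le_trans (ler_normD _ _) _; rewrite normrN lerD2l.
    exact: ler_normD.
have ic : (\int[mu]_w cst c%:E w = c%:E)%E.
  rewrite (@integral_cst _ _ _ mu)//.
  have h : (c%:E * mu setT = c%:E)%E by rewrite probability_setT mule1.
  exact: h.
rewrite ge0_integralD//; last 2 first.
- by move=> w _; rewrite -EFinD lee_fin addr_ge0.
- exact: emeasurable_funD.
rewrite ge0_integralD// ic.
apply: (@le_trans _ _ ((eta * tilt_cst b x)%:E + ((eta * tilt_cst b 0)%:E + (`|x| * (eta * ((1 + clock b) / 2)))%:E))%E).
  apply: leeD => //; apply: leeD => //.
  by rewrite lee_fin /c ler_wpM2l.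
rewrite -!EFinD lee_fin.
have -> : e = eta * C by rewrite /eta divfK// gt_eqF.
rewrite /C; nra.
Qed.

End wiener_shift.

(** * Difference quotients and the Malliavin derivative *)

Section smooth_along.
Context {R : realType} {T : R} {d : nat}.
Variable mu : probability (C0 T d) R.
Variables (j : 'I_d) (b : time T).
Local Notation leb := (@lebesgue_measure R).

(* [P w] and [K w] are versions of [F] and of its directional derivative [G]
   along the line [x |-> tilt j b x w]. *)
Definition smooth_along (F G : C0 T d -> R) : Prop :=
  exists (P K : C0 T d -> R -> R) (M : R),
  [/\ measurable_fun [set: C0 T d] F /\
      measurable_fun [set: C0 T d * R] (fun p : C0 T d * R => K p.1 p.2),
      forall w, P w 0 = F w /\ K w 0 = G w,
      forall x, {ae mu, forall w, F (tilt j b x w) = P w x /\ G (tilt j b x w) = K w x},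
      forall w x, is_derive (x : R^o) 1 (P w : R^o -> R^o) (K w x) &
      (forall w, continuous (K w)) /\ forall w x, `|K w x| <= M].

Lemma smooth_along0 : smooth_along (cst 0) (cst 0).
Proof.
exists (fun _ _ => 0), (fun _ _ => 0), 0; split => //.
- by move=> x; exact: aeW.
- by move=> w x; exact: is_derive_cst.
- by split => [w x|w x]; [exact: cst_continuous|rewrite normr0].
Qed.

Lemma smooth_along_lin (a : R) F1 G1 F2 G2 : smooth_along F1 G1 -> smooth_along F2 G2 ->
  smooth_along (fun w => F1 w + a * F2 w) (fun w => G1 w + a * G2 w).
Proof.
move=> [P1 [K1 [M1 [[mF1 mK1] PK1 ae1 d1 [c1 b1]]]]].
move=> [P2 [K2 [M2 [[mF2 mK2] PK2 ae2 d2 [c2 b2]]]]].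
exists (fun w x => P1 w x + a * P2 w x), (fun w x => K1 w x + a * K2 w x), (M1 + `|a| * M2).
split.
- split; first by apply: measurable_funD => //; exact: measurable_funM.
  by apply: measurable_funD => //; exact: measurable_funM.
- by move=> w; have [-> ->] := PK1 w; have [-> ->] := PK2 w.
- move=> x; apply: filterS2 (ae1 x) (ae2 x) => w [-> ->] [-> ->] //.
- move=> w x; have h1 := d1 w x; have h2 := d2 w x.
  exact: is_deriveD.
- split => [w x|w x].
    apply: cvgD; first exact: c1.
    by apply: cvgM; [exact: cvg_cst|exact: c2].
  apply: le_trans (ler_normD _ _) _; rewrite lerD// normrM.
  by rewrite ler_wpM2l.
Qed.

Lemma smooth_along_sum m (F G : 'I_m -> C0 T d -> R) :
  (forall i, smooth_along (F i) (G i)) ->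
  smooth_along (fun w => \sum_i F i w) (fun w => \sum_i G i w).
Proof.
move=> h.
suff : forall r : seq 'I_m,
    smooth_along (fun w => \sum_(i <- r) F i w) (fun w => \sum_(i <- r) G i w) by apply.
elim=> [|i r IH].
  under eq_fun do rewrite big_nil; under [X in smooth_along _ X]eq_fun do rewrite big_nil.
  exact: smooth_along0.
under eq_fun do rewrite big_cons addrC -[F _ _]mul1r.
under [X in smooth_along _ X]eq_fun do rewrite big_cons addrC -[G _ _]mul1r.
exact: smooth_along_lin IH (h i).
Qed.

Lemma smooth_along_measurable F G : smooth_along F G ->
  measurable_fun [set: C0 T d] F /\ measurable_fun [set: C0 T d] G.
Proof.
move=> [P [K [M [[mF mK] PK _ _ _]]]]; split => //.
rewrite (_ : G = (fun w => K w 0)); last by apply/funext => w; have [_ ->] := PK w.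
exact: (measurableT_comp mK (measurable_pair2 (0 : R))).
Qed.

Hypothesis T0 : 0 < T.
Hypothesis hmu : wiener_measure mu.
Hypothesis b0 : 0 < clock b.

(** The fundamental theorem of calculus along the line and Tonelli, for which [K] is jointly
    measurable. The null set where [K w r] differs from [G] at the shifted path may depend on [r];
    this is harmless once the integral over paths is the inner one. *)
Lemma smooth_along_quotient F G x (A : R) : 0 < x -> smooth_along F G ->
  (forall r, 0 <= r <= x -> (\int[mu]_w `|G (tilt j b r w)|%:E <= A%:E)%E) ->
  (\int[mu]_w `|F (tilt j b x w) - F w|%:E <= (x * A)%:E)%E.
Proof.
move=> x0 FG GA; have [mF mG] := smooth_along_measurable FG.
move: FG => [P [K [M [[_ mK] PK aeP dP [cK bK]]]]].
have mt r := @measurable_tilt R T d j b r.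
pose f (p : C0 T d * R) : \bar R := (`|K p.1 p.2| * \1_(`[0, x]) p.2)%:E.
have mf : measurable_fun [set: C0 T d * R] f.
  apply/measurable_EFinP; apply: measurable_funM; first exact: measurableT_comp.
  apply: (measurableT_comp (f := \1_(`[0, x]) : R -> R)); last exact: measurable_snd.
  by apply: measurable_indic; exact: measurable_itv.
have f0 p : (0 <= f p)%E by rewrite lee_fin mulr_ge0// indicE.
have fE w : (\int[leb]_r f (w, r) = \int[leb]_(r in `[0%R, x]) `|K w r|%:E)%E.
  rewrite [RHS]integral_mkcond; apply: eq_integral => r _.
  by rewrite /f /patch indicE/=; case: ifPn => _; rewrite ?mulr1 ?mulr0.
apply: (@le_trans _ _ (\int[mu]_w \int[leb]_r f (w, r))%E).
  apply: ae_ge0_le_integral => //.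
  - by apply/measurable_EFinP; apply: measurableT_comp => //; apply: measurable_funB => //; exact: measurableT_comp.
  - by move=> w _; apply: integral_ge0.
  - exact: (@measurable_fun_fubini_tonelli_F _ _ _ _ _ leb f mf f0).
  - apply: filterS (aeP x) => w [-> _] _; rewrite fE.
    have [<- _] := PK w.
    have -> : (`|P w x - P w 0|%:E = `|\int[leb]_(r in `[0%R, x]) (K w r)%:E|)%E.
      rewrite (@continuous_FTC2 _ (K w) (P w) 0 x)//.
      + exact: continuous_subspaceT.
      + split => [r _| |].
        * by have [] := dP w r.
        * apply: cvg_at_right_filter; apply: differentiable_continuous.
          by apply/derivable1_diffP; have [] := dP w 0.
        * apply: cvg_at_left_filter; apply: differentiable_continuous.
          by apply/derivable1_diffP; have [] := dP w x.
      + by move=> r _; rewrite derive1E; have [_] := dP w r.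
    apply: le_abse_integral => //; apply/measurable_EFinP.
    by apply: measurable_funTS; exact: continuous_measurable_fun.
rewrite fubini_tonelli//.
apply: (@le_trans _ _ (\int[leb]_r (A%:E * (\1_(`[0, x]) r)%:E))%E).
  apply: ge0_le_integral => //.
  - by move=> r _; exact: integral_ge0.
  - exact: (@measurable_fun_fubini_tonelli_G _ _ _ _ _ mu f mf f0).
  - by apply: measurable_funeM; apply/measurable_EFinP; apply: measurable_indic; exact: measurable_itv.
  - move=> r _; rewrite indicE mem_setE in_itv/=; rewrite /f/= indicE mem_setE in_itv/=.
    case: (boolP (_ && _)) => rx; last first.
      by rewrite mule0; under eq_integral do rewrite mulr0; rewrite integral0.
    rewrite mule1; apply: le_trans (GA r rx).
    rewrite le_eqVlt; apply/orP; left; apply/eqP.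
    apply: ge0_ae_eq_integral => //.
    + apply/measurable_EFinP; apply: measurable_funM => //.
      by apply: measurableT_comp => //; exact: (measurableT_comp mK (measurable_pair2 r)).
    + by apply/measurable_EFinP; apply: measurableT_comp => //; exact: measurableT_comp.
    + by apply: filterS (aeP r) => w [_ ->] _; rewrite mulr1.
rewrite integralZl//; last exact: integrable_indic_itv.
rewrite integral_indic// setIT.
have h : (A%:E * leb `[0%R, x]%classic <= (x * A)%:E)%E.
  by rewrite lebesgue_measure_itv/= lte_fin x0 sube0 -EFinM mulrC.
exact: h.
Qed.

Lemma smooth_along_quotient_cvg F G : smooth_along F G ->
  (\int[mu]_w `|m.+1%:R * (F (tilt j b m.+1%:R^-1 w) - F w) - G w|%:E)%E @[m --> \oo] --> 0%E.
Proof.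
move=> FG; have [mF mG] := smooth_along_measurable FG.
move: FG => [P [K [M [[_ mK] PK aeP dP [cK bK]]]]].
pose h m w := m.+1%:R * (F (tilt j b m.+1%:R^-1 w) - F w) - G w.
have mh m : measurable_fun [set: C0 T d] (h m).
  apply: measurable_funB => //; apply: measurable_funM => //; apply: measurable_funB => //.
  by apply: measurableT_comp => //; exact: measurable_tilt.
(* Only the countably many shifts [1 / (m + 1)] occur, so one null set of paths serves them all. *)
have ae : {ae mu, forall w, forall m, F (tilt j b m.+1%:R^-1 w) = P w m.+1%:R^-1}.
  by apply/ae_foralln => m; apply: filterS (aeP m.+1%:R^-1) => w [].
have mvt w m : exists2 z, 0 < z < m.+1%:R^-1 &
    m.+1%:R * (P w m.+1%:R^-1 - F w) = K w z.
  have m0 : 0 < (m.+1%:R^-1 : R) by rewrite invr_gt0.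
  have [|z] := @MVT R (P w) (K w) 0 m.+1%:R^-1 m0 (fun z _ => dP w z).
    by apply: derivable_within_continuous => z _; have [] := dP w z.
  rewrite in_itv/= subr0 => zm; have [-> _] := PK w => ->.
  by exists z => //; rewrite mulrC mulfVK.
have [] := @dominated_convergence _ _ _ mu setT measurableT (fun m => EFin \o h m) (cst 0%E) (cst (2 * M)%:E).
- by move=> m; exact/measurable_EFinP.
- exact: measurable_cst.
- apply: filterS ae => w hw _; apply: cvg_EFin; first exact: nearW.
  apply/cvgrPdist_lt => e e0.
  have /cvgrPdist_lt /(_ e e0) /nbhs_ballP[rho /= rho0 hrho] := cK w 0.
  have inv0 : (fun m : nat => m.+1%:R^-1 : R) @ \oo --> 0 by exact: cvg_harmonic.
  have /cvgrPdist_lt /(_ rho rho0) := inv0; apply: filterS => m.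
  rewrite sub0r normrN gtr0_norm ?invr_gt0// => mrho.
  have [z /andP[z0 zm] hz] := mvt w m.
  rewrite sub0r normrN /h hw hz; have [_ <-] := PK w; rewrite distrC; apply: hrho.
  by rewrite -ball_normE/= sub0r normrN gtr0_norm//; exact: lt_trans mrho.
- by apply: finite_measure_integrable_cst.
- apply: filterS ae => w hw m _ /=; rewrite lee_fin /h hw.
  have [z _ ->] := mvt w m; apply: le_trans (ler_normB _ _) _.
  by rewrite mulr_natl mulr2n lerD//; have [_ <-] := PK w.
move=> _ + _; apply: cvg_trans; apply: near_eq_cvg; apply: nearW => m.
by apply: eq_integral => w _; rewrite /cst sube0.
Qed.

End smooth_along.

Section elementary_smooth.
Context {R : realType} {T : R} {d : nat}.
Variable mu : probability (C0 T d) R.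
Hypothesis hmu : wiener_measure mu.
Hypothesis T0 : 0 < T.
Variables (j : 'I_d) (b : time T).
Hypothesis b0 : 0 < clock b.
Local Notation leb := (@lebesgue_measure R).

(** Along the shift the Wiener integral is the affine function [W w + x * c], up to a null set, so
    the versions are explicit and the rest is the chain rule. *)
Lemma elementary_smooth F Y : elementary mu F Y ->
  smooth_along mu j b F (fun w => (\int[leb]_(t in `]0%R, clock b]) Y (w, t) 0 j)%R).
Proof.
move=> [g [k [W [[dg cg [M gM]] kL2 hW -> ->]]]].
have [mW _] := hW; set c := drift j b k.
have YE w : (\int[leb]_(t in `]0%R, clock b]) (g^`()%classic (W w) *: k t) 0 j)%R = g^`()%classic (W w) * c.
  transitivity (\int[leb]_(t in `]0%R, clock b]) (g^`()%classic (W w) * k t 0 j))%R.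
    by apply: eq_Rintegral => t _; rewrite mxE.
  by rewrite RintegralZl//; exact: (integrable_L2_coord j b0 kL2).
have cg' : continuous g.
  by move=> x; apply: differentiable_continuous; apply/derivable1_diffP; exact: dg.
exists (fun w x => g (W w + x * c)), (fun w x => g^`()%classic (W w + x * c) * c), (M * `|c|).
have dline w x : is_derive (x : R^o) 1 ((fun x : R => W w + x * c) : R^o -> R^o) c.
  have h1 := is_deriveM (@is_derive_id R R^o x 1) (@is_derive_cst R R^o R^o c x 1).
  have h2 := is_deriveD (@is_derive_cst R R^o R^o (W w) x 1) h1.
  apply: is_derive_eq h2 _.
  by rewrite scaler0 !add0r; exact: mulr1.
split.
- split.
    by apply: measurableT_comp => //; exact: continuous_measurable_fun.
  apply: measurable_funM => //.
  apply: measurableT_comp; first exact: continuous_measurable_fun.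
  apply: measurable_funD; first exact: (measurableT_comp mW measurable_fst).
  by apply: measurable_funM => //; exact: measurable_snd.
- by move=> w; rewrite mul0r addr0 YE.
- move=> x; apply: filterS (wiener_integral_shift hmu T0 j b0 x kL2 hW) => w /= Ww.
  by rewrite YE Ww.
- move=> w x.
  have h1 : is_derive (W w + x * c : R^o) 1 (g : R^o -> R^o) (g^`()%classic (W w + x * c)).
    by rewrite derive1E; apply: derivableP; exact: dg.
  exact: (@is_derive1_comp R g (fun x0 => W w + x0 * c) x _ _ h1 (dline w x)).
- split=> [w x|w x].
    apply: cvgM; last exact: cvg_cst.
    apply: (cvg_comp (fun x => W w + x * c) g^`()%classic); last exact: cg.
    apply: cvgD; first exact: cvg_cst.
    by apply: cvgM; [exact: cvg_id|exact: cvg_cst].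
  by rewrite normrM ler_wpM2r//; have [] := gM (W w + x * c).
Qed.

End elementary_smooth.

(** * Tonelli on the product of paths and times *)

Section product_strip.
Context {R : realType} dX (X : measurableType dX) (m : probability X R) (A : set R).
Hypothesis mA : measurable A.
Local Notation leb := (@lebesgue_measure R).
Local Notation D := ([set: X] `*` A).

Lemma measurable_strip : measurable D.
Proof. exact: measurableX. Qed.

Lemma strip_patch (u : X * R -> \bar R) w t : (u \_ D) (w, t) = ((fun t => u (w, t)) \_ A) t.
Proof.
by rewrite /patch; congr (if _ then _ else _); apply/idP/idP; rewrite !inE => //= -[].
Qed.

Lemma tonelli_strip (u : X * R -> \bar R) : measurable_fun D u -> (forall p, 0 <= u p)%E ->
  measurable_fun [set: X] (fun w => \int[leb]_(t in A) u (w, t))%E /\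
  (\int[m \x leb]_(p in D) u p = \int[m]_w \int[leb]_(t in A) u (w, t))%E.
Proof.
move=> mu u0.
have mv : measurable_fun [set: X * R] (u \_ D).
  by apply/(measurable_restrictT _ _).1 => //; exact: measurable_strip.
have v0 p : (0 <= (u \_ D) p)%E by rewrite /patch; case: ifP.
have E w : (\int[leb]_(t in A) u (w, t) = \int[leb]_t (u \_ D) (w, t))%E.
  by rewrite integral_mkcond; apply: eq_integral => t _; rewrite strip_patch.
split.
  under eq_fun do rewrite E.
  exact: (@measurable_fun_fubini_tonelli_F _ _ _ _ _ leb (u \_ D) mv v0).
rewrite integral_mkcond fubini_tonelli1//.
by apply: eq_integral => w _; rewrite E.
Qed.

Lemma measurable_strip_integral (u : X * R -> R) : measurable_fun D u ->
  measurable_fun [set: X] (fun w => \int[leb]_(t in A) (u (w, t))%:E)%E.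
Proof.
move=> mu; have mE : measurable_fun D (EFin \o u) by exact/measurable_EFinP.
rewrite (_ : (fun w => _) = (fun w => \int[leb]_(t in A) ((EFin \o u)^\+ (w, t)) -
    \int[leb]_(t in A) ((EFin \o u)^\- (w, t)))%E); last first.
  apply/funext => w; rewrite [LHS]integralE; congr (_ - _)%E; apply: eq_integral => t _.
    by rewrite !funeposE.
  by rewrite !funenegE.
apply: emeasurable_funB.
- have [h _] := tonelli_strip (measurable_funepos mE) (fun p => funepos_ge0 _ p); exact: h.
- have [h _] := tonelli_strip (measurable_funeneg mE) (fun p => funeneg_ge0 _ p); exact: h.
Qed.

End product_strip.

Section malliavin_quotient.
Context {R : realType} {T : R} {d : nat}.
Variable mu : probability (C0 T d) R.
Hypothesis hmu : wiener_measure mu.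
Hypothesis T0 : 0 < T.
Variables (j : 'I_d) (b : time T).
Hypothesis b0 : 0 < clock b.
Local Notation leb := (@lebesgue_measure R).
Local Notation I := (`]0%R, clock b]%classic).
Local Notation D0 := ([set: C0 T d] `*` `[0%R, T]%classic).
Local Notation D := ([set: C0 T d] `*` I).

Definition gradient_mean (Y : C0 T d * R -> 'rV[R]_d) (w : C0 T d) : R :=
  (\int[leb]_(t in I) Y (w, t) 0 j)%R.

Let D_subset : D `<=` D0.
Proof. by move=> [w t] [_ /= tI]; split => //; exact: (I_subset tI). Qed.

Let mI : measurable (I : set R). Proof. exact: measurable_itv. Qed.

Let mD : measurable D. Proof. exact: measurable_strip. Qed.

Let mD0 : measurable D0. Proof. by apply: measurable_strip; exact: measurable_itv. Qed.

Lemma Rintegral_sum (J : Type) (r : seq J) (h : J -> R -> R) :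
  (forall i, leb.-integrable I (EFin \o h i)) ->
  (\int[leb]_(t in I) (\sum_(i <- r) h i t) = \sum_(i <- r) \int[leb]_(t in I) h i t)%R.
Proof.
move=> ih; elim: r => [|i r IH].
  rewrite big_nil; under eq_Rintegral do rewrite big_nil.
  by rewrite /Rintegral integral0.
rewrite big_cons -IH -RintegralD//.
  by apply: eq_Rintegral => t _; rewrite big_cons.
rewrite (_ : _ \o _ = (fun t => \sum_(i <- r) (EFin \o h i) t)%E).
  by apply: integrable_sum => // k _; exact: ih.
by apply/funext => t /=; rewrite sumEFin.
Qed.

Lemma elementary_strip F Y : elementary mu F Y -> vmeasurable D0 Y /\
  forall w, leb.-integrable I (fun t => (Y (w, t) 0 j)%:E).
Proof.
move=> [g [k [W [[dg cg _] kL2 [mW _] _ ->]]]]; split.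
  move=> l; rewrite (_ : (fun x => _) = (fun p : C0 T d * R => g^`()%classic (W p.1) * k p.2 0 l)).
    apply: measurable_funM.
      apply: measurable_funTS; apply: measurableT_comp; first exact: continuous_measurable_fun.
      exact: (measurableT_comp mW measurable_fst).
    have [mk _] := kL2.
    apply: (@measurable_comp _ _ _ _ _ _ `[0%R, T]%classic (fun t => k t 0 l)) => //.
    - by move=> _ [[w t] [_ tT] <-].
    - exact: (measurable_funTS measurable_snd).
  by apply/funext => p; rewrite mxE.
move=> w; rewrite (_ : (fun t => _) = (fun t => (g^`()%classic (W w))%:E * (k t 0 j)%:E)%E).
  by apply: integrableZl => //; exact: (integrable_L2_coord j b0 kL2).
by apply/funext => t; rewrite mxE EFinM.
Qed.

Lemma elementary_span_strip F Y : elementary_span mu F Y ->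
  [/\ vmeasurable D0 Y, forall w, leb.-integrable I (fun t => (Y (w, t) 0 j)%:E) &
    smooth_along mu j b F (gradient_mean Y)].
Proof.
move=> [n [F_ [Y_ [FY -> ->]]]].
have h i := elementary_strip (FY i).
split.
- move=> l; rewrite (_ : (fun x => _) = (fun p => \sum_i Y_ i p 0 l)).
    by apply: measurable_sum => i; have [+ _] := h i; apply.
  by apply/funext => p; rewrite summxE.
- move=> w; rewrite (_ : (fun t => _) = (fun t => \sum_i (Y_ i (w, t) 0 j)%:E)%E).
    by apply: integrable_sum => // i _; have [_] := h i.
  by apply/funext => t; rewrite summxE -sumEFin.
- rewrite (_ : gradient_mean _ = (fun w => \sum_i gradient_mean (Y_ i) w)).
    by apply: smooth_along_sum => i; exact: (elementary_smooth hmu T0 j b0 (FY i)).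
  apply/funext => w; rewrite /gradient_mean -(@Rintegral_sum _ _ (fun i t => Y_ i (w, t) 0 j)); last first.
    by move=> i; have [_] := h i; apply.
  by apply: eq_Rintegral => t _; rewrite summxE.
Qed.

(** The constant of [ge0_integral_mul_le] with [A = b exp b], which bounds the integral of the
    squared density over paths and times in []0, b]] for shifts [r] in [[0, 1]]. *)
Let kappa : R := (1 + clock b * expR (clock b)) / 2.

Lemma strip_tilt_le (u : C0 T d * R -> 'rV[R]_d) (eta r : R) :
  vmeasurable D0 u -> 0 < eta -> 0 <= r <= 1 ->
  (sqL2 (mu \x leb) D0 u <= (eta ^+ 2)%:E)%E ->
  (\int[mu]_w ((\int[leb]_(t in I) `|u (w, t) 0 j|%:E) * (tilt_density j b r w)%:E) <= (eta * kappa)%:E)%E.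
Proof.
move=> mu_ eta0 /andP[r0 r1] u2.
have md := @measurable_tilt_density R T d j b r.
have mu1 : measurable_fun D (fun p => u p 0 j).
  by apply: measurable_funS (mu_ j) => //; exact: D_subset.
have mdD : measurable_fun D (fun p : C0 T d * R => tilt_density j b r p.1).
  by apply: measurable_funTS; exact: (measurableT_comp md measurable_fst).
have m1 : measurable_fun D (fun p => `|u p 0 j * tilt_density j b r p.1|%:E).
  by apply/measurable_EFinP; apply: measurableT_comp => //; exact: measurable_funM.
have [_ E1] := tonelli_strip mu mI m1 (fun p => normr_ge0 _).
have m2 : measurable_fun D (fun p : C0 T d * R => (tilt_density j b r p.1 ^+ 2)%:E).
  by apply/measurable_EFinP; exact: measurable_funX.
have [_ E2] := tonelli_strip mu mI m2 (fun p => sqr_ge0 _).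
have sections w : measurable_fun I (fun t => u (w, t) 0 j).
  apply: (@measurable_comp _ _ _ _ _ _ D (fun p => u p 0 j)) => //.
  + by move=> _ [t tI <-].
  + by apply: measurable_funTS; exact: measurable_pair1.
apply: (@le_trans _ _ (\int[mu \x leb]_(p in D) `|u p 0 j * tilt_density j b r p.1|%:E)%E).
  rewrite E1 le_eqVlt; apply/orP; left; apply/eqP; apply: eq_integral => w _.
  rewrite -ge0_integralZr//.
  - by apply: eq_integral => t _; rewrite -EFinM normrM [in RHS](ger0_norm (tilt_density_ge0 _ _ _ _)).
  - by apply/measurable_EFinP; apply: (@measurable_comp _ _ _ _ _ _ setT) => //; exact: sections.
  - by rewrite lee_fin tilt_density_ge0.
have /= h := @ge0_integral_mul_le _ _ R (mu \x leb)%E D (fun p => u p 0 j) (fun p => tilt_density j b r p.1) eta (clock b * expR (clock b)) mD mu1 mdD eta0.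
apply: h.
  apply: le_trans u2; apply: coord_sqL2_le => //; exact: D_subset.
rewrite E2; apply: (@le_trans _ _ (\int[mu]_w ((clock b)%:E * (tilt_density j b r w ^+ 2)%:E))%E).
  rewrite le_eqVlt; apply/orP; left; apply/eqP; apply: eq_integral => w _.
  transitivity (\int[leb]_(t in I) cst ((tilt_density j b r w ^+ 2)%:E) t)%E => //.
  rewrite (@integral_cst _ _ _ leb)// muleC; congr (_ * _)%E; exact: (leb_I b0).
rewrite ge0_integralZl//.
- rewrite (integral_tilt_density_sqr hmu T0) -EFinM lee_fin ler_pM2l// ler_expR.
  by rewrite ler_piMl ?clock_ge0// exprn_ile1.
- by apply/measurable_EFinP; exact: measurable_funX.
- by move=> w _; rewrite lee_fin sqr_ge0.
- by rewrite lee_fin ltW.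
Qed.

End malliavin_quotient.

Section quotient_limit.
Context {R : realType} {T : R} {d : nat}.
Variable mu : probability (C0 T d) R.
Hypothesis hmu : wiener_measure mu.
Hypothesis T0 : 0 < T.
Variables (j : 'I_d) (b : time T).
Hypothesis b0 : 0 < clock b.
Local Notation leb := (@lebesgue_measure R).
Local Notation I := (`]0%R, clock b]%classic).
Local Notation D0 := ([set: C0 T d] `*` `[0%R, T]%classic).
Local Notation D := ([set: C0 T d] `*` I).
Local Notation kappa := ((1 + clock b * expR (clock b)) / 2).
Implicit Types (F : C0 T d -> R) (Y u : C0 T d * R -> 'rV[R]_d).

Let mI : measurable (I : set R). Proof. exact: measurable_itv. Qed.

Lemma malliavin_approx F Y eta : malliavin_derivative mu F Y -> 0 < eta ->
  exists F' Y', [/\ elementary_span mu F' Y',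
    (\int[mu]_w ((F' w - F w) ^+ 2)%:E <= (eta ^+ 2)%:E)%E &
    (sqL2 (mu \x leb)%E D0 (fun p => Y' p - Y p)%R <= (eta ^+ 2)%:E)%E].
Proof.
move=> [_ _ [F_ [Y_ [FY F_cvg Y_cvg]]]] eta0.
have e2 : 0 < eta ^+ 2 by rewrite exprn_gt0.
have [n _ h] := cvge0_near F_cvg eta0; have [m _ k] := cvge0_near Y_cvg e2.
exists (F_ (maxn n m)), (Y_ (maxn n m)); split => //.
  by apply: integral_sqr_le_Lnorm; apply: h => /=; exact: leq_maxl.
by apply: k => /=; exact: leq_maxr.
Qed.

Lemma measurable_section u w : vmeasurable D0 u -> measurable_fun I (fun t => u (w, t) 0 j).
Proof.
move=> mu_; have mD : measurable D by exact: measurable_strip.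
have mD0 : measurable D0 by apply: measurable_strip; exact: measurable_itv.
apply: (@measurable_comp _ _ _ _ _ _ D (fun p => u p 0 j)) => //.
- by move=> _ [t tI <-].
- apply: measurable_funS (mu_ j) => // -[v t] [_ /= tI]; split => //; exact: (I_subset tI).
- by apply: measurable_funTS; exact: measurable_pair1.
Qed.

Lemma measurable_strip_norm u : vmeasurable D0 u ->
  measurable_fun [set: C0 T d] (fun w => \int[leb]_(t in I) `|u (w, t) 0 j|%:E)%E.
Proof.
move=> mu_; have mD : measurable D by exact: measurable_strip.
have mD0 : measurable D0 by apply: measurable_strip; exact: measurable_itv.
have m1 : measurable_fun D (fun p => `|u p 0 j|%:E).
  apply/measurable_EFinP; apply: measurableT_comp => //.
  apply: measurable_funS (mu_ j) => // -[v t] [_ /= tI]; split => //; exact: (I_subset tI).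
by have [] := tonelli_strip mu mI m1 (fun p => normr_ge0 _).
Qed.

Lemma measurable_gradient_mean u : vmeasurable D0 u ->
  measurable_fun [set: C0 T d] (gradient_mean j b u).
Proof.
move=> mu_; have mD : measurable D by exact: measurable_strip.
have mD0 : measurable D0 by apply: measurable_strip; exact: measurable_itv.
apply: measurableT_comp => //.
apply: (measurable_strip_integral mu mI (u := fun p => u p 0 j)).
apply: measurable_funS (mu_ j) => // -[v t] [_ /= tI]; split => //; exact: (I_subset tI).
Qed.

Lemma strip_le u eta : vmeasurable D0 u -> 0 < eta ->
  (sqL2 (mu \x leb)%E D0 u <= (eta ^+ 2)%:E)%E ->
  (\int[mu]_w \int[leb]_(t in I) `|u (w, t) 0 j|%:E <= (eta * kappa)%:E)%E.
Proof.
move=> mu_ eta0 u2; have r01 : 0 <= (0 : R) <= 1 by rewrite lexx ler01.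
apply: le_trans (strip_tilt_le hmu T0 j b0 mu_ eta0 r01 u2).
rewrite le_eqVlt; apply/orP; left; apply/eqP; apply: eq_integral => w _.
by rewrite /tilt_density mul0r expr0n/= mul0r mul0r subrr expR0 mule1.
Qed.

(** The closure only says that [Y] is close to elementary derivatives. Those have integrable
    sections, and the difference with one of them at distance at most 1 has integrable sections
    almost surely by Tonelli. *)
Lemma malliavin_section_integrable F Y : malliavin_derivative mu F Y ->
  {ae mu, forall w, leb.-integrable I (fun t => (Y (w, t) 0 j)%:E)}.
Proof.
move=> FY; have [_ mY _] := FY.
have [F' [Y' [FY' _ Y1]]] := malliavin_approx FY ltr01.
have [mY' iY' _] := elementary_span_strip hmu T0 j b0 FY'.
have mdY : vmeasurable D0 (fun p => Y' p - Y p) by exact: vmeasurableB.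
have h : mu.-integrable setT (fun w => \int[leb]_(t in I) `|(Y' (w, t) - Y (w, t)) 0 j|%:E)%E.
  apply/integrableP; split; first exact: measurable_strip_norm mdY.
  apply: (@le_lt_trans _ _ ((1 * kappa)%:E)); last by rewrite ltry.
  apply: le_trans (strip_le mdY ltr01 Y1).
  rewrite le_eqVlt; apply/orP; left; apply/eqP; apply: eq_integral => w _.
  by rewrite gee0_abs//; apply: integral_ge0.
apply: filterS (integrable_ae measurableT h) => w /(_ Logic.I) wfin.
have i1 : leb.-integrable I (fun t => ((Y' (w, t) - Y (w, t)) 0 j)%:E).
  apply/integrableP; split.
    by apply/measurable_EFinP; exact: measurable_section mdY.
  by move: wfin; rewrite ge0_fin_numE//; apply: integral_ge0.
rewrite (_ : (fun t => _) = (fun t => (Y' (w, t) 0 j)%:E - ((Y' (w, t) - Y (w, t)) 0 j)%:E)%E).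
  by apply: integrableB.
by apply/funext => t; rewrite !mxE -EFinB opprB addrC subrK.
Qed.

Lemma gradient_mean_dist (u v : C0 T d * R -> 'rV[R]_d) w :
  leb.-integrable I (fun t => (u (w, t) 0 j)%:E) -> leb.-integrable I (fun t => (v (w, t) 0 j)%:E) ->
  (`|gradient_mean j b u w - gradient_mean j b v w|%:E <=
   \int[leb]_(t in I) `|(u (w, t) - v (w, t))%R 0 j|%:E)%E.
Proof.
move=> iu iv; rewrite /gradient_mean -RintegralB//.
have iB : leb.-integrable I (fun t => (u (w, t) 0 j - v (w, t) 0 j)%:E).
  by rewrite (_ : (fun t => _) = (fun t => (u (w, t) 0 j)%:E - (v (w, t) 0 j)%:E)%E)//; exact: integrableB.
rewrite /Rintegral -abse_EFin fineK; last exact: integrable_fin_num.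
apply: le_trans (le_abse_integral _ _ _) _ => //; first by have /integrableP[] := iB.
rewrite le_eqVlt; apply/orP; left; apply/eqP; apply: eq_integral => t _.
by rewrite !mxE.
Qed.

End quotient_limit.

Section quotient_cvg.
Context {R : realType} {T : R} {d : nat}.
Variable mu : probability (C0 T d) R.
Hypothesis hmu : wiener_measure mu.
Hypothesis T0 : 0 < T.
Variables (j : 'I_d) (b : time T).
Hypothesis b0 : 0 < clock b.
Local Notation leb := (@lebesgue_measure R).
Local Notation I := (`]0%R, clock b]%classic).
Local Notation D0 := ([set: C0 T d] `*` `[0%R, T]%classic).
Local Notation kappa := ((1 + clock b * expR (clock b)) / 2).
Local Notation quotient F m w :=
  (m.+1%:R * (F (tilt j b m.+1%:R^-1 w) - F w)).

Lemma measurable_section_norm (u : C0 T d * R -> 'rV[R]_d) w : vmeasurable D0 u ->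
  measurable_fun I (fun t => `|u (w, t) 0 j|%:E).
Proof.
move=> mu_; apply/measurable_EFinP; apply: (@measurable_comp _ _ _ _ _ _ setT) => //.
exact: measurable_section.
Qed.

Lemma gradient_mean_tilt_le (F : C0 T d -> R) (Y : C0 T d * R -> 'rV[R]_d) F1 Y1 F2 Y2 (eta r : R) :
  malliavin_derivative mu F Y -> 0 < eta -> 0 <= r <= 1 ->
  elementary_span mu F1 Y1 -> elementary_span mu F2 Y2 ->
  (sqL2 (mu \x leb)%E D0 (fun p => Y1 p - Y p)%R <= (eta ^+ 2)%:E)%E ->
  (sqL2 (mu \x leb)%E D0 (fun p => Y2 p - Y p)%R <= (eta ^+ 2)%:E)%E ->
  (\int[mu]_w `|(gradient_mean j b Y2 (tilt j b r w) - gradient_mean j b Y1 (tilt j b r w))%R|%:E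
     <= (2 * eta * kappa)%:E)%E.
Proof.
move=> [_ mY _] eta0 r01 FY1 FY2 h1 h2.
have [mY1 iY1 _] := elementary_span_strip hmu T0 j b0 FY1.
have [mY2 iY2 _] := elementary_span_strip hmu T0 j b0 FY2.
have mB1 := vmeasurableB mY1 mY; have mB2 := vmeasurableB mY2 mY.
have mG1 := measurable_gradient_mean mu j b mY1; have mG2 := measurable_gradient_mean mu j b mY2.
pose N (u : C0 T d * R -> 'rV[R]_d) (w : C0 T d) := (\int[leb]_(t in I) `|u (w, t) 0 j|%:E)%E.
have N0 u w : (0 <= N u w)%E by apply: integral_ge0.
have mN1 : measurable_fun setT (N (fun p => Y1 p - Y p)) := measurable_strip_norm mu j b mB1.
have mN2 : measurable_fun setT (N (fun p => Y2 p - Y p)) := measurable_strip_norm mu j b mB2.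
have mZ : measurable_fun [set: C0 T d] (fun w => (tilt_density j b r w)%:E).
  by apply/measurable_EFinP; exact: measurable_tilt_density.
have Z0 w : (0 <= (tilt_density j b r w)%:E)%E by rewrite lee_fin tilt_density_ge0.
have mabs : measurable_fun [set: C0 T d] (fun w => `|gradient_mean j b Y2 w - gradient_mean j b Y1 w|%:E).
  by apply/measurable_EFinP; apply: measurableT_comp => //; exact: measurable_funB.
rewrite (ge0_integral_tilt hmu T0 j b r (phi := fun w => `|gradient_mean j b Y2 w - gradient_mean j b Y1 w|%:E)) //.
apply: (@le_trans _ _ (\int[mu]_w (N (fun p => Y2 p - Y p)%R w * (tilt_density j b r w)%:E +
    N (fun p => Y1 p - Y p)%R w * (tilt_density j b r w)%:E))%E); last first.
  rewrite ge0_integralD//; last 4 first.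
  - by move=> w _; exact: mule_ge0.
  - exact: emeasurable_funM.
  - by move=> w _; exact: mule_ge0.
  - exact: emeasurable_funM.
  rewrite -mulrA mulr_natl mulr2n EFinD; apply: leeD.
  - exact: (strip_tilt_le hmu T0 j b0 mB2 eta0 r01 h2).
  - exact: (strip_tilt_le hmu T0 j b0 mB1 eta0 r01 h1).
apply: ge0_le_integral => //.
- by move=> w _; rewrite mule_ge0// lee_fin.
- exact: emeasurable_funM.
- by apply: emeasurable_funD; exact: emeasurable_funM.
move=> w _; rewrite -ge0_muleDl//; apply: lee_wpmul2r => //.
(* The comparison with [Y] is made under the integral of absolute values, which makes sense for
   every [w]; integrability of [Y (w, .)] is only an almost sure property. *)
apply: le_trans (gradient_mean_dist (iY2 w) (iY1 w)) _.
rewrite -ge0_integralD//; last 2 first.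
- exact: (@measurable_section_norm _ w mB2).
- exact: (@measurable_section_norm _ w mB1).
apply: ge0_le_integral => //.
- exact: (@measurable_section_norm _ w (vmeasurableB mY2 mY1)).
- apply: emeasurable_funD.
  + exact: (@measurable_section_norm _ w mB2).
  + exact: (@measurable_section_norm _ w mB1).
move=> t _; rewrite -EFinD lee_fin !mxE.
rewrite (_ : Y2 _ _ _ - Y1 _ _ _ = (Y2 (w, t) 0 j - Y (w, t) 0 j) - (Y1 (w, t) 0 j - Y (w, t) 0 j)); last by ring.
exact: ler_normB.
Qed.

(* [F] is approximated by [F1] independently of [m], and by [F2] within
   [eta / (m + 1)], which offsets the factor [m + 1] of the quotient. The
   difference [F2 - F1] is smooth along shifts, so the mean value theorem bounds
   its quotient by the gradients, which are both [eta]-close to [Y]. *)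
Lemma quotient_le (F : C0 T d -> R) (Y : C0 T d * R -> 'rV[R]_d) (eta : R) :
  malliavin_derivative mu F Y -> 0 < eta ->
  \forall m \near \oo, (\int[mu]_w `|quotient F m w - gradient_mean j b Y w|%:E <=
    (eta * (2 * tilt_cst b 1 + 3 * kappa + 1))%:E)%E.
Proof.
move=> FY eta0; have [mF mY _] := FY.
have [F1 [Y1 [FY1 _ h1]]] := malliavin_approx FY eta0.
have [mY1 iY1 s1] := elementary_span_strip hmu T0 j b0 FY1.
have [mF1 _] := smooth_along_measurable s1.
have mG := measurable_gradient_mean mu j b mY; have mG1 := measurable_gradient_mean mu j b mY1.
apply: filterS (cvge0_near (smooth_along_quotient_cvg s1) eta0) => m hm.
pose x : R := m.+1%:R^-1.
have x0 : 0 < x by rewrite invr_gt0.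
have x1 : x <= 1 by rewrite invf_le1// ler1n.
have mx : m.+1%:R * x = 1 by rewrite mulfV.
have mxe c : m.+1%:R * (eta * x * c) = eta * c.
  by rewrite -[eta * x * c]mulrA mulrCA [_ * (x * c)]mulrA mx mul1r.
have ex0 : 0 < eta * x by rewrite mulr_gt0.
have [F2 [Y2 [FY2 k2 h2]]] := malliavin_approx FY ex0.
have [mY2 iY2 s2] := elementary_span_strip hmu T0 j b0 FY2.
have [mF2 _] := smooth_along_measurable s2.
have exe : eta * x <= eta by rewrite ler_piMr// ltW.
have {}h2 : (sqL2 (mu \x leb)%E D0 (fun p => Y2 p - Y p)%R <= (eta ^+ 2)%:E)%E.
  by apply: le_trans h2 _; rewrite lee_fin lerXn2r ?nnegrE// ltW.
have mt := @measurable_tilt R T d j b x.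
have mB : measurable_fun [set: C0 T d] (fun w => F2 w - F w) by exact: measurable_funB.
have mBt : measurable_fun [set: C0 T d] (fun w => F2 (tilt j b x w) - F (tilt j b x w)).
  by exact: (measurableT_comp mB mt).
(* [A] and [B] measure the replacement of [F] by [F2] after and before the shift, [C] is the
   quotient of [F2 - F1], [E] the error of the quotient of [F1], and [G] that of its gradient. Their
   bounds add up to the constant of the statement. *)
pose A w := m.+1%:R * `|F2 (tilt j b x w) - F (tilt j b x w)|.
pose B w := m.+1%:R * `|F2 w - F w|.
pose C w := m.+1%:R * `|(F2 (tilt j b x w) + -1 * F1 (tilt j b x w)) - (F2 w + -1 * F1 w)|.
pose E w := `|m.+1%:R * (F1 (tilt j b x w) - F1 w) - gradient_mean j b Y1 w|.
pose G w := `|gradient_mean j b Y1 w - gradient_mean j b Y w|.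
have mnorm (u : C0 T d -> R) : measurable_fun setT u -> measurable_fun setT (fun w => `|u w|).
  by move=> ?; exact: measurableT_comp.
have mA : measurable_fun [set: C0 T d] A.
  by apply: measurable_funM => //; exact: mnorm mBt.
have mB' : measurable_fun [set: C0 T d] B.
  by apply: measurable_funM => //; exact: mnorm mB.
have s21 := smooth_along_lin (-1) s2 s1.
have [m21 _] := smooth_along_measurable s21.
have mC : measurable_fun [set: C0 T d] C.
  apply: measurable_funM => //; apply: mnorm; apply: measurable_funB => //.
  exact: (measurableT_comp m21 mt).
have mE : measurable_fun [set: C0 T d] E.
  apply: mnorm; apply: measurable_funB => //; apply: measurable_funM => //.
  by apply: measurable_funB => //; exact: (measurableT_comp mF1 mt).
have mG' : measurable_fun [set: C0 T d] G by apply: mnorm; exact: measurable_funB.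
have iA : (\int[mu]_w (A w)%:E <= (eta * tilt_cst b 1)%:E)%E.
  under eq_integral do rewrite EFinM.
  rewrite ge0_integralZl//; last by apply/measurable_EFinP; exact: mnorm mBt.
  apply: (@le_trans _ _ (m.+1%:R%:E * (eta * x * tilt_cst b x)%:E)%E).
    by apply: lee_wpmul2l; [rewrite lee_fin|exact: (integral_tilt_le hmu T0 j b x mB ex0 k2)].
  rewrite -EFinM lee_fin mxe ler_pM2l//; apply: tilt_cst_mono; last first.
    by rewrite ltW.
have iB : (\int[mu]_w (B w)%:E <= (eta * tilt_cst b 1)%:E)%E.
  under eq_integral do rewrite EFinM.
  rewrite ge0_integralZl//; last by apply/measurable_EFinP; exact: mnorm mB.
  apply: (@le_trans _ _ (m.+1%:R%:E * (eta * x * tilt_cst b 0)%:E)%E).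
    by apply: lee_wpmul2l; [rewrite lee_fin|exact: (integral_abs_le hmu T0 j b mB ex0 k2)].
  rewrite -EFinM lee_fin mxe ler_pM2l//; apply: tilt_cst_mono.
  by rewrite lexx ler01.
have iC : (\int[mu]_w (C w)%:E <= (2 * eta * kappa)%:E)%E.
  under eq_integral do rewrite EFinM.
  rewrite ge0_integralZl//; last first.
    apply/measurable_EFinP; apply: mnorm; apply: measurable_funB => //.
    exact: (measurableT_comp m21 mt).
  apply: (@le_trans _ _ (m.+1%:R%:E * (x * (2 * eta * kappa))%:E)%E); last first.
    by rewrite -EFinM [_ * (x * _)]mulrA mx mul1r.
  apply: lee_wpmul2l; first by rewrite lee_fin.
  apply: (smooth_along_quotient x0 s21) => r /andP[r0 rx].
  have r01 : 0 <= r <= 1 by rewrite r0 (le_trans rx).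
  apply: le_trans (gradient_mean_tilt_le FY eta0 r01 FY1 FY2 h1 h2).
  by under eq_integral do rewrite mulN1r.
have iG : (\int[mu]_w (G w)%:E <= (eta * kappa)%:E)%E.
  have mB1 := vmeasurableB mY1 mY.
  apply: le_trans (strip_le hmu T0 j b0 mB1 eta0 h1).
  apply: ae_ge0_le_integral => //.
  - by move=> w _; rewrite lee_fin normr_ge0.
  - by apply/measurable_EFinP.
  - by move=> w _; apply: integral_ge0.
  - exact: (measurable_strip_norm mu j b mB1).
  - apply: filterS (malliavin_section_integrable hmu T0 j b0 FY) => w iY _.
    exact: (gradient_mean_dist (iY1 w) iY).
apply: (@le_trans _ _ (\int[mu]_w ((A w)%:E + ((B w)%:E + ((C w)%:E + ((E w)%:E + (G w)%:E)))))%E).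
  apply: ge0_le_integral => //.
  - apply/measurable_EFinP; apply: mnorm; apply: measurable_funB => //; apply: measurable_funM => //.
    by apply: measurable_funB => //; exact: (measurableT_comp mF mt).
  - by do !apply: emeasurable_funD; apply/measurable_EFinP.
  move=> w _; rewrite -!EFinD lee_fin.
  rewrite (_ : quotient F m w - _ = - (m.+1%:R * (F2 (tilt j b x w) - F (tilt j b x w)))
     + (m.+1%:R * (F2 w - F w) + (m.+1%:R * ((F2 (tilt j b x w) + -1 * F1 (tilt j b x w)) - (F2 w + -1 * F1 w))
     + ((m.+1%:R * (F1 (tilt j b x w) - F1 w) - gradient_mean j b Y1 w)
     + (gradient_mean j b Y1 w - gradient_mean j b Y w))))); last by rewrite -/x; ring.
  do 4 (apply: le_trans (ler_normD _ _) _; apply: lerD; first by rewrite ?normrN ?normrM ?normr_nat).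
  by [].
have A0 w : 0 <= A w by rewrite mulr_ge0.
have B0 w : 0 <= B w by rewrite mulr_ge0.
have C0' w : 0 <= C w by rewrite mulr_ge0.
have E0 w : 0 <= E w by exact: normr_ge0.
have G0 w : 0 <= G w by exact: normr_ge0.
rewrite !ge0_integralD//; try by move=> w _; rewrite ?adde_ge0// lee_fin.
all: try by do ?apply: emeasurable_funD; apply/measurable_EFinP.
rewrite (_ : eta * _ = eta * tilt_cst b 1 + (eta * tilt_cst b 1 + (2 * eta * kappa + (eta + eta * kappa)))); last by ring.
by rewrite !EFinD; do 4 (apply: leeD => //).
Qed.

End quotient_cvg.

(** * Identification of the two derivatives *)

Section vanishing.
Context {R : realType}.

Lemma cvge0_of_near (u : nat -> \bar R) (C : R) : (forall n, 0 <= u n)%E ->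
  (forall eta : R, 0 < eta -> \forall n \near \oo, (u n <= (eta * C)%:E)%E) -> u @ \oo --> 0%E.
Proof.
move=> u0 h.
have {}h (eta : R) : 0 < eta -> \forall n \near \oo, (u n <= eta%:E)%E.
  move=> eta0; have C0 : 0 < `|C| + 1 by rewrite ltr_wpDl.
  have := h (eta / (`|C| + 1)) (divr_gt0 eta0 C0); apply: filterS => n; move/le_trans; apply.
  rewrite lee_fin mulrAC ler_pdivrMr// ler_pM2l//.
  by apply: le_trans (ler_norm _) _; rewrite lerDl.
apply/fine_cvgP; split.
  apply: filterS (h 1 ltr01) => n hn; rewrite ge0_fin_numE//.
  by apply: le_lt_trans hn _; rewrite ltry.
apply/cvgrPdist_le => eta eta0; apply: filterS (h eta eta0) => n hn /=.
have un : u n \is a fin_num by rewrite ge0_fin_numE//; apply: le_lt_trans hn _; rewrite ltry.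
by rewrite sub0r normrN ger0_norm ?fine_ge0// -lee_fin fineK.
Qed.

(** Rational endpoints are all that is available, since each endpoint costs a null set of paths.
    Continuity gives [F x = 0], and the difference quotient is then 0 along rational points. *)
Lemma derive_dense_zero (F : R -> R) (x : R) :
  (forall q : rat, F (ratr q) = 0) -> derivable F x 1 -> F^`()%classic x = 0.
Proof.
move=> Fq dF; have cF : F @ x --> F x.
  by apply: differentiable_continuous; apply/derivable1_diffP.
have Fx : F x = 0.
  apply/eqP/negPn/negP => Fx0.
  have Fx1 : 0 < `|F x| by rewrite normr_gt0.
  have /cvgrPdist_lt /(_ _ Fx1) /nbhs_ballP[r /= r0 hr] := cF.
  have [|q] := @rat_in_itvoo R x (x + r); first by rewrite ltrDl.
  rewrite in_itv/= => /andP[q1 q2]; have := hr (ratr q).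
  rewrite Fq subr0 ltxx => h; apply/notF/h.
  by rewrite -ball_normE/= distrC gtr0_norm ?subr_gt0//; lra.
have Fcvg : (fun h : R => h^-1 *: ((F \o shift x) (h *: (1 : R)) - F x)) @ 0^' --> 'D_1 F x by exact: dF.
rewrite derive1E; apply/eqP/negPn/negP => l0.
have l1 : 0 < `|'D_1 F x| by rewrite normr_gt0.
have /cvgrPdist_lt /(_ _ l1) := Fcvg.
rewrite /dnbhs /within/= => /nbhs_ballP[r /= r0 hr].
have [|q] := @rat_in_itvoo R x (x + r); first by rewrite ltrDl.
rewrite in_itv/= => /andP[q1 q2]; have := hr (ratr q - x).
rewrite /= Fx subr0 [_ *: 1]mulr1 subrK Fq scaler0 subr0 ltxx => h; apply/notF/h.
  by rewrite -ball_normE/= sub0r normrN gtr0_norm ?subr_gt0//; lra.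
by rewrite subr_eq0 gt_eqF.
Qed.

End vanishing.

Section quotient_ae.
Context {R : realType} {T : R} {d : nat}.
Variable mu : probability (C0 T d) R.
Hypothesis hmu : wiener_measure mu.
Hypothesis T0 : 0 < T.
Variables (j : 'I_d) (b : time T).
Hypothesis b0 : 0 < clock b.
Local Notation quotient F m w :=
  (m.+1%:R * (F (tilt j b m.+1%:R^-1 w) - F w)).

(** Fatou's lemma compares the pointwise limit with the [L^1] limit. The limit [g] is extended-real,
    so that finiteness of the pathwise integral comes out as a conclusion. *)
Lemma quotient_limit_ae (F : C0 T d -> R) (Y : C0 T d * R -> 'rV[R]_d) (g : C0 T d -> \bar R) :
  malliavin_derivative mu F Y ->
  (forall w, (quotient F m w)%:E @[m --> \oo] --> g w) ->
  {ae mu, forall w, g w = (gradient_mean j b Y w)%:E}.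
Proof.
move=> FY Fg; have [mF mY _] := FY.
have mG := measurable_gradient_mean mu j b mY.
have mq m : measurable_fun [set: C0 T d] (fun w => quotient F m w).
  apply: measurable_funM => //; apply: measurable_funB => //.
  by apply: measurableT_comp => //; exact: measurable_tilt.
have mg : measurable_fun [set: C0 T d] g.
  apply: (@emeasurable_fun_cvg _ _ _ _ (fun m w => (quotient F m w)%:E)) => [m|w _].
    exact/measurable_EFinP.
  exact: Fg.
have mgG : measurable_fun [set: C0 T d] (fun w => g w - (gradient_mean j b Y w)%:E)%E.
  by apply: emeasurable_funB => //; exact/measurable_EFinP.
pose h m w := (`|quotient F m w - gradient_mean j b Y w|%:E : \bar R).
have mh m : measurable_fun [set: C0 T d] (h m).
  by apply/measurable_EFinP; apply: measurableT_comp => //; exact: measurable_funB.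
have h0 : (fun m => \int[mu]_w h m w)%E @ \oo --> 0%E.
  apply: (@cvge0_of_near _ _ (2 * tilt_cst b 1 + 3 * ((1 + clock b * expR (clock b)) / 2) + 1)) => [m|eta eta0].
    by apply: integral_ge0 => w _; rewrite lee_fin normr_ge0.
  exact: (quotient_le hmu T0 j b0 FY eta0).
have hlim w : h ^~ w @ \oo --> `|g w - (gradient_mean j b Y w)%:E|%E.
  rewrite (_ : h ^~ w = (fun m => `|(quotient F m w)%:E - (gradient_mean j b Y w)%:E|%E))//.
  apply: cvg_abse; apply: cvgeB; first by rewrite fin_num_adde_defl.
    exact: Fg.
  exact: cvg_cst.
have I0 : (\int[mu]_w `|g w - (gradient_mean j b Y w)%:E| = 0)%E.
  apply/eqP; rewrite eq_le; apply/andP; split; last exact: integral_ge0.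
  have F0 : (\int[mu]_w limn_einf (h ^~ w) <= limn_einf (fun m => \int[mu]_w h m w))%E.
    by apply: fatou => // m w _; rewrite lee_fin normr_ge0.
  have [E0 _] := cvg_limn_einf_sup h0; rewrite -E0; apply: le_trans F0.
  rewrite le_eqVlt; apply/orP; left; apply/eqP; apply: eq_integral => w _.
  by have [-> _] := cvg_limn_einf_sup (hlim w).
have := (ae_eq_integral_abs mu measurableT mgG).1 I0.
apply: filterS => w /(_ Logic.I) /=.
case: (g w) => [r| |]//= /eqP.
by rewrite -EFinD eqe subr_eq0 => /eqP ->.
Qed.

End quotient_ae.

Section vanishing_primitive.
Context {R : realType}.
Local Notation leb := (@lebesgue_measure R).

Lemma ae_zero_of_primitive (h : R -> R) : leb.-integrable setT (EFin \o h) ->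
  (forall q : rat, (\int[leb]_(t in `]-oo, (ratr q : R)%R]) h t)%R = 0) ->
  {ae leb, forall t, h t = 0}.
Proof.
move=> ih hq.
have iS y : leb.-integrable `]-oo, y] (EFin \o h) by exact: integrableS ih.
have loc : locally_integrable [set: R] h.
  by apply: open_integrable_locally => //; exact: openT.
move: (FTC1Ny iS loc); apply: filterS; first exact: (ae_filter_ringOfSetsType leb).
move=> t [dF <-].
exact: derive_dense_zero.
Qed.

Lemma ae_zero_of_primitive_itv (T : R) (u : R -> R) : leb.-integrable `]0, T] (EFin \o u) ->
  (forall q : rat, 0 < Num.min (ratr q) T -> (\int[leb]_(t in `]0%R, Num.min (ratr q) T]) u t)%R = 0) ->
  {ae leb, forall t, 0 < t <= T -> u t = 0}.
Proof.
move=> iu uq.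
have ih : leb.-integrable setT (EFin \o (u \_ `]0, T])).
  by rewrite -restrict_EFin; apply/(integrable_mkcond _ _).1.
suff : {ae leb, forall t, (u \_ `]0, T]) t = 0}.
  apply: filterS; first exact: (ae_filter_ringOfSetsType leb).
  by move=> t + tT; rewrite patchE mem_set//= in_itv/= tT.
apply: ae_zero_of_primitive ih _ => q.
rewrite -Rintegral_mkcondr.
have -> : (`]-oo, (ratr q : R)] `&` `]0, T] : set R) = `]0, Num.min (ratr q) T]%classic.
  apply/seteqP; split => t; rewrite /= !in_itv/=.
    by move=> [tq /andP[t0 tT]]; rewrite t0 le_min tq.
  by move=> /andP[t0]; rewrite le_min => /andP[tq tT]; split => //; rewrite t0.
have [/uq//|q0] := ltP 0 (Num.min (ratr q) T).
by rewrite set_itv_ge ?Rintegral_set0// bnd_simp -leNgt.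
Qed.

End vanishing_primitive.

Section product_ae.
Context {R : realType} dX (X : measurableType dX) (m : probability X R).
Local Notation leb := (@lebesgue_measure R).

Lemma ae_product_snd (P : R -> Prop) : {ae leb, forall t, P t} ->
  {ae (m \x leb)%E, forall p : X * R, P p.2}.
Proof.
move=> [N [mN N0 PN]]; exists (setT `*` N); split.
- exact: measurableX.
- by rewrite product_measure1E//; rewrite [X in (_ * X)%E]N0 mule0.
- by move=> [w t] /= nP; split => //; exact: PN.
Qed.

(** Null sections make a null set through Tonelli, for which [v] must be jointly measurable; this is
    why [Y] is compared with the left limit before the derivative itself. *)
Lemma ae_product_strip (A : set R) (v : X * R -> R) : measurable A ->
  measurable_fun ([set: X] `*` A) v ->
  {ae m, forall w, {ae leb, forall t, A t -> v (w, t) = 0}} ->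
  {ae (m \x leb)%E, forall p, A p.2 -> v p = 0}.
Proof.
move=> mA mv v0.
have mD : measurable ([set: X] `*` A) by exact: measurable_strip.
have ma : measurable_fun ([set: X] `*` A) (fun p => `|v p|%:E).
  by apply/measurable_EFinP; exact: measurableT_comp.
have [mi E] := tonelli_strip m mA ma (fun p => normr_ge0 _).
have mE : measurable_fun ([set: X] `*` A) (EFin \o v) by exact/measurable_EFinP.
have I0 : (\int[m \x leb]_(p in [set: X] `*` A) `|(EFin \o v) p| = 0)%E.
  rewrite -[RHS](@integral0 _ _ _ m setT); transitivity (\int[m]_w \int[leb]_(t in A) `|v (w, t)|%:E)%E.
    exact: E.
  apply: ge0_ae_eq_integral => //.
  - by move=> w _; exact: integral_ge0.
  apply: filterS v0 => w vw _.
  rewrite -[RHS](@integral0 _ _ _ leb A); apply: ge0_ae_eq_integral => //.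
  - apply/measurable_EFinP; apply: (@measurable_comp _ _ _ _ _ _ setT) => //.
    apply: (@measurable_comp _ _ _ _ _ _ ([set: X] `*` A) v) => //.
    + by move=> _ [t tA <-].
    + by apply: measurable_funTS; exact: measurable_pair1.
  - move: vw; apply: filterS; first exact: (ae_filter_ringOfSetsType leb).
    by move=> t vt /vt ->; rewrite normr0.
have := (ae_eq_integral_abs (m \x leb)%E mD mE).1 I0.
by apply: filterS => -[w t] h At; have /= [] := h (conj Logic.I At).
Qed.

End product_ae.

Section coordinate.
Context {R : realType} {T : R} {d : nat}.
Variable mu : probability (C0 T d) R.
Hypothesis hmu : wiener_measure mu.
Hypothesis T0 : 0 < T.
Variables (f : C0 T d -> R) (ft : cadlag T d -> R) (Dft : time T -> cadlag T d -> 'rV[R]_d).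
Hypothesis fE : forall w : C0 T d, ft (C0_cadlag w) = f w.
Hypothesis dft : pathwise_derivative ft Dft.
Hypothesis cft : continuous ft.
Hypothesis cDft : forall t, continuous (Dft t).
Hypothesis lDft : forall t, has_left_limit Dft t.
Hypothesis bDft : boundedness_preserving Dft.
Variable Y : C0 T d * R -> 'rV[R]_d.
Hypothesis FY : malliavin_derivative mu f Y.
Variable j : 'I_d.
Local Notation leb := (@lebesgue_measure R).
Local Notation grad := (left_gradient (ltW T0) lDft j).
Local Notation gradT p := (if 0 < p.2 <= T then grad p.2 (C0_cadlag p.1) else 0).

Lemma integral_left_gradient (b : time T) : 0 < clock b ->
  {ae mu, forall w, leb.-integrable `]0, clock b] (fun t => (gradT (w, t))%:E) /\
    leb.-integrable `]0, clock b] (fun t => (Y (w, t) 0 j)%:E) /\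
    (\int[leb]_(t in `]0%R, clock b]) (Y (w, t) 0 j - gradT (w, t)))%R = 0}.
Proof.
move=> b0.
have gE w : (\int[leb]_(t in `]0%R, clock b]) (grad t (C0_cadlag w))%:E =
    \int[leb]_(t in `]0%R, clock b]) (gradT (w, t))%:E)%E.
  apply: eq_integral => t; rewrite inE /= in_itv/= => /andP[t0 tb].
  by rewrite t0 (le_trans tb (clock_le b)).
have q_cvg w : (m.+1%:R * (f (tilt j b m.+1%:R^-1 w) - f w))%:E @[m --> \oo] -->
    (\int[leb]_(t in `]0%R, clock b]) (gradT (w, t))%:E)%E.
  rewrite -gE (_ : (fun m => _) = (fun m => (m.+1%:R * (ft (C0_cadlag (tilt j b m.+1%:R^-1 w)) - ft (C0_cadlag w)))%:E)).
    exact: pathwise_quotient.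
  by apply/funext => m; rewrite !fE.
apply: filterS2 (malliavin_section_integrable hmu T0 j b0 FY) (quotient_limit_ae hmu T0 b0 FY q_cvg) => w iY wE.
have mg : measurable_fun `]0, clock b] (fun t => gradT (w, t)).
  apply: measurable_funTS.
  exact: (measurableT_comp (measurable_left_gradient T0 cDft lDft j) (measurable_pair1 w)).
(* Integrability is read off [wE]: the integral equals a real number, hence is finite. *)
have ig : leb.-integrable `]0, clock b] (fun t => (gradT (w, t))%:E).
  apply/integrableP; split; first exact/measurable_EFinP.
  have h : (\int[leb]_(t in `]0%R, clock b]) `|gradT (w, t)|%:E < +oo)%E.
    by rewrite (integral_fin_num_abs leb)// wE.
  exact: h.
split => //; split => //.
rewrite RintegralB// /Rintegral.
have -> : (\int[leb]_(t in `]0%R, clock b]) (gradT (w, t))%:E = (gradient_mean j b Y w)%:E)%E := wE.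
by rewrite /= subrr.
Qed.

Lemma malliavin_left_gradient_ae :
  {ae (mu \x leb)%E, forall p, `]0, T]%classic p.2 -> Y p 0 j - gradT p = 0}.
Proof.
have [mF mY _] := FY.
have mD : measurable ([set: C0 T d] `*` (`]0%R, T]%classic : set R)).
  by apply: measurable_strip; exact: measurable_itv.
have mD0 : measurable ([set: C0 T d] `*` (`[0%R, T]%classic : set R)).
  by apply: measurable_strip; exact: measurable_itv.
have sub : [set: C0 T d] `*` (`]0%R, T]%classic : set R) `<=` [set: C0 T d] `*` `[0%R, T]%classic.
  by move=> [w t] [_ /=]; rewrite !in_itv/= => /andP[/ltW -> ->].
apply: (ae_product_strip (v := fun p => Y p 0 j - gradT p)).
- exact: measurable_itv.
- apply: measurable_funB.
    exact: (measurable_funS mD0 sub (mY j)).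
  exact: (measurable_funTS (measurable_left_gradient T0 cDft lDft j)).
pose bq (q : rat) := tclamp (ltW T0) (ratr q).
have bqE q : 0 < Num.min (ratr q) T -> clock (bq q) = Num.min (ratr q) T.
  by move=> q0; rewrite clock_tclamp max_r// ltW.
have bT : clock (tclamp (ltW T0) T) = T by rewrite clock_tclamp_id// lexx ltW.
(* Each endpoint has its own null set of paths; enumerating the rationals through [unpickle] keeps
   the union countable. *)
have hq (n : nat) : {ae mu, forall w, forall q : rat, unpickle n = Some q -> 0 < Num.min (ratr q) T ->
    (\int[leb]_(t in `]0%R, Num.min (ratr q) T]) (Y (w, t) 0 j - gradT (w, t)))%R = 0}.
  case: (unpickle n : option rat) => [q|]; last by apply: aeW.
  have [q0|q0] := boolP (0 < Num.min (ratr q) T); last first.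
    by apply: aeW => w q' [<-]; rewrite (negbTE q0).
  have q0' : 0 < clock (bq q) by rewrite bqE.
  have := integral_left_gradient q0'; rewrite bqE//.
  by apply: filterS => w [_ [_ h]] q' [<-].
(* The endpoint [T] supplies integrability on the whole interval, as Lebesgue differentiation
   requires. *)
have T0' : 0 < clock (tclamp (ltW T0) T) by rewrite bT.
have := integral_left_gradient T0'; rewrite bT => hT.
apply: filterS2 hT (ae_foralln hq) => w [ig [iY _]] hw.
apply: ae_zero_of_primitive_itv => [|q q0].
  exact: (integrableB _ iY ig).
exact: (hw (pickle q) q (pickleK q)).
Qed.

End coordinate.

Theorem proposition3p9 (R : realType) (T : R) (hT : 0 < T) (d : nat)
    (mu : probability (C0 T d) R) (hmu : wiener_measure mu)
    (f : C0 T d -> R) (hf : D1b f) (hF : D12 mu f) :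
  forall Df : time T -> C0 T d -> 'rV[R]_d, D1b_derivative f Df ->
  forall Y : C0 T d * R -> 'rV[R]_d, malliavin_derivative mu f Y ->
  {ae (mu \x lebesgue_measure)%E, forall p : C0 T d * R,
    forall t : time T, p.2 = clock t -> Df t p.1 = Y p}.
Proof.
move=> Df [ft [Dft [[fE dft [cft cDft] lDft bDft] DfE]]] Y FY.
have FF : Filter (nbhs (almost_everywhere (mu \x lebesgue_measure)%E)) := ae_filter_ringOfSetsType _.
have coord (j : 'I_d) : {ae (mu \x lebesgue_measure)%E, forall p : C0 T d * R,
    forall t : time T, p.2 = clock t -> Df t p.1 0 j = Y p 0 j}.
  have [N cN gradN] := left_gradient_ae hT cDft lDft j.
  have null (A : set R) : countable A -> {ae (@lebesgue_measure R), forall t, ~ A t}.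
    move=> cA; exists A; split; [|exact: countable_lebesgue_measure0|by move=> t /= /contrapT].
    by apply: countable_measurable => // t; exact: measurable_set1.
  (* The exceptional times do not depend on the path, so they span a null set of the product. Time
     0, which has no times to its left, is discarded in the same way. *)
  have h1 := ae_product_snd mu (null _ cN).
  have h2 := ae_product_snd mu (null _ (countable1 0)).
  have h3 := malliavin_left_gradient_ae hmu hT fE dft cft cDft lDft bDft FY j.
  apply: filterS3 h1 h2 h3 => -[w s] /= Ns n0 YE t st.
  have s0 : 0 < s <= T.
    rewrite st clock_le andbT lt_neqAle clock_ge0 andbT eq_sym.
    by apply/eqP => t0; apply: n0; rewrite st.
  have {}YE := YE s0; rewrite s0 in YE.
  rewrite DfE -(tclamp_clock (ltW hT) t) -st gradN//.
  by move/eqP: YE; rewrite subr_eq0 => /eqP ->.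
apply: filterS (filter_forall _ coord) => p pE t pt.
by apply/rowP => j; exact: pE.
Qed.
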